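(* Suppose $p=\Omega(\log n)$ and $p=o(e^n)$. There exist a universal constant $A>3$ and a constant $D_0>0$ such that the event $$\mathcal{E}:=\Big\{|\nu_n(f)-\nu_n(f^* )|\le D_0\Big(\sqrt{\tfrac{\log p}{n}}\,\|\boldsymbol\beta-\boldsymbol\beta^*\|_1+\gamma_n\|g-g^*\|_2+\gamma_n^2\|g-g^*\|_K+e^{-p}\Big)\ \text{ for all } f=\boldsymbol\beta'Z+g(T)\in\mathcal{F}\Big\}$$ satisfies $$\mathbb{P}(\mathcal{E})\ge 1-2p^{-A/2}-16p^{3-A}.$$
   Context: Setting. $(X,Y)$ is a random vector with unknown joint distribution $\rho$, where $Y\in\{-1,+1\}$ and $X=(Z,T)'$ with $Z\in\mathbb{R}^p$ and $T\in\mathcal{T}$ ($\mathcal{T}$ compact, of fixed dimension). $\{(Y_i,Z_i,T_i)\}_{i=1}^n$ is an i.i.d. sample from $\rho$. A prime on a vector denotes transpose. RKHS. $K:\mathcal{T}\times\mathcal{T}\to\mathbb{R}$ is a symmetric positive semidefinite kernel with reproducing kernel Hilbert space $\mathcal{H}_K$, norm $\|\cdot\|_K$, and $\max_{t\in\mathcal{T}}K(t,t)<\infty$. Its Mercer decomposition is $K(t,t')=\sum_{\ell\ge1}\mu_\ell\phi_\ell(t)\phi_\ell(t')$ with eigenvalues $\mu_1\ge\mu_2\ge\cdots>0$ and $\{\phi_\ell\}$ orthonormal in $L_2(\rho_T)$, where $\rho_T$ is the law of $T$. Model and risks. $\mathcal{F}=\{f(X)=\boldsymbol\beta'Z+g(T):\boldsymbol\beta\in\mathbb{R}^p,\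 g\in\mathcal{H}_K\}$. With the hinge loss $\phi_h(u)=(1-u)_+$, for $f\in\mathcal{F}$ set $\mathcal{R}(f)=\mathbb{E}[\phi_h(Yf(X))]$, $\mathcal{R}_n(f)=\frac1n\sum_{i=1}^n\phi_h(Y_if(X_i))$, and $\nu_n(f)=\mathcal{R}_n(f)-\mathcal{R}(f)$. The target $f^*(X)=(\boldsymbol\beta^* )'Z+g^*(T)$, with $g^*\in\mathcal{H}_K$, is a global minimizer of $\mathcal{R}$ over $\mathcal{F}$. Norms. $\|\cdot\|_1$ is the $\ell_1$-norm of a vector; $\|g\|_2$ is the $L_2$-norm of a function with respect to the distribution of the covariates. Rates. For $r>0$, $\mathcal{Q}_n(r)=\frac{1}{\sqrt n}\big[\sum_{\ell\ge1}\min\{r^2,\mu_\ell\}\big]^{1/2}$; the number $\nu_n$ (not to be confused with the process $\nu_n(f)$) is the smallest positive solution of $40\nu_n^2\ge\mathcal{Q}_n(\nu_n)$; $\gamma_n=\max\{\nu_n,\sqrt{\log p/n}\}$. $a_n=\Omega(b_n)$ means $a_n\ge Cb_n$ for some positive constant $C$. Standing assumption (Assumption A). (i) $\|Z\|_\infty\le C_0<\infty$ for some positive constant $C_0$; (ii) the largest eigenvalue of $\mathbb{E}[ZZ']$ is finite, denoted $\Lambda_{\max}>0$. The constant $D_0$ does not depend on $n$, $p$ or $f$. *)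

(* Defs.v *)
From HB Require Import structures.
From mathcomp Require Import all_boot all_order all_algebra.
From mathcomp Require Import all_classical all_reals all_analysis.

Set Implicit Arguments.
Unset Strict Implicit.
Unset Printing Implicit Defensive.

Import Order.TTheory GRing.Theory Num.Theory.
Import numFieldNormedType.Exports.

Local Open Scope classical_set_scope.
Local Open Scope ring_scope.

(* Kernels and reproducing kernel Hilbert spaces on a set D.  A function on D
   is represented by its extension by 0 to the ambient type X, so that equality
   in the space is equality of functions. *)
Section rkhs.
Context {R : realType} {X : Type}.
Implicit Types (D : set X) (K : X -> X -> R) (H : set (X -> R))
  (ip : (X -> R) -> (X -> R) -> R) (g h : X -> R).

Definition psd_kernel D K : Prop :=
  (forall s t, D s -> D t -> K s t = K t s) /\
  (forall (m : nat) (x : 'I_m -> X) (c : 'I_m -> R), (forall i, D (x i)) ->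
     0 <= \sum_(i < m) \sum_(j < m) c i * c j * K (x i) (x j)).

Definition ksection D K (t : X) : X -> R :=
  fun s => if s \in D then K s t else 0.

Definition ip_norm ip g : R := Num.sqrt (ip g g).

Record is_rkhs D K H ip : Prop := {
  rkhs_supp : forall g t, H g -> ~ D t -> g t = 0 ;
  rkhs_zero : H (cst 0) ;
  rkhs_comb : forall (a : R) g h, H g -> H h -> H (a \*o g \+ h) ;
  rkhs_sym : forall g h, H g -> H h -> ip g h = ip h g ;
  rkhs_lin : forall (a : R) g g' h, H g -> H g' -> H h ->
    ip (a \*o g \+ g') h = a * ip g h + ip g' h ;
  rkhs_ge0 : forall g, H g -> 0 <= ip g g ;
  rkhs_def : forall g, H g -> ip g g = 0 -> g = cst 0 ;
  rkhs_complete : forall u : nat -> X -> R, (forall k, H (u k)) ->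
    (forall e : R, 0 < e -> exists N : nat, forall k l : nat,
       (N <= k)%N -> (N <= l)%N -> ip_norm ip (u k \- u l) < e) ->
    exists2 g, H g & ip_norm ip (u k \- g) @[k --> \oo] --> (0 : R) ;
  rkhs_section : forall t, D t -> H (ksection D K t) ;
  rkhs_reproducing : forall g t, H g -> D t -> ip g (ksection D K t) = g t
}.

End rkhs.

(* The case l = m of mercer_orthonormal forces phi l to be square-integrable,
   an infinite integral having real value 0. *)
Record is_mercer {R : realType} {dX : measure_display} {X : measurableType dX}
    (D : set X) (K : X -> X -> R) (rhoX : probability X R)
    (mu : nat -> R) (phi : nat -> X -> R) : Prop := {
  mercer_gt0 : forall l, 0 < mu l ;
  mercer_nonincr : forall l m, (l <= m)%N -> mu m <= mu l ;
  mercer_meas : forall l, measurable_fun D (phi l) ;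
  mercer_orthonormal : forall l m,
    \int[rhoX]_(t in D) (phi l t * phi m t) = (l == m)%:R ;
  mercer_expansion : forall s t, D s -> D t ->
    series (fun l => mu l * phi l s * phi l t) @ \oo --> K s t
}.

Definition is_iid {R : realType} {dO dS : measure_display}
    {Omega : measurableType dO} {S : measurableType dS}
    (P : probability Omega R) (rho : probability S R) (n : nat)
    (W : 'I_n -> {RV P >-> S}) : Prop :=
  (forall i (B : set S), measurable B -> distribution P (W i) B = rho B) /\
  (forall (J : {set 'I_n}) (B : 'I_n -> set S), (forall i, measurable (B i)) ->
     P (\bigcap_(i in [set` J]) (W i @^-1` B i)) =
     (\prod_(i in J) P (W i @^-1` B i))%E).

Definition largest_eigenvalue {R : realType} {p : nat} (M : 'M[R]_p) (a : R)
    : Prop :=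
  eigenvalue M a /\ (forall b, eigenvalue M b -> b <= a).

(* MathComp-Analysis puts the product Borel sigma-algebra on tuples and the
   usual topology on row vectors; this is the identification of the two. *)
Definition row_of_tuple {R : realType} {d : nat} (t : d.-tuple R) : 'rV[R]_d :=
  \row_j tnth t j.

(* An observation (Y, Z, T). *)
Notation obs R p d := (R * p.-tuple R * d.-tuple R)%type.

Section model.
Context {R : realType} {p d : nat}.

Definition obsY (w : obs R p d) : R := w.1.1.
Definition obsZ (w : obs R p d) : p.-tuple R := w.1.2.
Definition obsT (w : obs R p d) : d.-tuple R := w.2.

Definition decision (beta : 'rV[R]_p) (g : d.-tuple R -> R) (w : obs R p d) : R :=
  \sum_(j < p) beta ord0 j * tnth (obsZ w) j + g (obsT w).

Definition hinge (u : R) : R := Num.max (1 - u) 0.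

Definition margin_loss beta g (w : obs R p d) : R :=
  hinge (obsY w * decision beta g w).

Definition risk (rho : probability (obs R p d) R) beta g : R :=
  fine ('E_rho[margin_loss beta g]).

Definition emp_risk {n : nat} (w : 'I_n -> obs R p d) beta g : R :=
  n%:R^-1 * \sum_(i < n) margin_loss beta g (w i).

Definition emp_process (rho : probability (obs R p d) R) {n : nat}
    (w : 'I_n -> obs R p d) beta g : R :=
  emp_risk w beta g - risk rho beta g.

Definition risk_minimizer (rho : probability (obs R p d) R)
    (H : set (d.-tuple R -> R)) beta0 g0 : Prop :=
  H g0 /\ (forall beta g, H g -> risk rho beta0 g0 <= risk rho beta g).

Definition second_moment (rho : probability (obs R p d) R) : 'M[R]_p :=
  \matrix_(i, j) fine ('E_rho[fun w => tnth (obsZ w) i * tnth (obsZ w) j]).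

(* The largest eigenvalue depends on the dimension p; Lmax is a bound for it
   that does not. *)
Definition assumption_A (C0 Lmax : R) (rho : probability (obs R p d) R) : Prop :=
  {ae rho, forall w, forall j, `|tnth (obsZ w) j| <= C0} /\
  (exists2 a, largest_eigenvalue (second_moment rho) a & 0 < a <= Lmax).

Definition l1norm (beta : 'rV[R]_p) : R := \sum_(j < p) `|beta ord0 j|.

End model.

Definition L2norm {R : realType} {dX : measure_display} {X : measurableType dX}
    (rhoX : probability X R) (g : X -> R) : R :=
  fine ('N[rhoX]_2%:E[EFin \o g])%E.

Section rates.
Context {R : realType}.

Definition Qn (mu : nat -> R) (n : nat) (r : R) : R :=
  (Num.sqrt n%:R)^-1 *
  Num.sqrt (limn (series (fun l => Num.min (r ^+ 2) (mu l)))).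

Definition is_critical_radius (mu : nat -> R) (n : nat) (nu : R) : Prop :=
  [/\ 0 < nu, Qn mu n nu <= 40 * nu ^+ 2 &
      forall r, 0 < r -> Qn mu n r <= 40 * r ^+ 2 -> nu <= r].

Definition gamma_rate (nu : R) (n p : nat) : R :=
  Num.max nu (Num.sqrt (ln p%:R / n%:R)).

Definition Omega_log (p : nat -> nat) : Prop :=
  exists2 C : R, 0 < C & forall n, C * ln n%:R <= (p n)%:R.

Definition little_o_exp (p : nat -> nat) : Prop :=
  (fun n => (p n)%:R : R^o) =o_\oo (fun n => expR n%:R : R^o).

End rates.
Arguments Omega_log : clear implicits.
Arguments little_o_exp : clear implicits.

Section event.
Context {R : realType} {dO : measure_display} {Omega : measurableType dO}.
Context {p d n : nat}.

(* nu is the critical radius nu_n, as opposed to the process nu_n(f). *)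
Definition good_event (P : probability Omega R) (W : 'I_n -> {RV P >-> obs R p d})
    (rho : probability (obs R p d) R) (rhoT : probability (d.-tuple R) R)
    (H : set (d.-tuple R -> R))
    (ip : (d.-tuple R -> R) -> (d.-tuple R -> R) -> R)
    (beta0 : 'rV[R]_p) (g0 : d.-tuple R -> R) (nu D0 : R) : set Omega :=
  [set omega | forall (beta : 'rV[R]_p) (g : d.-tuple R -> R), H g ->
    let w := fun i => W i omega in
    let gam := gamma_rate nu n p in
    `|emp_process rho w beta g - emp_process rho w beta0 g0| <=
    D0 * (Num.sqrt (ln p%:R / n%:R) * l1norm (beta - beta0)
          + gam * L2norm rhoT (g \- g0)
          + gam ^+ 2 * ip_norm ip (g \- g0)
          + expR (- p%:R))].

End event.

(* Main.v *)
Require Import Defs.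
From HB Require Import structures.
From mathcomp Require Import all_boot all_order all_algebra.
From mathcomp Require Import all_classical all_reals all_analysis.
From mathcomp Require Import measurable_realfun ring lra.
Import Order.TTheory GRing.Theory Num.Theory.
Import numFieldNormedType.Exports.
Local Open Scope classical_set_scope.
Local Open Scope ring_scope.

Set Implicit Arguments.
Unset Strict Implicit.
Unset Printing Implicit Defensive.

(** Why the bound holds.  Take [A = 4], put [l = ln p] and [lam = sqrt (l / n)],
    and let [rate f] be the right-hand side of the event without [D0].  If
    [p <= 16] the claimed probability is not positive, so let [l >= 1] and
    [32 * expR (- (2 * l)) <= 1].

    The excess of [f] over the target is divided by [rate f].  With
    [sc = 1 / rate f], [tau = 1 - Y f0(X)] and [Delta = sc (f - f0)(X)], the
    normalised increment of the hinge loss is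
        [pos_part (sc * tau - Y * Delta) - pos_part (sc * tau)],
    and the claim becomes: with probability at least [1 - 16 * expR (- (2 * l))],
    all the normalised increments have empirical means within a constant of their
    expectations.  The normalisation turns each term of the rate into a
    constraint: the linear part of [Delta] has [l1]-norm at most [1 / lam], and
    the kernel part, in the orthonormal basis of the kernel space given by the
    scaled eigenfunctions, lies in an ellipsoid with weights
    [wt_i = mu_i * gamma^2 + gamma^4].  Working with all scales at once replaces
    the usual peeling over shells.

    Expectation over random signs.  The increment depends on [sc * tau] only up to
    the size of [Delta] ([pos_part_clip]), so the contraction principle
    ([rsup_contraction]) splits its Rademacher complexity into three: that of the
    clipped scales, a one-parameter family that Doob's maximal inequality handles
    once the observations are sorted ([rsup_clip]); that of an [l1]-ball, a
    maximum of [p] coordinates ([rsup_l1_ball]); and that of an ellipsoid, a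
    Euclidean norm ([rsup_ellipsoid]).  The last one is governed by the sample sum
    of [envelope], the square of the norm dual to the ellipsoid, whose mean is at
    most [2 * 40^2 * n] by the definition of the critical radius
    ([critical_radius_sum_ge]).

    Concentration.  A ghost sample and random exchanges reduce a deviation of the
    empirical process to a large Rademacher sum given two samples
    ([ghost_symmetrization]), and Talagrand's convex distance inequality on the
    cube ([talagrand_convex_distance]) bounds the latter with the Euclidean norm of
    the increments as deviation scale.  The same argument first bounds the sum of
    the envelope, then the sums of squared kernel parts, and finally the process
    itself ([hinge_class_deviation]).

    Functions.  The space is only given abstractly, so the expansion in
    eigenfunctions has to be established: they belong to the space by a Riesz
    argument ([rkhs_of_bounded]), are orthonormal in it, and their finite
    combinations are dense ([comb_dense]).  Hence the event is determined by
    countably many decision functions with rational coefficients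
    ([good_event_rational]); this gives measurability and reduces the bound to
    finite classes, by continuity of the measure. *)

(** * Averages over signs *)

Section rademacher.
Context {R : realType}.
Implicit Types (F G : seq bool -> R) (n : nat) (s : seq bool) (v : nat -> R).

(** Uniform averages over the sign patterns of length [n], [true] standing for
    the sign [-1].  The recursion gives inductions on the dimension. *)
Fixpoint rad n F : R :=
  if n is m.+1 then
    (rad m (fun s => F (true :: s)) + rad m (fun s => F (false :: s))) / 2
  else F [::].

Definition rsum n s v : R := \sum_(i < n) (-1) ^+ nth false s i * v i.

Lemma rsumS n b s v :
  rsum n.+1 (b :: s) v = (-1) ^+ b * v 0 + rsum n s (v \o succn).
Proof. by rewrite /rsum big_ord_recl. Qed.

Lemma rsumD n s v w : rsum n s (fun i => v i + w i) = rsum n s v + rsum n s w.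
Proof. by rewrite /rsum -big_split/=; apply: eq_bigr => i _; rewrite mulrDr. Qed.

Lemma rsumZ n s (c : R) v : rsum n s (fun i => c * v i) = c * rsum n s v.
Proof. by rewrite /rsum mulr_sumr; apply: eq_bigr => i _; rewrite mulrCA. Qed.

Lemma rsumN n s v : rsum n s (fun i => - v i) = - rsum n s v.
Proof. by rewrite /rsum -sumrN; apply: eq_bigr => i _; rewrite mulrN. Qed.

Lemma rsum_sum n s (I : Type) (r : seq I) (w : I -> nat -> R) :
  rsum n s (fun i => \sum_(k <- r) w k i) = \sum_(k <- r) rsum n s (w k).
Proof.
rewrite /rsum exchange_big/=; apply: eq_bigr => i _.
by rewrite mulr_sumr.
Qed.

Lemma le_rad n F G : (forall s, size s = n -> F s <= G s) -> rad n F <= rad n G.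
Proof.
elim: n F G => [|n IH] F G FG /=; first exact: FG.
rewrite ler_pM2r// lerD//; apply: IH => s sn; apply: FG; by rewrite /= sn.
Qed.

Lemma eq_rad n F G : (forall s, size s = n -> F s = G s) -> rad n F = rad n G.
Proof.
by move=> FG; apply/eqP; rewrite eq_le; apply/andP; split; apply: le_rad => s sn;
  rewrite FG.
Qed.

Lemma rad_cst n (c : R) : rad n (fun=> c) = c.
Proof. by elim: n => //= n ->; field. Qed.

Lemma radD n F G : rad n (fun s => F s + G s) = rad n F + rad n G.
Proof. by elim: n F G => //= n IH F G; rewrite !IH; field. Qed.

Lemma radZ n (c : R) F : rad n (fun s => c * F s) = c * rad n F.
Proof. by elim: n F => //= n IH F; rewrite !IH; field. Qed.

Lemma rad_sum n (I : Type) (r : seq I) (F : I -> seq bool -> R) :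
  rad n (fun s => \sum_(k <- r) F k s) = \sum_(k <- r) rad n (F k).
Proof.
elim: r => [|k r IH].
  by under eq_rad do rewrite big_nil; rewrite rad_cst big_nil.
by under eq_rad do rewrite big_cons; rewrite radD IH big_cons.
Qed.

Lemma rad_ge0 n F : (forall s, size s = n -> 0 <= F s) -> 0 <= rad n F.
Proof. by move=> F0; rewrite -(rad_cst n 0); exact: le_rad. Qed.

Lemma rad_flip n F : rad n (fun s => F (map negb s)) = rad n F.
Proof.
elim: n F => //= n IH F.
by rewrite (IH (fun s => F (false :: s))) (IH (fun s => F (true :: s))) addrC.
Qed.

Lemma rsum_flip n s v : size s = n -> rsum n (map negb s) v = - rsum n s v.
Proof.
move=> sn; rewrite /rsum -sumrN; apply: eq_bigr => i _.
rewrite (nth_map false) ?sn// signrN mulNr//.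
Qed.

(** The cross terms average out one sign at a time. *)
Lemma rad_sqr n (c : R) v :
  rad n (fun s => (c + rsum n s v) ^+ 2) = c ^+ 2 + \sum_(i < n) v i ^+ 2.
Proof.
elim: n c v => [|n IH] c v /=; first by rewrite /rsum !big_ord0 !addr0.
under eq_rad do rewrite rsumS addrA.
rewrite IH; under eq_rad do rewrite rsumS addrA.
by rewrite IH big_ord_recl/= expr0 expr1; set x := \sum_(_ < _) _; field.
Qed.

End rademacher.

(** * The contraction principle *)

Section finite_max.
Context {R : realType} {T : finType} (j0 : T).
Implicit Types f g : T -> R.

Definition fmax f : R := \big[Num.max/f j0]_(j : T) f j.

Lemma fmax_ge f j : f j <= fmax f.
Proof. exact: le_bigmax. Qed.

Lemma fmax_ex f : exists j, fmax f = f j.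
Proof.
rewrite /fmax; elim: (index_enum T) => [|k r [j IH]].
  by exists j0; rewrite big_nil.
rewrite big_cons IH; case: (leP (f k) (f j)) => _; first by exists j.
by exists k.
Qed.

Lemma fmax_le f c : (forall j, f j <= c) -> fmax f <= c.
Proof. by move=> fc; have [j ->] := fmax_ex f. Qed.

Lemma le_fmax f g : (forall j, f j <= g j) -> fmax f <= fmax g.
Proof. by move=> fg; apply: fmax_le => j; exact: le_trans (fg j) (fmax_ge _ _). Qed.

Lemma fmaxD f g : fmax (fun j => f j + g j) <= fmax f + fmax g.
Proof. by apply: fmax_le => j; rewrite lerD// fmax_ge. Qed.

(** The one-coordinate case of the contraction principle: if the maxima on the
    left are attained at [j] and [k], then only [phi j - phi k] matters, and the
    sign of [v j - v k] decides which of [j], [k] serves which maximum. *)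
Lemma fmax_contract f phi v :
  (forall j k, `|phi j - phi k| <= `|v j - v k|) ->
  fmax (fun j => f j - phi j) + fmax (fun j => f j + phi j) <=
  fmax (fun j => f j - v j) + fmax (fun j => f j + v j).
Proof.
move=> phiv.
have [j ->] := fmax_ex (fun j => f j - phi j).
have [k ->] := fmax_ex (fun j => f j + phi j).
have H1 : forall i, f i - v i <= fmax (fun j => f j - v j) by move=> i; exact: (fmax_ge (fun j => f j - v j)).
have H2 : forall i, f i + v i <= fmax (fun j => f j + v j) by move=> i; exact: (fmax_ge (fun j => f j + v j)).
have := phiv k j; have := ler_norm (phi k - phi j).
have := H1 j; have := H1 k; have := H2 j; have := H2 k.
by move=> /=; case: (ger0P (v k - v j)); lra.
Qed.

End finite_max.

Section contraction.
Context {R : realType} {T : finType} (j0 : T).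
Implicit Types (A : T -> R) (phi v : nat -> T -> R) (n : nat).

(** The Rademacher complexity of the vectors [v ^~ j], up to a factor [n]. *)
Definition rsup n v : R := rad n (fun s => fmax j0 (fun j => rsum n s (v ^~ j))).

(** The Ledoux--Talagrand contraction principle.  The coordinates are replaced
    one at a time; [A] holds those already treated. *)
Lemma rad_contraction n A phi v :
  (forall i j k, (i < n)%N -> `|phi i j - phi i k| <= `|v i j - v i k|) ->
  rad n (fun s => fmax j0 (fun j => A j + rsum n s (phi ^~ j))) <=
  rad n (fun s => fmax j0 (fun j => A j + rsum n s (v ^~ j))).
Proof.
elim: n A phi v => [|n IH] A phi v phiv /=.
  by apply: le_fmax => j; rewrite /rsum !big_ord0.
pose phi' i := phi i.+1; pose v' i := v i.+1.
have IH' B : rad n (fun s => fmax j0 (fun j => B j + rsum n s (phi' ^~ j))) <=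
    rad n (fun s => fmax j0 (fun j => B j + rsum n s (v' ^~ j))).
  by apply: IH => i j k ik; exact: phiv.
have E w b B : rad n (fun s => fmax j0 (fun j => B j + rsum n.+1 (b :: s) (w ^~ j))) =
    rad n (fun s => fmax j0 (fun j => (B j + (-1) ^+ b * w 0 j)
       + rsum n s ((fun i => w i.+1) ^~ j))).
  apply: eq_rad => s _; congr fmax; apply/funext => j.
  by rewrite rsumS addrA.
rewrite !E ler_pM2r//.
apply: (le_trans (lerD (IH' _) (IH' _))).
rewrite -!radD; apply: le_rad => s _ /=.
have := @fmax_contract R T j0 (fun j => A j + rsum n s (v' ^~ j)) (phi 0) (v 0)
  (fun j k => phiv 0 j k isT).
congr (_ + _ <= _ + _); congr fmax; apply/funext => j; rewrite ?expr1 ?expr0 /v'; ring.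
Qed.

Lemma rsup_contraction n phi v :
  (forall i j k, (i < n)%N -> `|phi i j - phi i k| <= `|v i j - v i k|) ->
  rsup n phi <= rsup n v.
Proof.
move=> /(rad_contraction (fun=> 0)); congr (_ <= _); apply: eq_rad => s _;
by congr fmax; apply/funext => j; rewrite add0r.
Qed.

Lemma rsupD n v w : rsup n (fun i j => v i j + w i j) <= rsup n v + rsup n w.
Proof.
rewrite /rsup -radD; apply: le_rad => s _; apply: le_trans (fmaxD _ _ _).
by apply: le_fmax => j; rewrite rsumD.
Qed.

Lemma rsupN n v : rsup n (fun i j => - v i j) = rsup n v.
Proof.
rewrite /rsup -rad_flip; apply: eq_rad => s sn; congr fmax; apply/funext => j.
by rewrite rsumN rsum_flip// opprK.
Qed.

Lemma rsupZ n (c : R) v : 0 <= c -> rsup n (fun i j => c * v i j) <= c * rsup n v.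
Proof.
move=> c0; rewrite /rsup -radZ; apply: le_rad => s _; apply: fmax_le => j.
rewrite rsumZ ler_wpM2l//.
exact: (fmax_ge j0 (fun j => rsum n s (v ^~ j))).
Qed.

End contraction.

(** * The convex distance on the cube *)

Section convex_distance.
Context {R : realType}.
Implicit Types (A : seq bool -> Prop) (n : nat) (a : nat -> R).

Definition indic (P : Prop) : R := (`[< P >])%:R.

Lemma indic_ge0 P : 0 <= indic P.
Proof. exact: ler0n. Qed.

Lemma le_indic (P Q : Prop) : (P -> Q) -> indic P <= indic Q.
Proof.
move=> PQ; rewrite /indic ler_nat; case: asboolP => // p.
by rewrite asboolT//; exact: PQ.
Qed.

Lemma indicT (P : Prop) : P -> indic P = 1.
Proof. by move=> p; rewrite /indic asboolT. Qed.

Lemma indicF (P : Prop) : ~ P -> indic P = 0.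
Proof. by move=> p; rewrite /indic asboolF. Qed.

Lemma indic_le1 P : indic P <= 1.
Proof. by rewrite /indic lern1 leq_b1. Qed.

(** Convexity of [expR], from its tangent line at the barycentre. *)
Lemma expR_convex (l x y : R) : 0 <= l <= 1 ->
  expR (l * x + (1 - l) * y) <= l * expR x + (1 - l) * expR y.
Proof.
move=> /andP[l0 l1]; set m := l * x + (1 - l) * y.
have tangent z : expR m * (1 + (z - m)) <= expR z.
  have -> : expR z = expR m * expR (z - m) by rewrite -expRD subrKC.
  rewrite ler_pM2l ?expR_gt0//; exact: expR_ge1Dx.
have tx := ler_wpM2l l0 (tangent x).
have ty := @ler_wpM2l R (1 - l) ltac:(lra) _ _ (tangent y).
have E : l * (expR m * (1 + (x - m))) + (1 - l) * (expR m * (1 + (y - m))) = expR m.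
  by rewrite /m; ring.
lra.
Qed.

(** Hoelder's inequality with exponents [1 / l] and [1 / (1 - l)], in the form
    that follows from convexity after normalising [F] and [G]. *)
Lemma rad_hoelder n (F G : seq bool -> R) (l a b : R) : 0 <= l <= 1 ->
  rad n (fun s => expR (F s)) <= expR a -> rad n (fun s => expR (G s)) <= expR b ->
  rad n (fun s => expR (l * F s + (1 - l) * G s)) <= expR (l * a + (1 - l) * b).
Proof.
move=> l01 Fa Gb; have /andP[l0 l1] := l01.
set m := l * a + (1 - l) * b.
apply: (@le_trans _ _ (rad n (fun s => expR m *
    (l * expR (- a) * expR (F s) + (1 - l) * expR (- b) * expR (G s))))).
  apply: le_rad => s _.
  have -> : l * F s + (1 - l) * G s = m + (l * (F s - a) + (1 - l) * (G s - b)).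
    by rewrite /m; ring.
  rewrite expRD ler_pM2l ?expR_gt0//.
  rewrite -!mulrA -!expRD ![- _ + _]addrC; exact: expR_convex.
rewrite radZ radD !radZ -[leRHS]mulr1 ler_pM2l ?expR_gt0//.
have ea : expR (- a) * rad n (fun s => expR (F s)) <= 1.
  by rewrite expRN mulrC ler_pdivrMr ?expR_gt0// mul1r.
have eb : expR (- b) * rad n (fun s => expR (G s)) <= 1.
  by rewrite expRN mulrC ler_pdivrMr ?expR_gt0// mul1r.
have := ler_wpM2l l0 ea; have := @ler_wpM2l R (1 - l) ltac:(lra) _ _ eb.
rewrite !mulrA; lra.
Qed.

Lemma expR_le_inv (x : R) : x < 1 -> expR x <= (1 - x)^-1.
Proof.
move=> x1; rewrite -[leLHS]invrK -expRN lef_pV2 ?posrE ?expR_gt0 ?subr_gt0//.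
have := expR_ge1Dx (- x); lra.
Qed.

(** The optimisation over [l] in the induction for the convex distance, where
    [u = - ln r] and [r] is the ratio of the measures of the two sections. *)
Lemma section_weight (u : R) : 0 <= u ->
  exists2 l : R, 0 <= l <= 1 &
    expR (l ^+ 2 / 16 + (1 - l) * u) <= 2 - expR (- u).
Proof.
move=> u0; have [u8|u8] := leP u (1 / 8).
  exists (8 * u); first by apply/andP; split; lra.
  have -> : (8 * u) ^+ 2 / 16 + (1 - 8 * u) * u = u - 4 * u ^+ 2 by field.
  set v := u - 4 * u ^+ 2.
  have vu : v <= 1 / 16 by rewrite /v; have := sqr_ge0 (u - 1 / 8); rewrite sqrrB; lra.
  have v0 : 0 <= v by rewrite /v; nra.
  apply: (@le_trans _ _ (1 + v + (16 / 15) * v ^+ 2)).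
    apply: le_trans (expR_le_inv _) _; first lra.
    rewrite -div1r ler_pdivrMr; nra.
  have eu : expR (- u) <= 1 - u + u ^+ 2.
    rewrite expRN -div1r ler_pdivrMr ?expR_gt0//.
    have := expR_ge1Dx u; nra.
  have vu2 : v ^+ 2 <= u ^+ 2 by rewrite ler_sqr ?nnegrE//; rewrite /v; nra.
  have : v = u - 4 * u ^+ 2 by [].
  nra.
exists 1; first by apply/andP; split; lra.
rewrite expr1n subrr mul0r addr0.
have : expR (1 / 16) <= 16 / 15 :> R.
  apply: le_trans (expR_le_inv _) _; first lra.
  rewrite -div1r ler_pdivrMr; lra.
have : expR (- u) <= 8 / 9.
  rewrite expRN -div1r ler_pdivrMr ?expR_gt0//.
  have := expR_ge1Dx u; lra.
lra.
Qed.

Lemma CauchySchwarz2 (x y z w : R) : 0 <= y -> 0 <= w ->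
  x * y + z * w <= Num.sqrt (x ^+ 2 + z ^+ 2) * Num.sqrt (y ^+ 2 + w ^+ 2).
Proof.
move=> y0 w0; rewrite -sqrtrM; last by rewrite addr_ge0// sqr_ge0.
apply: le_trans (ler_norm _) _.
rewrite -sqrtr_sqr ler_sqrt; last by rewrite mulr_ge0// addr_ge0// sqr_ge0.
have := sqr_ge0 (x * w - z * y); nra.
Qed.

Definition hamming n a (x y : seq bool) : R :=
  \sum_(i < n) a i * (nth false x i != nth false y i)%:R.

Definition norm2 n a : R := Num.sqrt (\sum_(i < n) a i ^+ 2).

Lemma hammingS n a b c x y : hamming n.+1 a (b :: x) (c :: y) =
  a 0 * (b != c)%:R + hamming n (a \o succn) x y.
Proof. by rewrite /hamming big_ord_recl. Qed.

Lemma norm2_ge0 n a : 0 <= norm2 n a.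
Proof. exact: sqrtr_ge0. Qed.

Lemma norm2_sqr n a : norm2 n a ^+ 2 = \sum_(i < n) a i ^+ 2.
Proof. by rewrite sqr_sqrtr// sumr_ge0// => i _; rewrite sqr_ge0. Qed.

Lemma norm2S n a : norm2 n.+1 a ^+ 2 = a 0 ^+ 2 + norm2 n (a \o succn) ^+ 2.
Proof. by rewrite !norm2_sqr big_ord_recl. Qed.

Lemma norm2S_ge n a : norm2 n (a \o succn) <= norm2 n.+1 a.
Proof.
rewrite -[leLHS]ger0_norm ?norm2_ge0// -[leRHS]ger0_norm ?norm2_ge0//.
rewrite -ler_sqr ?nnegrE// ?normr_ge0// !real_normK ?num_real//.
by rewrite norm2S lerDr sqr_ge0.
Qed.

(** The convex distance in dual form: [D x] bounds the square of the supremum over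
    the weights [a] of the weighted Hamming distance from [x] to [A], divided by
    the norm of [a]. *)
Definition convex_dist_bound n A (D : seq bool -> R) : Prop :=
  (forall x, size x = n -> 0 <= D x) /\
  (forall x a, size x = n -> exists y, [/\ size y = n, A y &
     hamming n a x y <= norm2 n a * Num.sqrt (D x)]).

(** A point over the section [~~ b] may be compared with both sections of [A]; the
    weight [l] of the other one costs [l^2] for the coordinate that changes. *)
Lemma convex_dist_step n A b (D1 D2 : seq bool -> R) (l : R) :
  0 <= l <= 1 ->
  convex_dist_bound n (fun y => A (b :: y)) D1 ->
  (l < 1 -> convex_dist_bound n (fun y => A (~~ b :: y)) D2) ->
  (forall x, size x = n -> 0 <= D2 x) ->
  convex_dist_bound n.+1 A (fun x => if x is c :: x' then
    if c == b then D1 x' else l * D1 x' + (1 - l) * D2 x' + l ^+ 2 else 0).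
Proof.
move=> /andP[l0 l1] [D1ge0 D1P] D2P D2ge0; split => [[|c x]//= [xn]|].
  case: ifP => _; first exact: D1ge0.
  by rewrite !addr_ge0 ?mulr_ge0 ?D1ge0 ?D2ge0 ?sqr_ge0 ?subr_ge0.
move=> [//|c x] a /= [xn]; have [cb|cb] := eqVneq c b.
  have [y [yn Ay dy]] := D1P x (a \o succn) xn.
  exists (b :: y); split => //; first by rewrite /= yn.
  rewrite hammingS cb eqxx mulr0 add0r (le_trans dy)//.
  by rewrite ler_wpM2r ?sqrtr_ge0 ?norm2S_ge.
have cE : c = ~~ b by move: cb; case: (b); case: (c).
have [y1 [y1n Ay1 dy1]] := D1P x (a \o succn) xn.
set N := norm2 n (a \o succn) in dy1.
set p := Num.sqrt (D1 x) in dy1.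
have p0 : 0 <= p by rewrite sqrtr_ge0.
have pE : p ^+ 2 = D1 x by rewrite sqr_sqrtr// D1ge0.
pose q := Num.sqrt (D2 x).
have q0 : 0 <= q by rewrite sqrtr_ge0.
have qE : q ^+ 2 = D2 x by rewrite sqr_sqrtr// D2ge0.
(* It suffices to bound the average, with weights l and 1 - l, of the distances
   to the two candidates. *)
have key : l * (a 0 + N * p) + (1 - l) * (N * q) <=
    norm2 n.+1 a * Num.sqrt (l * D1 x + (1 - l) * D2 x + l ^+ 2).
  have := @CauchySchwarz2 N (l * p + (1 - l) * q) (a 0) l
    (addr_ge0 (mulr_ge0 l0 p0) (mulr_ge0 (_ : 0 <= 1 - l) q0)) l0.
  rewrite subr_ge0 => /(_ l1).
  have -> : Num.sqrt (N ^+ 2 + a 0 ^+ 2) = norm2 n.+1 a.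
    by rewrite addrC -norm2S sqrtr_sqr ger0_norm ?norm2_ge0.
  set lhs := (X in X <= _); have -> : l * (a 0 + N * p) + (1 - l) * (N * q) = lhs.
    by rewrite /lhs; ring.
  move/le_trans; apply; rewrite ler_wpM2l ?norm2_ge0// ler_sqrt; last first.
    by rewrite !addr_ge0 ?mulr_ge0 ?D1ge0 ?D2ge0 ?sqr_ge0 ?subr_ge0.
  rewrite lerD2r -pE -qE.
  have : 0 <= l * (1 - l) * (p - q) ^+ 2.
    by rewrite mulr_ge0 ?sqr_ge0// mulr_ge0// subr_ge0.
  nra.
have [l_lt1|l_ge1] := ltP l 1; last first.
  have lE : l = 1 by apply/eqP; rewrite eq_le l1 l_ge1.
  exists (b :: y1); split => //; first by rewrite /= y1n.
  rewrite hammingS cE (_ : ~~ b != b) ?mulr1; last by case: (b).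
  apply: le_trans key; rewrite lE; lra.
have [_ /(_ x (a \o succn) xn) [y2 [y2n Ay2 dy2]]] := D2P l_lt1.
rewrite -/N -/q in dy2.
have [h|h] := leP (a 0 + N * p) (N * q).
  exists (b :: y1); split => //; first by rewrite /= y1n.
  rewrite hammingS cE (_ : ~~ b != b) ?mulr1; last by case: (b).
  apply: le_trans key; nra.
exists (~~ b :: y2); split => //; first by rewrite /= y2n.
rewrite hammingS cE eqxx mulr0 add0r.
apply: le_trans key; nra.
Qed.

Lemma radS n b (F : seq bool -> R) : rad n.+1 F =
  (rad n (fun s => F (b :: s)) + rad n (fun s => F (~~ b :: s))) / 2.
Proof. by case: b => //=; rewrite addrC. Qed.

(** Talagrand's inequality for the convex distance to a set of sign patterns, by
    induction on the dimension: if the two sections of [A] have measures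
    [p >= q], a point over the larger one uses that section alone, and a point
    over the smaller one uses both, with weights depending on [q / p]. *)
Lemma talagrand_convex_distance n A (p := rad n (fun s => indic (A s))) : 0 < p ->
  exists D, convex_dist_bound n A D /\ rad n (fun s => expR (D s / 16)) <= p^-1.
Proof.
rewrite {}/p; elim: n A => [|n IH] A p0.
  move: p0 => /= p0; have A0 : A [::].
    by apply: contrapT => nA; move: p0; rewrite indicF// ltxx.
  exists (fun=> 0); rewrite indicT// mul0r expR0 invr1; split => //; split => // x a x0.
  by exists [::]; rewrite /hamming big_ord0 sqrtr0 mulr0.
have [b pq] : exists b, rad n (fun s => indic (A (~~ b :: s))) <=
    rad n (fun s => indic (A (b :: s))).
  have [h|/ltW h] := leP (rad n (fun s => indic (A (false :: s))))
    (rad n (fun s => indic (A (true :: s)))); by [exists true|exists false].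
rewrite (radS n b) in p0 *.
set p := rad n _ in p0 pq *; set q := rad n _ in pq p0 *.
have q0 : 0 <= q by apply: rad_ge0 => s _; exact: indic_ge0.
have p_gt0 : 0 < p by rewrite lt_neqAle (le_trans q0 pq) andbT; apply/eqP => p_eq0; lra.
have [D1 [D1P D1e]] := IH (fun y => A (b :: y)) p_gt0.
have pV : p^-1 = expR (- ln p) by rewrite expRN lnK.
(* the choice of the weight; an empty section is never used *)
have [l [D2 [l01 D2P D2ge0 De]]] : exists l D2, [/\ 0 <= l <= 1,
    l < 1 -> convex_dist_bound n (fun y => A (~~ b :: y)) D2,
    forall x, size x = n -> 0 <= D2 x &
    rad n (fun s => expR ((l * D1 s + (1 - l) * D2 s + l ^+ 2) / 16)) <=
      p^-1 * (2 - q / p)].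
  have [q_gt0|q_le0] := ltP 0 q; last first.
    have -> : q = 0 by apply/eqP; rewrite eq_le q_le0 q0.
    exists 1, (fun=> 0); split => //; first by rewrite ler01 lexx.
      by rewrite ltxx.
    have -> : rad n (fun s => expR ((1 * D1 s + (1 - 1) * 0 + 1 ^+ 2) / 16)) =
        expR (1 / 16) * rad n (fun s => expR (D1 s / 16)).
      rewrite -radZ; apply: eq_rad => s _; rewrite -expRD; congr expR; ring.
    rewrite mul0r subr0 mulrC.
    have e2 : expR (1 / 16) <= 2 :> R.
      apply: le_trans (expR_le_inv _) _; first lra.
      rewrite -div1r ler_pdivrMr; lra.
    by apply: ler_pM => //; apply: rad_ge0 => s _; exact: expR_ge0.
  have [D2 [D2P D2e]] := IH (fun y => A (~~ b :: y)) q_gt0.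
  have qV : q^-1 = expR (- ln q) by rewrite expRN lnK.
  have u0 : 0 <= ln p - ln q by rewrite subr_ge0 ler_ln.
  have [l l01 le2] := section_weight u0.
  exists l, D2; split => //; first by case: D2P.
  have -> : rad n (fun s => expR ((l * D1 s + (1 - l) * D2 s + l ^+ 2) / 16)) =
      expR (l ^+ 2 / 16) *
      rad n (fun s => expR (l * (D1 s / 16) + (1 - l) * (D2 s / 16))).
    rewrite -radZ; apply: eq_rad => s _; rewrite -expRD; congr expR; ring.
  rewrite pV in D1e; rewrite qV in D2e.
  have H := rad_hoelder l01 D1e D2e.
  apply: le_trans (ler_wpM2l (expR_ge0 _) H) _.
  rewrite -expRD.
  have -> : l ^+ 2 / 16 + (l * - ln p + (1 - l) * - ln q) =
      - ln p + (l ^+ 2 / 16 + (1 - l) * (ln p - ln q)) by ring.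
  rewrite expRD pV ler_pM2l ?expR_gt0//; apply: le_trans le2 _.
  by rewrite opprB expRD expRN lnK// lnK// mulrC mulrC.
exists (fun x => if x is c :: x' then
    if c == b then D1 x' else l * D1 x' + (1 - l) * D2 x' + l ^+ 2 else 0).
split; first exact: convex_dist_step.
rewrite (radS n b) eqxx; have -> : (~~ b == b) = false by case: (b).
have ineq : p^-1 + p^-1 * (2 - q / p) <= 2 * ((p + q) / 2)^-1.
  rewrite -subr_ge0.
  have -> : 2 * ((p + q) / 2)^-1 - (p^-1 + p^-1 * (2 - q / p)) =
     (p - q) ^+ 2 / (p ^+ 2 * (p + q)).
    by field; rewrite !lt0r_neq0//; lra.
  by rewrite divr_ge0 ?sqr_ge0// mulr_ge0 ?sqr_ge0//; lra.
rewrite ler_pdivrMr// mulrC; apply: le_trans ineq; exact: lerD.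
Qed.

(** Concentration for a maximum of linear forms in the signs.  The variance
    term is that of the maximising vector itself, so that vectors [v j] with norms
    of different orders are treated together. *)
Lemma cube_deviation n (J : Type) (v : J -> nat -> R) (M : J -> R) (u : R) : 0 <= u ->
  rad n (fun s => indic (exists j, M j < rsum n s (v j))) <= 1 / 2 ->
  rad n (fun s => indic (exists j, M j + 2 * (norm2 n (v j) * u) < rsum n s (v j)))
    <= 2 * expR (- (u ^+ 2 / 16)).
Proof.
move=> u0 hM.
pose A s := forall j, rsum n s (v j) <= M j.
have pA : 1 / 2 <= rad n (fun s => indic (A s)).
  have : rad n (fun s => indic (A s) + indic (exists j, M j < rsum n s (v j))) >= 1.
    rewrite -[leLHS](rad_cst n); apply: le_rad => s _.
    have [As|nA] := pselect (A s); first by rewrite indicT// lerDl indic_ge0.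
    rewrite (indicT (P := exists j, _)) ?lerDr ?indic_ge0//.
    move: nA => /existsNP[j /negP]; rewrite -ltNge => h; by exists j.
  rewrite radD; lra.
have [|D [[Dge0 DP] De]] := @talagrand_convex_distance n A; first lra.
have far s : size s = n ->
    (exists j, M j + 2 * (norm2 n (v j) * u) < rsum n s (v j)) -> u ^+ 2 <= D s.
  move=> sn [j jM].
  have [y [yn Ay]] := DP s (fun i => (-1) ^+ nth false s i * v j i) sn.
  have -> : norm2 n (fun i => (-1) ^+ nth false s i * v j i) = norm2 n (v j).
    rewrite /norm2; congr Num.sqrt; apply: eq_bigr => i _.
    by rewrite exprMn sqrr_sign mul1r.
  have -> : hamming n (fun i => (-1) ^+ nth false s i * v j i) s y =
      (rsum n s (v j) - rsum n y (v j)) / 2.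
    rewrite /hamming /rsum -sumrB mulr_suml; apply: eq_bigr => i _.
    by case: (nth _ s i); case: (nth _ y i) => /=; rewrite ?expr0 ?expr1; field.
  have Aj := Ay j; move=> h.
  have lt1 : norm2 n (v j) * u < norm2 n (v j) * Num.sqrt (D s) by lra.
  have N0 : 0 < norm2 n (v j).
    rewrite lt_neqAle norm2_ge0 andbT; apply/eqP => N0.
    by move: lt1; rewrite -N0 !mul0r ltxx.
  move: lt1; rewrite ltr_pM2l// => lt1.
  rewrite -(sqr_sqrtr (Dge0 _ sn)) ler_sqr ?nnegrE ?sqrtr_ge0//; exact: ltW.
apply: (@le_trans _ _ (rad n (fun s => expR (- (u ^+ 2 / 16)) * expR (D s / 16)))).
  apply: le_rad => s sn; rewrite -expRD.
  have [/(far s sn) h|h] := pselect (exists j, M j + 2 * (norm2 n (v j) * u) < rsum n s (v j)).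
    apply: le_trans (indic_le1 _) _.
    apply: le_trans (expR_ge1Dx _); lra.
  by rewrite indicF// expR_ge0.
rewrite radZ mulrC ler_pM2r ?expR_gt0//; apply: le_trans De _.
rewrite -[leRHS]invrK lef_pV2 ?posrE ?invr_gt0//; lra.
Qed.

End convex_distance.

(** * Rademacher complexities *)

Section rademacher_bounds.
Context {R : realType} {T : finType} (j0 : T).
Implicit Types (n : nat) (v : nat -> T -> R).

Lemma cosh_le (y : R) : (expR y + expR (- y)) / 2 <= expR (2 * y ^+ 2).
Proof.
wlog y0 : y / 0 <= y => [H|].
  have [/H//|/ltW y0] := leP 0 y.
  by have := H (- y); rewrite oppr_ge0 sqrrN opprK addrC; exact.
have [y2|y2] := leP y (1 / 2).
  have h1 : expR y <= 1 + y + 2 * y ^+ 2.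
    apply: le_trans (expR_le_inv _) _; first lra.
    rewrite -div1r ler_pdivrMr; nra.
  have h2 : expR (- y) <= 1 - y + y ^+ 2.
    rewrite expRN -div1r ler_pdivrMr ?expR_gt0//.
    have := expR_ge1Dx y; nra.
  apply: le_trans (expR_ge1Dx _); nra.
have h : expR (- y) <= expR y by rewrite ler_expR; lra.
apply: (@le_trans _ _ (expR y)); first lra.
by rewrite ler_expR; nra.
Qed.

Lemma rad_expR n (v : nat -> R) :
  rad n (fun s => expR (rsum n s v)) <= expR (2 * \sum_(i < n) v i ^+ 2).
Proof.
elim: n v => [|n IH] v /=; first by rewrite /rsum !big_ord0 mulr0.
have E b : rad n (fun s => expR (rsum n.+1 (b :: s) v)) =
    expR ((-1) ^+ b * v 0) * rad n (fun s => expR (rsum n s (v \o succn))).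
  by rewrite -radZ; apply: eq_rad => s _; rewrite rsumS expRD.
rewrite !E -mulrDl mulrAC big_ord_recl mulrDr expRD.
apply: ler_pM; [|exact: rad_ge0|..].
- by rewrite divr_ge0// addr_ge0 ?expR_ge0.
- by rewrite addrC mul1r mulN1r; exact: cosh_le.
- exact: IH.
Qed.

(** A maximum over an [l1]-ball is a maximum over the coordinates, which the
    Laplace transforms of the coordinates control up to a logarithm of their
    number. *)
Lemma rsup_l1_ball (L : finType) n (b : T -> L -> R) (z : nat -> L -> R) (B C t u : R) :
  (forall j, \sum_l `|b j l| <= B) -> (forall i l, `|z i l| <= C) -> 0 < t -> 0 <= u ->
  rsup j0 n (fun i j => \sum_l b j l * z i l) <=
  B * (u + t^-1 * (2 * #|L|%:R * expR (2 * (t ^+ 2 * n%:R * C ^+ 2) - t * u))).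
Proof.
move=> bB zC t0 u0.
have B0 : 0 <= B by apply: le_trans (bB j0); rewrite sumr_ge0.
pose X l s := rsum n s (z ^~ l).
pose E s := \sum_l (expR (t * X l s) + expR (- (t * X l s))).
have XE l s : `|X l s| <= u + t^-1 * (expR (- (t * u)) * E s).
  rewrite -lerBlDl mulrC ler_pdivlMr//.
  apply: (@le_trans _ _ (expR (t * `|X l s| - t * u))).
    by apply: le_trans (expR_ge1Dx _); lra.
  rewrite addrC expRD ler_pM2l ?expR_gt0// /E (bigD1 l)//=.
  apply: ler_wpDr.
    by apply: sumr_ge0 => k _; rewrite addr_ge0 ?expR_ge0.
  have [X0|X0] := ger0P (X l s); first by rewrite lerDl expR_ge0.
  by rewrite mulrN lerDr expR_ge0.
have zsum (c : R) l : \sum_(i < n) (c * z i l) ^+ 2 <= c ^+ 2 * n%:R * C ^+ 2.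
  have C0 : 0 <= C by apply: le_trans (zC 0 l).
  apply: (@le_trans _ _ (\sum_(i < n) c ^+ 2 * C ^+ 2)).
    apply: ler_sum => i _; rewrite exprMn ler_wpM2l ?sqr_ge0//.
    by rewrite -real_normK ?num_real// ler_sqr ?nnegrE.
  by rewrite sumr_const card_ord -[leLHS]mulr_natr [leLHS]mulrAC.
have radE : rad n E <= 2 * #|L|%:R * expR (2 * (t ^+ 2 * n%:R * C ^+ 2)).
  rewrite rad_sum.
  apply: (@le_trans _ _ (\sum_(l : L) 2 * expR (2 * (t ^+ 2 * n%:R * C ^+ 2)))).
    apply: ler_sum => l _; rewrite radD mulrDl mul1r.
    have Xc (c : R) : c ^+ 2 = t ^+ 2 ->
        rad n (fun s => expR (c * X l s)) <= expR (2 * (t ^+ 2 * n%:R * C ^+ 2)).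
      move=> ct; rewrite /X; under eq_rad do rewrite -rsumZ.
      apply: le_trans (rad_expR _ _) _.
      by rewrite ler_expR ler_pM2l// -ct; exact: zsum.
    apply: lerD; first exact: Xc.
    under eq_rad do rewrite -mulNr.
    by apply: Xc; rewrite sqrrN.
  by rewrite sumr_const -[leLHS]mulr_natr [leLHS]mulrAC.
apply: (@le_trans _ _ (rad n (fun s => B * u + B * (t^-1 * expR (- (t * u))) * E s))).
  apply: le_rad => s _; apply: fmax_le => j.
  rewrite rsum_sum; under eq_bigr do rewrite rsumZ.
  apply: (@le_trans _ _ (\sum_l `|b j l| * (u + t^-1 * (expR (- (t * u)) * E s)))).
    apply: ler_sum => l _; apply: le_trans (ler_norm _) _.
    by rewrite normrM ler_wpM2l//; exact: XE.
  have -> : B * u + B * (t^-1 * expR (- (t * u))) * E s =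
    B * (u + t^-1 * (expR (- (t * u)) * E s)) by ring.
  rewrite -mulr_suml ler_wpM2r//.
  rewrite addr_ge0// mulr_ge0 ?invr_ge0 ?(ltW t0)// mulr_ge0 ?expR_ge0//.
  by apply: sumr_ge0 => k _; rewrite addr_ge0 ?expR_ge0.
rewrite radD rad_cst radZ mulrDr lerD2l -[leLHS]mulrA ler_wpM2l//.
apply: le_trans (ler_wpM2l _ radE) _.
  by rewrite mulr_ge0 ?invr_ge0 ?expR_ge0 ?ltW.
by rewrite expRD -!mulrA ler_pM2l ?invr_gt0// mulrC !mulrA.
Qed.

(** For an ellipsoid the maximum is a Euclidean norm, whose second moment is
    explicit. *)
Lemma rsup_ellipsoid m n (al : T -> 'I_m -> R) (e : nat -> 'I_m -> R) (w : 'I_m -> R)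
    (B c : R) : (forall l, 0 < w l) -> 0 < B -> 0 < c ->
  (forall j, \sum_l w l * al j l ^+ 2 <= B) ->
  rsup j0 n (fun i j => \sum_l al j l * e i l) <=
  c / 2 + B / (2 * c) * \sum_(i < n) \sum_l e i l ^+ 2 / w l.
Proof.
move=> w0 B0 c0 aB; pose X l s := rsum n s (e ^~ l).
apply: (@le_trans _ _ (rad n (fun s => c / 2 + B / (2 * c) * \sum_l (w l)^-1 * (0 + X l s) ^+ 2))).
  apply: le_rad => s _; apply: fmax_le => j.
  rewrite rsum_sum; under eq_bigr do rewrite rsumZ.
  apply: (@le_trans _ _ (\sum_l (c / (2 * B) * (w l * al j l ^+ 2)
      + B / (2 * c) * ((w l)^-1 * (0 + X l s) ^+ 2)))).
    apply: ler_sum => l _; rewrite add0r -/(X l s) -subr_ge0.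
    have -> : c / (2 * B) * (w l * al j l ^+ 2) + B / (2 * c) * ((w l)^-1 * X l s ^+ 2) -
       al j l * X l s = (c * w l * al j l - B * X l s) ^+ 2 / (2 * B * c * w l).
      by field; rewrite !lt0r_neq0.
    by rewrite divr_ge0 ?sqr_ge0// !mulr_ge0// ltW.
  rewrite big_split/= -!mulr_sumr lerD2r.
  apply: le_trans (ler_wpM2l _ (aB j)) _; first by rewrite divr_ge0 ?mulr_ge0 ?ltW.
  by rewrite le_eqVlt; apply/orP; left; apply/eqP; field; rewrite lt0r_neq0.
rewrite radD rad_cst radZ rad_sum lerD2l ler_wpM2l//.
  by rewrite divr_ge0 ?mulr_ge0 ?ltW.
rewrite exchange_big/=; apply: ler_sum => l _.
by rewrite radZ rad_sqr expr0n/= add0r mulr_sumr; apply: ler_sum => i _; rewrite mulrC.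
Qed.

(** [rad] over a list of coordinates, so that they can be reordered. *)
Fixpoint radl (l : seq nat) (A : T -> R) (v : nat -> T -> R) : R :=
  if l is i :: l' then
    (radl l' (fun j => A j - v i j) v + radl l' (fun j => A j + v i j) v) / 2
  else fmax j0 A.

Lemma radl_rad n k A v :
  rad n (fun s => fmax j0 (fun j => A j + rsum n s (fun i => v (k + i)%N j))) =
  radl (iota k n) A v.
Proof.
elim: n k A => [|n IH] k A /=.
  by congr fmax; apply/funext => j; rewrite /rsum big_ord0 addr0.
rewrite -!IH; congr ((_ + _) / 2); apply: eq_rad => s _; congr fmax; apply/funext => j;
  rewrite rsumS addrA addn0; congr (_ + _ + rsum _ _ _); rewrite ?expr0 ?expr1 ?mul1r ?mulN1r//;
  by apply/funext => i; rewrite /= addnS.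
Qed.

Lemma radl_swap i k l A v : radl (i :: k :: l) A v = radl (k :: i :: l) A v.
Proof.
rewrite /= ![(_ + _) / 2]mulrDl -!mulrDl.
have e1 : (fun j : T => A j - v i j + v k j) = (fun j => A j + v k j - v i j).
  by apply/funext => j; ring.
have e2 : (fun j : T => A j + v i j - v k j) = (fun j => A j - v k j + v i j).
  by apply/funext => j; ring.
have e3 : (fun j : T => A j - v i j - v k j) = (fun j => A j - v k j - v i j).
  by apply/funext => j; ring.
have e4 : (fun j : T => A j + v i j + v k j) = (fun j => A j + v k j + v i j).
  by apply/funext => j; ring.
by rewrite e1 e2 e3 e4; field.
Qed.

Lemma radl_cons i l1 l2 v : (forall A, radl l1 A v = radl l2 A v) ->
  forall A, radl (i :: l1) A v = radl (i :: l2) A v.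
Proof. by move=> E A /=; rewrite !E. Qed.

Lemma radl_move i l1 l2 v A : radl (l1 ++ i :: l2) A v = radl (i :: l1 ++ l2) A v.
Proof.
elim: l1 A => [//|k l1 IH] A; rewrite !cat_cons radl_swap.
exact: (radl_cons k IH).
Qed.

Lemma radl_perm l1 l2 v A : perm_eq l1 l2 -> radl l1 A v = radl l2 A v.
Proof.
elim: l1 l2 A => [|i l1 IH] l2 A; first by move=> /perm_size/esym/size0nil ->.
move=> p; have il2 : i \in l2 by rewrite -(perm_mem p) mem_head.
case/splitPr: il2 p => p1 p2 p.
have p' : perm_eq l1 (p1 ++ p2) by rewrite -(perm_cons i) (perm_trans p)// perm_catC/= perm_cons perm_catC.
by rewrite radl_move; apply: radl_cons => A'; exact: IH.
Qed.

(** The coordinates are treated by decreasing [x], so that a truncated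
    combination is an average of the partial sums [S] and hence at most their
    running maximum [M].  The bound is Doob's [L2] inequality for [M]: the
    quadratic form [4 S^2 - 4 M S + 2 M^2] dominates [M^2], and can only
    decrease on average, apart from the increments of [4 S^2]. *)
Lemma radl_truncated (l : seq nat) (sc : T -> R) (x b : nat -> R) (w A : T -> R)
    (S M c : R) : 0 < c ->
  sorted (fun i k => x k <= x i) l ->
  (forall i j, i \in l -> Num.min (sc j * x i) 1 <= w j) ->
  (forall i j, 0 <= sc j * x i) -> (forall i, 0 <= b i) ->
  (forall j, 0 <= w j <= 1) -> (forall j, 0 <= sc j) ->
  (forall j, A j <= w j * S + (1 - w j) * M) -> S <= M ->
  radl l A (fun i j => b i * Num.min (sc j * x i) 1) <=
  c / 2 + (2 * c)^-1 * (4 * (S ^+ 2 + \sum_(i <- l) b i ^+ 2) - 4 * M * S + 2 * M ^+ 2).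
Proof.
move=> c0; elim: l w A S M => [|i l IH] w A S M srt lw sx b0 w01 sc0 Aw SM /=.
  rewrite big_nil addr0.
  apply: (@le_trans _ _ M).
    apply: fmax_le => j; apply: le_trans (Aw j) _; have /andP[w0 w1] := w01 j; nra.
  have -> : c / 2 + (2 * c)^-1 * (4 * S ^+ 2 - 4 * M * S + 2 * M ^+ 2) =
     M + (2 * c)^-1 * ((c - M) ^+ 2 + (2 * S - M) ^+ 2) by field; rewrite lt0r_neq0.
  rewrite lerDl mulr_ge0 ?addr_ge0 ?sqr_ge0// invr_ge0; lra.
pose w' j := Num.min (sc j * x i) 1.
have w'01 j : 0 <= w' j <= 1 by rewrite /w' le_min sx ler01/= ge_min lexx orbT.
have w'w j : w' j <= w j by rewrite lw// mem_head.
have lw' k j : k \in l -> Num.min (sc j * x k) 1 <= w' j.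
  move=> kl; have xki : x k <= x i.
    move: srt => /= /order_path_min => /(_ _)/allP; apply => //.
    by move=> a1 a2 a3 /= h1 h2; exact: le_trans h2 h1.
  by rewrite /w' le_min !ge_min lexx orbT andbT ler_wpM2l.
have srt' : sorted (fun i k => x k <= x i) l by exact: path_sorted srt.
have step (ep : R) : `|ep| = 1 ->
    radl l (fun j => A j + ep * (b i * w' j)) (fun i j => b i * Num.min (sc j * x i) 1) <=
    c / 2 + (2 * c)^-1 * (4 * ((S + ep * b i) ^+ 2 + \sum_(i <- l) b i ^+ 2)
       - 4 * M * (S + ep * b i) + 2 * M ^+ 2).
  move=> ep1; set S' := S + ep * b i; set M' := Num.max M S'.
  apply: le_trans (IH w' _ S' M' srt' lw' sx b0 w'01 sc0 _ _) _.
  - move=> j; have := Aw j; have /andP[? ?] := w'01 j; have := w'w j => ?.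
    have -> : w' j * S' + (1 - w' j) * M' =
      w' j * S + (1 - w' j) * M' + ep * (b i * w' j) by rewrite /S'; ring.
    rewrite lerD2r => /le_trans; apply.
    have MM : M <= M' by rewrite le_max lexx.
    have : (1 - w' j) * M <= (1 - w' j) * M' by rewrite ler_wpM2l// subr_ge0.
    nra.
  - by rewrite le_max lexx orbT.
  rewrite lerD2l; apply: ler_wpM2l; first by rewrite invr_ge0; lra.
  rewrite /M'; case: (leP S' M) => // MS; nra.
rewrite ler_pdivrMr//.
have -> : (fun j : T => A j - b i * Num.min (sc j * x i) 1) =
    (fun j => A j + (-1) * (b i * w' j)) by apply/funext => j; rewrite mulN1r.
have -> : (fun j : T => A j + b i * Num.min (sc j * x i) 1) =
    (fun j => A j + 1 * (b i * w' j)) by apply/funext => j; rewrite mul1r.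
have sm := step (-1); have sp := step 1.
rewrite normrN normr1 in sm; rewrite normr1 in sp.
apply: le_trans (lerD (sm erefl) (sp erefl)) _.
rewrite big_cons; set sb := \sum_(_ <- _) _; set q := (2 * c)^-1.
rewrite le_eqVlt; apply/orP; left; apply/eqP; rewrite mulN1r mul1r; by field.
Qed.

(** The family is one-dimensional: up to a constant, the maximum over all scales
    [sc j] costs as much as one vector with entries [b i]. *)
Lemma rsup_scale n (sc : T -> R) (t b : nat -> R) (c : R) : 0 < c ->
  (forall j, 0 <= sc j) -> (forall i, 0 <= t i) -> (forall i, 0 < b i) ->
  rsup j0 n (fun i j => Num.min (sc j * t i) (b i)) <=
  c / 2 + 2 / c * \sum_(i < n) b i ^+ 2.
Proof.
move=> c0 sc0 t0 b0; pose x i := t i / b i.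
have -> : (fun i j => Num.min (sc j * t i) (b i)) =
    (fun i j => b i * Num.min (sc j * x i) 1).
  apply/funext => i; apply/funext => j; rewrite minr_pMr ?(ltW (b0 i))// mulr1.
  by congr Num.min; rewrite /x; field; rewrite lt0r_neq0.
set v := (fun i j => b i * _).
have -> : rsup j0 n v = radl (iota 0 n) (fun=> 0) v.
  rewrite -radl_rad; apply: eq_rad => s _; congr fmax; apply/funext => j.
  by rewrite add0r; congr rsum; apply/funext.
pose le_x i k := x k <= x i.
rewrite (@radl_perm _ (sort le_x (iota 0 n))); last by rewrite perm_sym perm_sort.
have x0 i : 0 <= x i by rewrite divr_ge0// ltW.
apply: (@le_trans _ _ (c / 2 + (2 * c)^-1 * (4 * (0 ^+ 2 +
    \sum_(i <- sort le_x (iota 0 n)) b i ^+ 2) - 4 * 0 * 0 + 2 * 0 ^+ 2))).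
  apply: (@radl_truncated _ sc x b (fun=> 1)) => //.
  - by apply: sort_sorted => i k; rewrite /le_x le_total.
  - by move=> i j _; rewrite ge_min lexx orbT.
  - by move=> i j; rewrite mulr_ge0.
  - by move=> i; rewrite ltW.
  - by move=> j; rewrite ler01 lexx.
rewrite lerD2l (perm_big _ (permEl (perm_sort le_x (iota 0 n)))) -[n in iota _ n]subn0.
rewrite [\sum_(i <- iota _ _) _]big_mkord; set sb := \sum_(_ < _) _.
rewrite le_eqVlt; apply/orP; left; apply/eqP; field; exact: lt0r_neq0.
Qed.

Definition clip (b x : R) : R := Num.max (- b) (Num.min x b).

Lemma clipN b x : 0 <= b -> clip b (- x) = - clip b x.
Proof.
move=> b0; rewrite /clip oppr_max oppr_min opprK.
by rewrite /Num.max /Num.min; repeat case: ifP; lra.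
Qed.

Lemma rsup_clip n (sc : T -> R) (t b : nat -> R) (c : R) : 0 < c ->
  (forall j, 0 <= sc j) -> (forall i, 0 < b i) ->
  rsup j0 n (fun i j => clip (b i) (sc j * t i)) <=
  c / 2 + 2 / c * \sum_(i < n) b i ^+ 2.
Proof.
move=> c0 sc0 b0; apply: le_trans (rsup_scale (t := fun i => `|t i|) n c0 sc0 _ b0) => //.
apply: rsup_contraction => i j k _.
have clipE a : 0 <= a -> clip (b i) a = Num.min a (b i).
  move=> a0; rewrite /clip; apply/max_idPr; rewrite le_min.
  by have := b0 i => ?; apply/andP; split; lra.
have [ti|ti] := ger0P (t i); first by rewrite !clipE// mulr_ge0.
have clipE' s : 0 <= s -> clip (b i) (s * t i) = - Num.min (s * - t i) (b i).
  move=> s0; rewrite -{1}(opprK (t i)) mulrN clipN ?(ltW (b0 i))// clipE//.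
  by rewrite mulr_ge0// oppr_ge0 ltW.
by rewrite !clipE'// -opprD normrN.
Qed.

End rademacher_bounds.

(** * Elementary probability *)

Lemma measurable_exists {d : measure_display} {T : measurableType d} (J : finType)
    (A : J -> set T) : (forall j, measurable (A j)) -> measurable [set x | exists j, A j x].
Proof.
move=> mA; have -> : [set x | exists j, A j x] = \bigcup_(j in [set: J]) A j.
  by apply/seteqP; split => [x [j Aj]|x [j _ Aj]]; exists j.
exact: fin_bigcup_measurable.
Qed.

Lemma measurable_forall {d : measure_display} {T : measurableType d} (J : finType)
    (A : J -> set T) : (forall j, measurable (A j)) -> measurable [set x | forall j, A j x].
Proof.
move=> mA; have -> : [set x | forall j, A j x] = \bigcap_(j in [set: J]) A j.
  by apply/seteqP; split => [x Ax j _|x Ax j]; [exact: Ax|exact: Ax].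
exact: fin_bigcap_measurable.
Qed.

Section probability_tools.
Context {R : realType} {d : measure_display} {T : measurableType d}.
Context (P : probability T R).

Definition pr (A : set T) : R := fine (P A).

Lemma prE A : measurable A -> (pr A)%:E = P A.
Proof. by move=> mA; rewrite fineK// fin_num_measure. Qed.

Lemma le_pr A B : measurable A -> measurable B -> A `<=` B -> pr A <= pr B.
Proof.
by move=> mA mB AB; rewrite -lee_fin !prE// le_measure// inE.
Qed.

Lemma pr_setU A B : measurable A -> measurable B -> pr (A `|` B) <= pr A + pr B.
Proof.
move=> mA mB; rewrite -lee_fin EFinD !prE//; last exact: measurableU.
exact: measureU2.
Qed.

Lemma pr_setC A : measurable A -> pr (~` A) = 1 - pr A.
Proof.
move=> mA; apply: EFin_inj; rewrite EFinB !prE//; last exact: measurableC.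
exact: probability_setC.
Qed.

Lemma bounded_integrable (f : T -> R) (c : R) : measurable_fun setT f ->
  (forall x, `|f x| <= c) -> P.-integrable setT (EFin \o f).
Proof.
move=> mf fc; apply: measurable_bounded_integrable => //.
  by rewrite -ge0_fin_numE// fin_num_measure.
exists c; split; first exact: num_real.
by move=> M cM x _ /=; rewrite (le_trans (fc x))// ltW.
Qed.

Lemma Rintegral_pr_cst (c : R) : \int[P]_x c = c.
Proof.
rewrite Rintegral_cst// -[RHS]mulr1; congr (_ * _).
exact: (congr1 fine (probability_setT P)).
Qed.

Lemma Rintegral_sum (D : set T) (I : Type) (s : seq I) (f : I -> T -> R) : measurable D ->
  (forall i, P.-integrable D (EFin \o f i)) ->
  P.-integrable D (EFin \o (fun x => \sum_(i <- s) f i x)) /\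
  \int[P]_(x in D) (\sum_(i <- s) f i x) = \sum_(i <- s) \int[P]_(x in D) f i x.
Proof.
move=> mD fi.
have E : EFin \o (fun x => \sum_(i <- s) f i x) = (fun x => \sum_(i <- s) (f i x)%:E)%E.
  by apply/funext => x /=; rewrite sumEFin.
split; first by rewrite E; apply: (integrable_sum mD) => i _; exact: fi.
rewrite /Rintegral [X in integral _ _ X]E integral_sum// sum_fine// => i _.
by apply: (integrable_fin_num mD); exact: fi.
Qed.

Lemma Rintegral_indic A : measurable A -> \int[P]_x (indic (A x)) = pr A :> R.
Proof.
move=> mA; rewrite /Rintegral /pr; congr fine.
by rewrite -[A in RHS](setIT A) -integral_indic.
Qed.

Lemma measurable_indic_set (A : set T) : measurable A ->
  measurable_fun setT (fun x => indic (A x) : R).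
Proof. by move=> mA; exact: (measurable_indic mA).
Qed.

Lemma measurable_set_ltr (f g : T -> R) : measurable_fun setT f ->
  measurable_fun setT g -> measurable [set x | f x < g x].
Proof.
move=> mf mg; have /(_ measurableT _ (Logic.I : measurable [set true])) := measurable_fun_ltr mf mg.
by rewrite setTI.
Qed.

Lemma measurable_set_ler (f g : T -> R) : measurable_fun setT f ->
  measurable_fun setT g -> measurable [set x | f x <= g x].
Proof.
move=> mf mg; have /(_ measurableT _ (Logic.I : measurable [set true])) := measurable_fun_ler mf mg.
by rewrite setTI.
Qed.

Lemma markov (f : T -> R) (m : R) : measurable_fun setT f -> (forall x, 0 <= f x) ->
  P.-integrable setT (EFin \o f) -> 0 < m ->
  m * pr [set x | m < f x] <= \int[P]_x f x.
Proof.
move=> mf f0 fi m0.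
have mA : measurable [set x | m < f x].
  exact: measurable_set_ltr.
rewrite -Rintegral_indic// -RintegralZl//; last first.
  by apply: (@bounded_integrable _ 1); [exact: measurable_indic_set|move=> x; rewrite ger0_norm ?indic_ge0 ?indic_le1].
apply: le_Rintegral => //.
  apply: (@bounded_integrable _ m).
    by apply: measurable_funM => //; exact: measurable_indic_set.
  by move=> x; rewrite normrM (ger0_norm (indic_ge0 _)) gtr0_norm// ler_piMr ?indic_le1// ltW.
move=> x _; have [h|h] := pselect (m < f x); last by rewrite indicF// mulr0.
by rewrite indicT// mulr1 ltW.
Qed.

Lemma rad_integrable n (F : seq bool -> T -> R) :
  (forall e, P.-integrable setT (EFin \o F e)) ->
  P.-integrable setT (EFin \o (fun x => rad n (F ^~ x))) /\
  \int[P]_x rad n (F ^~ x) = rad n (fun e => \int[P]_x F e x).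
Proof.
elim: n F => [|n IH] F iF /=; first by split; [exact: iF|].
have [i1 e1] := IH (fun e => F (true :: e)) (fun e => iF _).
have [i2 e2] := IH (fun e => F (false :: e)) (fun e => iF _).
have i12 := integrableD measurableT i1 i2.
split.
  have := integrableZl measurableT (2^-1) i12.
  by apply: eq_integrable => // x _ /=; rewrite -EFinD -EFinM mulrC.
by rewrite RintegralZr// RintegralD// e1 e2.
Qed.

End probability_tools.

(** * Symmetrisation by a ghost sample *)

Section ghost_sample.
Context {R : realType} {dO dS : measure_display} {Omega : measurableType dO}
  {S : measurableType dS}.
Context (P : probability Omega R) (rho : probability S R) (n : nat)
  (W : 'I_n -> {RV P >-> S}).

Definition sample (w : Omega) : n.-tuple S := [tuple W i w | i < n].

Definition swap (e : seq bool) (x y : n.-tuple S) : n.-tuple S :=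
  [tuple if nth false e i then tnth y i else tnth x i | i < n].

Lemma measurable_sample : measurable_fun setT sample.
Proof.
apply/measurable_fun_tnthP => i.
rewrite (_ : _ \o _ = W i); first exact: measurable_funPT.
by apply/funext => w /=; rewrite tnth_mktuple.
Qed.

Lemma measurable_sample_set (c : set (n.-tuple S)) : measurable c ->
  measurable [set w | c (sample w)].
Proof.
by move=> mc; rewrite -[X in measurable X]setTI; exact: measurable_sample.
Qed.

Definition rectangle (A B : 'I_n -> set S) : set (n.-tuple S * n.-tuple S) :=
  [set xy | forall i, A i (tnth xy.1 i) /\ B i (tnth xy.2 i)].

Lemma measurable_rectangle A B : (forall i, measurable (A i)) ->
  (forall i, measurable (B i)) -> measurable (rectangle A B).
Proof.
move=> mA mB.
apply: (measurable_forall (A := fun i =>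
  ((fun xy => tnth xy.1 i) @^-1` A i) `&` ((fun xy => tnth xy.2 i) @^-1` B i))) => i.
apply: measurableI; rewrite -[X in measurable X]setTI.
- by apply: (measurableT_comp (@measurable_tnth _ S n i) measurable_fst) => //; exact: mA.
- by apply: (measurableT_comp (@measurable_tnth _ S n i) measurable_snd) => //; exact: mB.
Qed.

Definition rectangles : set (set (n.-tuple S * n.-tuple S)) :=
  [set C | exists A B, [/\ forall i, measurable (A i), forall i, measurable (B i)
     & C = rectangle A B]].

Lemma rectanglesT : rectangles setT.
Proof.
by exists (fun=> setT), (fun=> setT); split => //; apply/seteqP; split.
Qed.

Lemma rectanglesI : setI_closed rectangles.
Proof.
move=> _ _ [A [B [mA mB ->]]] [A' [B' [mA' mB' ->]]].
exists (fun i => A i `&` A' i), (fun i => B i `&` B' i); split => [i|i|].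
- exact: measurableI.
- exact: measurableI.
apply/seteqP; split => [xy [h h'] i|xy h]; first by have [? ?] := h i; have [? ?] := h' i.
by split => i; have [[? ?] [? ?]] := h i.
Qed.

Lemma measurable_rectangles :
  @measurable _ (n.-tuple S * n.-tuple S)%type = <<s rectangles >>.
Proof.
apply/seteqP; split; last first.
  apply: smallest_sub; first exact: sigma_algebra_measurable.
  by move=> _ [A [B [mA mB ->]]]; exact: measurable_rectangle.
move=> U mU.
pose idf : g_sigma_algebraType rectangles -> (n.-tuple S * n.-tuple S)%type := id.
have mid : measurable_fun setT idf.
  apply/measurable_fun_pairP; split; apply/measurable_fun_tnthP => i _ A mA;
    rewrite setTI; apply: sub_gen_smallest.
  - exists (fun k => if k == i then A else setT), (fun=> setT); split => //.
      by move=> k; case: ifP.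
    apply/seteqP; split => [xy /= h k|xy /= h]; first by case: eqP => [->|].
    by have := (h i).1; rewrite eqxx.
  - exists (fun=> setT), (fun k => if k == i then A else setT); split => //.
      by move=> k; case: ifP.
    apply/seteqP; split => [xy /= h k|xy /= h]; first by case: eqP => [->|].
    by have := (h i).2; rewrite eqxx.
by have := mid measurableT U mU; rewrite setTI.
Qed.

Context (iid : is_iid rho W).

Lemma iid_rect (A : 'I_n -> set S) : (forall i, measurable (A i)) ->
  P [set w | forall i, A i (W i w)] = (\prod_(i < n) rho (A i))%E.
Proof.
move=> mA; have [idd ind] := iid.
have := ind finset.setT A mA.
have -> : \bigcap_(i in [set` finset.setT]) W i @^-1` A i = [set w | forall i, A i (W i w)].
  apply/seteqP; split => w h i; last by move=> _; exact: h.
  by apply: h; rewrite /= finset.in_setT.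
move=> ->; apply: eq_big => [i|i _]; first by rewrite finset.in_setT.
exact: idd.
Qed.

Lemma measurable_ghost (e : seq bool) :
  measurable_fun setT (fun w : Omega * Omega =>
    (swap e (sample w.1) (sample w.2), swap e (sample w.2) (sample w.1))).
Proof.
have m1 i : measurable_fun setT (fun w : Omega * Omega => W i w.1).
  by apply: (measurableT_comp (measurable_funPT (W i)) measurable_fst).
have m2 i : measurable_fun setT (fun w : Omega * Omega => W i w.2).
  by apply: (measurableT_comp (measurable_funPT (W i)) measurable_snd).
apply: measurable_fun_pair; apply/measurable_fun_tnthP => i.
- rewrite (_ : _ \o _ = fun w : Omega * Omega => if nth false e i then W i w.2 else W i w.1).
    by case: (nth _ _ _).
  by apply/funext => w /=; rewrite !tnth_mktuple.
- rewrite (_ : _ \o _ = fun w : Omega * Omega => if nth false e i then W i w.1 else W i w.2).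
    by case: (nth _ _ _).
  by apply/funext => w /=; rewrite !tnth_mktuple.
Qed.

Lemma ghost_rect e A B : (forall i, measurable (A i)) -> (forall i, measurable (B i)) ->
  (P \x P)%E [set w | rectangle A B
     (swap e (sample w.1) (sample w.2), swap e (sample w.2) (sample w.1))] =
  (\prod_(i < n) (rho (A i) * rho (B i)))%E.
Proof.
move=> mA mB.
pose A' (i : 'I_n) := if nth false e i then B i else A i.
pose B' (i : 'I_n) := if nth false e i then A i else B i.
have mA' i : measurable (A' i) by rewrite /A'; case: ifP.
have mB' i : measurable (B' i) by rewrite /B'; case: ifP.
have mP (C : 'I_n -> set S) : (forall i, measurable (C i)) ->
    measurable [set w | forall i, C i (W i w)].
  move=> mC; apply: (measurable_forall (A := fun i => W i @^-1` C i)) => i.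
  by rewrite -[X in measurable X]setTI; exact: (measurable_funPT (W i)).
have -> : [set w | rectangle A B
     (swap e (sample w.1) (sample w.2), swap e (sample w.2) (sample w.1))] =
   [set w | forall i, A' i (W i w)] `*` [set w | forall i, B' i (W i w)].
  apply/seteqP; split => [w h|w [h1 h2] i]; first split=> i.
  - by have := h i; rewrite /= !tnth_mktuple /A'; case: ifP => _ [].
  - by have := h i; rewrite /= !tnth_mktuple /B'; case: ifP => _ [].
  - have := h1 i; have := h2 i; rewrite /= !tnth_mktuple /A' /B'.
    by case: ifP.
transitivity (P [set w | forall i, A' i (W i w)] * P [set w | forall i, B' i (W i w)])%E.
  by apply: product_measure1E; exact: mP.
rewrite (iid_rect mA') (iid_rect mB') -big_split/=; apply: eq_bigr => i _.
by rewrite /A' /B'; case: ifP => // _; rewrite muleC.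
Qed.

(** By independence the two laws agree on rectangles, which are stable under
    intersection and generate the product sigma-algebra. *)
Lemma ghost_swap_law e (U : set (n.-tuple S * n.-tuple S)) : measurable U ->
  (P \x P)%E [set w | U (sample w.1, sample w.2)] =
  (P \x P)%E [set w | U
     (swap e (sample w.1) (sample w.2), swap e (sample w.2) (sample w.1))].
Proof.
move=> mU.
have swap0 x y : swap [::] x y = x.
  by apply: eq_from_tnth => i; rewrite tnth_mktuple nth_nil.
have -> : [set w | U (sample w.1, sample w.2)] =
  [set w | U (swap [::] (sample w.1) (sample w.2), swap [::] (sample w.2) (sample w.1))].
  by apply/seteqP; split => w /=; rewrite !swap0.
pose f e (w : Omega * Omega) :=
  (swap e (sample w.1) (sample w.2), swap e (sample w.2) (sample w.1)).
pose fm e := isMeasurableFun.Build _ _ _ _ (f e) (measurable_ghost e).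
pose F e : {mfun _ >-> _} := HB.pack (f e) (fm e).
apply: (@measure_unique _ R _ rectangles (fun=> setT) _ _ _ _
  (pushforward (P \x P)%E (F [::])) (pushforward (P \x P)%E (F e))) => //.
- exact: measurable_rectangles.
- exact: rectanglesI.
- by move=> _; exact: rectanglesT.
- by apply: bigcup_const => //; exists 0.
- by move=> _ [A [B [mA mB ->]]]; rewrite /= /pushforward/=; rewrite !ghost_rect.
- by move=> _; rewrite /= /pushforward/= preimage_setT; rewrite probability_setT ltry.
Qed.

(** Symmetrisation by a ghost sample.  Independently of the index [j] for which
    the sample is exceptional, a second sample is likely to be typical; given
    the two samples, the signs deciding which point belongs to which of them
    are uniform and can be averaged over. *)
Lemma ghost_symmetrization (J : finType) (a b : J -> set (n.-tuple S)) (del : R) :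
  (forall j, measurable (a j)) -> (forall j, measurable (b j)) ->
  (forall j, 1 / 2 <= pr P [set w | b j (sample w)]) ->
  (forall x y, rad n (fun e =>
     indic (exists j, a j (swap e x y) /\ b j (swap e y x))) <= del) ->
  pr P [set w | exists j, a j (sample w)] <= 2 * del.
Proof.
move=> ma mb b2 radle.
set A := [set w | _].
have mA : measurable A by apply: measurable_exists => j; exact: measurable_sample_set.
pose U : set (n.-tuple S * n.-tuple S) := [set xy | exists j, a j xy.1 /\ b j xy.2].
have mU : measurable U.
  by apply: (measurable_exists (A := fun j => a j `*` b j)) => j; exact: measurableX.
pose V e := [set w : Omega * Omega | U
   (swap e (sample w.1) (sample w.2), swap e (sample w.2) (sample w.1))].
have mV e : measurable (V e).
  by rewrite -[X in measurable X]setTI; exact: measurable_ghost.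
pose V0 := [set w : Omega * Omega | U (sample w.1, sample w.2)].
have mV0 : measurable V0.
  have -> : V0 = V [::].
    apply/seteqP; split => w; rewrite /V /V0 /=;
      have s0 x y : swap [::] x y = x
        by [apply: eq_from_tnth => i; rewrite tnth_mktuple nth_nil];
      by rewrite !s0.
  exact: mV.
have V0e e : pr (P \x P)%E V0 = pr (P \x P)%E (V e).
  by rewrite /pr; congr fine; exact: ghost_swap_law.
have V0le : pr (P \x P)%E V0 <= del.
  rewrite -(rad_cst n (pr _ V0)).
  have -> : rad n (fun=> pr (P \x P)%E V0) =
      rad n (fun e => \int[(P \x P)%E]_w indic (V e w)).
    by apply: eq_rad => e _; rewrite Rintegral_indic.
  have iV e : (P \x P)%E.-integrable setT (EFin \o (fun w => indic (V e w) : R)).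
    apply: (@bounded_integrable _ _ _ _ _ 1); first exact: measurable_indic_set.
    by move=> x; rewrite ger0_norm ?indic_ge0 ?indic_le1.
  have [i <-] := rad_integrable n iV.
  rewrite -[leRHS]mulr1 -[X in _ * X](_ : fine ((P \x P)%E setT) = 1); last first.
    by rewrite probability_setT.
  rewrite -Rintegral_cst//; apply: le_Rintegral => //.
    by apply: (@bounded_integrable _ _ _ _ _ `|del|) => //; exact: measurable_cst.
  by move=> w _; exact: radle.
suff : pr P A <= 2 * pr (P \x P)%E V0 by lra.
rewrite -lee_fin EFinM !prE//= /product_measure1.
have -> : P A = (2%:E * \int[P]_x ((1 / 2)%:E * (\1_A x)%:E))%E.
  rewrite ge0_integralZl//.
  - by rewrite integral_indic// setIT muleA -EFinM (_ : 2 * (1 / 2) = 1) ?mul1e//; field.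
  - exact/measurable_EFinP/measurable_indic.
rewrite lee_pmul2l//.
apply: ge0_le_integral => //.
- by apply/measurable_EFinP; apply: measurable_funM => //; exact: measurable_indic.
- exact: measurable_fun_xsection.
move=> w _; rewrite indicE; case: (boolP (w \in A)) => wA; last by rewrite mule0.
rewrite mule1; move: wA; rewrite inE => -[j aj].
apply: (@le_trans _ _ (P [set w' | b j (sample w')])).
  by rewrite -prE ?lee_fin//; exact: measurable_sample_set.
apply: le_measure; rewrite ?inE//; [exact: measurable_sample_set|exact: measurable_xsection|].
by move=> w' bj; rewrite /xsection/= inE; exists j.
Qed.

End ghost_sample.

(** * Moments of an independent sample *)

Section iid_moments.
Context {R : realType} {dO dS : measure_display} {Omega : measurableType dO}
  {S : measurableType dS}.
Context (P : probability Omega R) (rho : probability S R) (n : nat)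
  (W : 'I_n -> {RV P >-> S}) (iid : is_iid rho W).
Implicit Types f h : S -> R.

Lemma measurable_comp_RV i f : measurable_fun setT f ->
  measurable_fun setT (fun w => f (W i w)).
Proof. by move=> mf; exact: (measurableT_comp mf (measurable_funPT (W i))). Qed.

Lemma expectation_iid i f (c : R) : measurable_fun setT f -> (forall x, `|f x| <= c) ->
  \int[P]_w f (W i w) = \int[rho]_x f x.
Proof.
move=> mf fc; rewrite /Rintegral; congr fine.
have mfE : measurable_fun setT (EFin \o f) by exact/measurable_EFinP.
have := @integral_pushforward _ _ _ _ R (W i) (measurable_funPT (W i)) P setT (EFin \o f) mfE.
rewrite preimage_setT => /(_ _ measurableT) <-.
  by apply: eq_measure_integral => A mA _; exact: iid.1.
apply: (@bounded_integrable _ _ _ P (fun w => f (W i w)) c) => //.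
exact: measurable_comp_RV.
Qed.

Lemma pair_law i k (A B : set S) : i != k -> measurable A -> measurable B ->
  P [set w | A (W i w) /\ B (W k w)] = (rho A * rho B)%E.
Proof.
move=> ik mA mB.
pose C (l : 'I_n) := if l == i then A else if l == k then B else setT.
have mC l : measurable (C l) by rewrite /C; do 2 case: ifP => //.
have -> : [set w | A (W i w) /\ B (W k w)] = [set w | forall l, C l (W l w)].
  apply/seteqP; split => [w [Aw Bw] l|w h].
    by rewrite /C; case: eqVneq => [->//|_]; case: eqVneq => [->|].
  split; first by have := h i; rewrite /C eqxx.
  by have := h k; rewrite /C eqxx eq_sym (negbTE ik).
rewrite (iid_rect iid mC) (bigD1 i)//= (bigD1 k)//=; last by rewrite eq_sym.
rewrite {1 2}/C !eqxx eq_sym (negbTE ik) big1 ?mule1// => l /andP[/negbTE li /negbTE lk].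
by rewrite /C li lk probability_setT.
Qed.

Lemma expectation_pair i k f (c : R) : i != k -> measurable_fun setT f ->
  (forall x, `|f x| <= c) ->
  \int[P]_w (f (W i w) * f (W k w)) = (\int[rho]_x f x) ^+ 2.
Proof.
move=> ik mf fc.
have fi : rho.-integrable setT (EFin \o f) by exact: bounded_integrable fc.
have c0 : 0 <= c by exact: le_trans (fc point).
pose phi (w : Omega) := (W i w, W k w).
have mphi : measurable_fun setT phi.
  by apply: measurable_fun_pair; exact: measurable_funPT.
pose g (xy : S * S) := f xy.1 * f xy.2.
have mg : measurable_fun setT g.
  by apply: measurable_funM; [exact: (measurableT_comp mf measurable_fst)|
    exact: (measurableT_comp mf measurable_snd)].
have gc xy : `|g xy| <= c * c by rewrite normrM ler_pM.
have mgE : measurable_fun setT (EFin \o g) by exact/measurable_EFinP.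
rewrite /Rintegral.
have -> : (\int[P]_w (f (W i w) * f (W k w))%:E = \int[(rho \x rho)%E]_xy (EFin \o g) xy)%E.
  have := @integral_pushforward _ _ _ _ R phi mphi P setT (EFin \o g) mgE.
  rewrite preimage_setT => /(_ _ measurableT) <-; last first.
    apply: (@bounded_integrable _ _ _ P (g \o phi) (c * c)).
      exact: (measurableT_comp mg mphi).
    by move=> w; exact: gc.
  apply: eq_measure_integral => A mA _; apply/esym.
  apply: (@product_measure_unique _ _ _ _ R rho rho (pushforward P phi)) => // A' B' mA' mB'.
  exact: pair_law.
have gi : (rho \x rho)%E.-integrable setT (EFin \o g).
  exact: (@bounded_integrable _ _ _ _ g (c * c)).
have -> : (\int[(rho \x rho)%E]_xy (EFin \o g) xy = \int[rho]_x (f x * \int[rho]_y f y)%:E)%E.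
  rewrite -(integral12_prod_meas1 gi); apply: eq_integral => x _.
  rewrite /fubini_F/= /g/=; under eq_integral do rewrite EFinM.
  rewrite integralZl// EFinM; congr (_ * _)%E.
  by rewrite fineK// integrable_fin_num.
exact: RintegralZr.
Qed.

(** Pairwise independence makes the variance of the sum additive. *)
Lemma chebyshev_iid h (c v L : R) : measurable_fun setT h -> (forall x, `|h x| <= c) ->
  \int[rho]_x (h x ^+ 2) <= v -> 0 < L -> 4 * (n%:R * v) <= L ^+ 2 ->
  pr P [set w | L ^+ 2 < (\sum_(i < n) h (W i w) - n%:R * \int[rho]_x h x) ^+ 2]
    <= 1 / 4.
Proof.
move=> mh hc hv L0 Lv; set m := \int[rho]_x h x.
have hi : rho.-integrable setT (EFin \o h) by exact: bounded_integrable hc.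
have c0 : 0 <= c by exact: le_trans (hc point).
pose f x := h x - m.
have mf : measurable_fun setT f by apply: measurable_funB.
have fc x : `|f x| <= c + `|m| by rewrite (le_trans (ler_normB _ _))// lerD2r.
have f_int : \int[rho]_x f x = 0.
  rewrite RintegralB//; last by apply: (@bounded_integrable _ _ _ _ (cst m) `|m|).
  by rewrite Rintegral_pr_cst subrr.
have mhh : measurable_fun setT (fun x => h x ^+ 2) by exact: measurable_funX.
have hhi : rho.-integrable setT (EFin \o (fun x => h x ^+ 2)).
  apply: (@bounded_integrable _ _ _ _ _ (c ^+ 2)) => // x.
  by rewrite normrX ler_sqr ?nnegrE// ?(le_trans _ (hc x)).
have ff_int : \int[rho]_x (f x * f x) <= v.
  apply: le_trans hv.
  have -> : \int[rho]_x (f x * f x) = \int[rho]_x (h x ^+ 2 - (2 * m * h x - m ^+ 2)).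
    by apply: eq_Rintegral => x _; rewrite /f; ring.
  have i1 : rho.-integrable setT (EFin \o (fun x => 2 * m * h x)).
    apply: (@bounded_integrable _ _ _ _ _ (`|2 * m| * c)).
      exact: measurable_funM.
    by move=> x; rewrite normrM ler_wpM2l.
  have i2 : rho.-integrable setT (EFin \o (fun _ : S => m ^+ 2)).
    by apply: (@bounded_integrable _ _ _ _ (cst (m ^+ 2)) `|m ^+ 2|).
  have i3 : rho.-integrable setT (EFin \o (fun x => 2 * m * h x - m ^+ 2)).
    by have := integrableB measurableT i1 i2; apply: eq_integrable.
  rewrite RintegralB// RintegralB// RintegralZl// Rintegral_pr_cst -/m.
  have := sqr_ge0 m; lra.
pose D w := \sum_(i < n) f (W i w).
have DE w : \sum_(i < n) h (W i w) - n%:R * m = D w.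
  by rewrite /D sumrB sumr_const card_ord -[m *+ n]mulr_natl.
have -> : [set w | L ^+ 2 < (\sum_(i < n) h (W i w) - n%:R * m) ^+ 2] =
    [set w | L ^+ 2 < D w ^+ 2] by apply/seteqP; split => w /=; rewrite DE.
have mfW i : measurable_fun setT (fun w => f (W i w)) by exact: measurable_comp_RV.
have mD : measurable_fun setT D by apply: measurable_sum.
have mD2 : measurable_fun setT (fun w => D w ^+ 2) by exact: measurable_funX.
have ip i k : P.-integrable setT (EFin \o (fun w => f (W i w) * f (W k w))).
  apply: (@bounded_integrable _ _ _ _ _ ((c + `|m|) * (c + `|m|))).
    exact: measurable_funM.
  by move=> w; rewrite normrM ler_pM.
have D2E w : D w ^+ 2 = \sum_(ik : 'I_n * 'I_n) f (W ik.1 w) * f (W ik.2 w).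
  rewrite expr2 /D mulr_suml -(pair_bigA _ (fun i k => f (W i w) * f (W k w)))/=.
  by apply: eq_bigr => i _; rewrite mulr_sumr.
have [Di DiE] := Rintegral_sum (index_enum ('I_n * 'I_n)%type)
  measurableT (fun ik => ip ik.1 ik.2).
rewrite (_ : (fun w => \sum_(ik : 'I_n * 'I_n) f (W ik.1 w) * f (W ik.2 w)) =
  fun w => D w ^+ 2) in Di DiE; last by apply/funext => w; rewrite D2E.
have D2int : \int[P]_w (D w ^+ 2) <= n%:R * v.
  rewrite DiE.
  rewrite -(pair_bigA _ (fun i k => \int[P]_w (f (W i w) * f (W k w))))/=.
  apply: (@le_trans _ _ (\sum_(i < n) v)); last by rewrite sumr_const card_ord -[v *+ n]mulr_natl.
  apply: ler_sum => i _; rewrite (bigD1 i)//= big1 ?addr0.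
    rewrite (@expectation_iid i (fun x => f x * f x) ((c + `|m|) * (c + `|m|)))//.
      exact: measurable_funM.
    by move=> x; rewrite normrM ler_pM.
  by move=> k ki; rewrite (@expectation_pair i k f (c + `|m|)) ?f_int ?expr0n// eq_sym.
have L2 : 0 < L ^+ 2 by rewrite exprn_gt0.
have := markov mD2 (fun w => sqr_ge0 (D w)) Di L2.
set q := pr P _ => /le_trans/(_ D2int) qv.
rewrite -(ler_pM2l L2); lra.
Qed.

End iid_moments.

(** * Tail bounds for empirical sums *)

Section tails.
Context {R : realType} {dO dS : measure_display} {Omega : measurableType dO}
  {S : measurableType dS}.
Context (P : probability Omega R) (rho : probability S R) (n : nat)
  (W : 'I_n -> {RV P >-> S}) (iid : is_iid rho W) (J : finType).
Implicit Types (f : S -> R) (x y : n.-tuple S).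

Definition ssum f x : R := \sum_(i < n) f (tnth x i).

(** Indexed by [nat], as [rsum] expects; past the end both samples have the default
    point, so that the entries vanish. *)
Definition dvec f x y (i : nat) : R := f (nth point x i) - f (nth point y i).

Lemma measurable_ssum f : measurable_fun setT f -> measurable_fun setT (ssum f).
Proof.
by move=> mf; apply: measurable_sum => i; exact: (measurableT_comp mf (measurable_tnth i)).
Qed.

Lemma ssum_sample f w : ssum f (sample W w) = \sum_(i < n) f (W i w).
Proof. by apply: eq_bigr => i _; rewrite tnth_mktuple. Qed.

Lemma ssum_swapB f e x y :
  ssum f (swap e x y) - ssum f (swap e y x) = rsum n e (dvec f x y).
Proof.
rewrite /ssum /rsum -sumrB; apply: eq_bigr => i _.
rewrite !tnth_mktuple /dvec !(tnth_nth point).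
by case: (nth _ e i); rewrite ?expr0 ?expr1; ring.
Qed.

Lemma ssum_swapD f e x y :
  ssum f (swap e x y) + ssum f (swap e y x) = ssum f x + ssum f y.
Proof.
rewrite /ssum -!big_split/=; apply: eq_bigr => i _; rewrite !tnth_mktuple.
by case: (nth _ e i); rewrite // addrC.
Qed.

Lemma norm2_dvec_le f x y (B : R) : (forall z, 0 <= f z <= B) ->
  norm2 n (dvec f x y) ^+ 2 <= B * (ssum f x + ssum f y).
Proof.
move=> fB; rewrite norm2_sqr /ssum -big_split mulr_sumr; apply: ler_sum => i _.
rewrite /dvec !(tnth_nth point).
have /andP[a0 aB] := fB (nth point x i); have /andP[b0 bB] := fB (nth point y i).
set a := f _ in a0 aB *; set b := f _ in b0 bB *.
rewrite /=; nra.
Qed.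

Lemma half_event (A B : set Omega) : measurable A -> measurable B ->
  3 / 4 <= pr P A -> pr P B <= 1 / 4 -> 1 / 2 <= pr P (A `&` ~` B).
Proof.
move=> mA mB A34 B14.
have mAB : measurable (A `&` ~` B) by apply: measurableI => //; exact: measurableC.
have : pr P A <= pr P (A `&` ~` B) + pr P B.
  apply: (le_trans _ (pr_setU P mAB mB)); apply: le_pr => //; first exact: measurableU.
  by move=> w Aw; have [Bw|nBw] := pselect (B w); [right|left].
lra.
Qed.

(** An upper tail at a constant multiple of the mean.  A sample for which the
    sum is large while it is not for the ghost sample produces a large
    difference, and for nonnegative functions the Euclidean norm of the
    differences is controlled by the large sum itself. *)
Lemma nonneg_tail (q : J -> S -> R) (c : set (n.-tuple S)) (B v l L M u : R) :
  (forall j, measurable_fun setT (q j)) -> (forall j z, 0 <= q j z <= B) ->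
  (forall j, \int[rho]_z q j z <= v) ->
  measurable c -> 3 / 4 <= pr P [set w | c (sample W w)] ->
  0 < l -> 4 * (n%:R * v) <= l -> 8 * l <= L -> 4 * M <= L -> 0 <= u ->
  18 * ((u + 1) ^+ 2 * B) <= L ->
  (forall x y e, c (swap e x y) -> c (swap e y x) -> rad n (fun s => indic (exists j,
     M + 2 * norm2 n (dvec (q j) x y) < rsum n s (dvec (q j) x y))) <= 1 / 2 :> R) ->
  pr P [set w | exists j, c (sample W w) /\ L < ssum (q j) (sample W w)] <=
    4 * expR (- (u ^+ 2 / 16)).
Proof.
move=> mq qB qv mc c34 l0 nvl lL ML u0 uB cM.
have nvl4 : n%:R * v <= l * (1 / 4) by lra.
have B0 (j : J) : 0 <= B by have /andP[h1 h2] := qB j point; exact: le_trans h1 h2.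
have -> : 4 * expR (- (u ^+ 2 / 16)) = 2 * (2 * expR (- (u ^+ 2 / 16))) by ring.
apply: (ghost_symmetrization iid (J := J) (a := fun j : J => c `&` [set x | L < ssum (q j) x])
  (b := fun j : J => c `&` ~` [set x | l < ssum (q j) x])).
- move=> j; apply: measurableI => //.
  by apply: measurable_set_ltr => //; exact: measurable_ssum.
- move=> j; apply: measurableI => //; apply: measurableC.
  by apply: measurable_set_ltr => //; exact: measurable_ssum.
- move=> j; apply: (half_event (A := [set w | c (sample W w)])
    (B := [set w | l < ssum (q j) (sample W w)])) => //.
  + exact: measurable_sample_set.
  + by apply: (@measurable_sample_set _ _ _ _ _ P n W [set x | l < ssum (q j) x]); apply: measurable_set_ltr => //; exact: measurable_ssum.
  + have qn z : `|q j z| <= B by have /andP[h1 h2] := qB j z; rewrite ger0_norm.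
    have qi i : P.-integrable setT (EFin \o (fun w => q j (W i w))).
      apply: (@bounded_integrable _ _ _ P (fun w => q j (W i w)) B).
        exact: (@measurable_comp_RV _ _ _ _ _ P n W i (q j) (mq j)).
      by move=> w; exact: qn.
    have [si sE] := Rintegral_sum (index_enum 'I_n) measurableT qi.
    have E : (fun w => ssum (q j) (sample W w)) = (fun w => \sum_(i < n) q j (W i w)).
      by apply/funext => w; rewrite ssum_sample.
    have h : \int[P]_w ssum (q j) (sample W w) <= n%:R * v.
      rewrite [X in Rintegral _ _ X]E sE.
      apply: (@le_trans _ _ (\sum_(i < n) v)); last by rewrite sumr_const card_ord -[v *+ n]mulr_natl.
      by apply: ler_sum => i _; rewrite (expectation_iid iid i (mq j) qn).
    have := markov (P := P) (f := fun w => ssum (q j) (sample W w)) (m := l).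
    move=> /(_ _ _ _ l0)/le_trans/(_ h) H; rewrite -(ler_pM2l l0).
    apply: le_trans (H _ _ _) _; last exact: nvl4.
    - exact: (measurableT_comp (measurable_ssum (mq j)) (measurable_sample W)).
    - by move=> w; apply: sumr_ge0 => i _; have /andP[] := qB j (tnth (sample W w) i).
    - by rewrite E.
move=> x y.
have [[e0 [c1 c2]]|nc] := pselect (exists e, c (swap e x y) /\ c (swap e y x)); last first.
  rewrite (@eq_rad _ _ _ (fun=> 0)); first by rewrite rad_cst mulr_ge0// expR_ge0.
  by move=> e _; rewrite indicF// => -[j [[? _] [? _]]]; apply: nc; exists e.
apply: le_trans (cube_deviation (v := fun j : J => dvec (q j) x y)
  (M := fun j : J => M + 2 * norm2 n (dvec (q j) x y)) u0 (cM _ _ _ c1 c2)).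
apply: le_rad => e _; apply: le_indic => -[j [[_ LS] [_ /negP]]]; rewrite -leNgt => lS'.
exists j; rewrite -ssum_swapB.
move: LS => /= LS; have {}B0 : 0 <= B := B0 j.
set s := ssum (q j) (swap e x y) in LS *; set s' := ssum (q j) (swap e y x) in lS' *.
set N := norm2 n _.
have NB : N ^+ 2 <= B * (s + s') by rewrite /s /s' ssum_swapD; exact: norm2_dvec_le.
have N0 : 0 <= N by exact: norm2_ge0.
have s0 : 0 < s by lra.
have Ns : 2 * (N * (u + 1)) <= s / 2.
  rewrite -(@ler_pXn2r _ 2)// ?nnegrE; last 2 first.
  - by rewrite !mulr_ge0// addr_ge0.
  - by rewrite divr_ge0// ltW.
  have -> : (2 * (N * (u + 1))) ^+ 2 = 4 * ((u + 1) ^+ 2 * N ^+ 2) by ring.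
  apply: (@le_trans _ _ (4 * ((u + 1) ^+ 2 * (B * (9 / 8 * s))))).
    rewrite ler_pM2l// ler_wpM2l ?sqr_ge0//; apply: le_trans NB _.
    by rewrite ler_wpM2l//; lra.
  have -> : 4 * ((u + 1) ^+ 2 * (B * (9 / 8 * s))) =
     (18 * ((u + 1) ^+ 2 * B)) * s / 4 by field.
  have := ler_wpM2r (ltW s0) uB; nra.
lra.
Qed.

(** A deviation of size [2 L] on the sample but at most [L] on the ghost sample is
    a Rademacher sum of size at least [L].  Its deviation scale [N] is computed
    from the two samples, on events [D j] that only have to be likely for each
    [j] separately. *)
Lemma deviation_tail (h : J -> S -> R) (D : J -> set (n.-tuple S)) (b v L M N u : R) :
  (forall j, measurable_fun setT (h j)) -> (forall j z, `|h j z| <= b) ->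
  (forall j, \int[rho]_z (h j z ^+ 2) <= v) ->
  (forall j, measurable (D j)) -> (forall j, 3 / 4 <= pr P [set w | D j (sample W w)]) ->
  0 < L -> 4 * (n%:R * v) <= L ^+ 2 -> 0 <= u -> M + 2 * (N * u) <= L ->
  (forall x y e j, D j (swap e x y) -> D j (swap e y x) ->
     norm2 n (dvec (h j) x y) <= N /\ rad n (fun s => indic (exists j,
       M < rsum n s (dvec (h j) x y))) <= 1 / 2 :> R) ->
  pr P [set w | exists j, D j (sample W w) /\
     2 * L < ssum (h j) (sample W w) - n%:R * \int[rho]_z h j z] <=
    4 * expR (- (u ^+ 2 / 16)).
Proof.
move=> mh hb hv mD D34 L0 vL u0 MNL DM.
have -> : 4 * expR (- (u ^+ 2 / 16)) = 2 * (2 * expR (- (u ^+ 2 / 16))) by ring.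
pose m j := n%:R * \int[rho]_z h j z.
have mA j : measurable [set x | 2 * L < ssum (h j) x - m j].
  by apply: measurable_set_ltr => //; apply: measurable_funB => //; exact: measurable_ssum.
have mB j : measurable [set x | L ^+ 2 < (ssum (h j) x - m j) ^+ 2].
  apply: measurable_set_ltr => //; apply: measurable_funX.
  by apply: measurable_funB => //; exact: measurable_ssum.
apply: (ghost_symmetrization iid (J := J) (a := fun j : J => D j `&` [set x | 2 * L < ssum (h j) x - m j])
  (b := fun j : J => D j `&` ~` [set x | L ^+ 2 < (ssum (h j) x - m j) ^+ 2])).
- by move=> j; apply: measurableI.
- by move=> j; apply: measurableI => //; apply: measurableC.
- move=> j; apply: (half_event (A := [set w | D j (sample W w)])
    (B := [set w | L ^+ 2 < (ssum (h j) (sample W w) - m j) ^+ 2])) => //.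
  + exact: measurable_sample_set.
  + exact: (measurable_sample_set W (mB j)).
  + have := chebyshev_iid iid (mh j) (hb j) (hv j) L0 vL.
    congr (pr P _ <= _); apply/seteqP; split => w /=; by rewrite ssum_sample.
move=> x y.
have [[e0 [j0 [d1 d2]]]|nc] := pselect (exists e j, D j (swap e x y) /\ D j (swap e y x)); last first.
  rewrite (@eq_rad _ _ _ (fun=> 0)); first by rewrite rad_cst mulr_ge0// expR_ge0.
  by move=> e _; rewrite indicF// => -[j [[? _] [? _]]]; apply: nc; exists e, j.
apply: le_trans (cube_deviation (v := fun j : J => dvec (h j) x y)
  (M := fun=> M) u0 (DM _ _ _ _ d1 d2).2).
apply: le_rad => e _; apply: le_indic => -[j [[dj LS] [dj' /negP]]]; rewrite -leNgt => S'L.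
have [Nj _] := DM _ _ _ _ dj dj'.
exists j; rewrite -ssum_swapB.
have S'L' : - L <= ssum (h j) (swap e y x) - m j <= L.
  by rewrite -ler_norml -(@ler_pXn2r _ 2)// ?nnegrE ?normr_ge0 ?(ltW L0)// real_normK ?num_real.
have := ler_wpM2r u0 Nj.
move: S'L' => /andP[_ S'L']; move: LS => /=; lra.
Qed.

End tails.

(** * Random signs and hinge increments *)

Section rad_tail_bounds.
Context {R : realType} {T : finType} (j0 : T).

Lemma rad_chebyshev n (v : nat -> R) :
  rad n (fun s => indic (2 * norm2 n v < rsum n s v)) <= 1 / 4 :> R.
Proof.
set N := norm2 n v; have N0 : 0 <= N by exact: norm2_ge0.
have E : rad n (fun s => (0 + rsum n s v) ^+ 2) = N ^+ 2.
  by rewrite rad_sqr expr0n/= add0r /N norm2_sqr.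
have [N_eq0|N_gt0] := leP N 0.
  have NE : N = 0 by apply/eqP; rewrite eq_le N_eq0.
  have v0 i : (i < n)%N -> v i = 0.
    move=> ni; have : \sum_(i < n) v i ^+ 2 = 0 by rewrite -norm2_sqr -/N NE expr0n.
    move/eqP; rewrite psumr_eq0; last by move=> k _; rewrite sqr_ge0.
    move/allP => /(_ (Ordinal ni) (mem_index_enum _)); rewrite /= sqrf_eq0; exact: eqP.
  rewrite (@eq_rad _ _ _ (fun=> 0)) ?rad_cst// => s _; rewrite indicF// NE mulr0.
  by rewrite /rsum big1 ?ltxx// => i _; rewrite v0 ?mulr0.
have N2 : 0 < 4 * N ^+ 2 by rewrite mulr_gt0// exprn_gt0.
rewrite -(ler_pM2l N2) -radZ.
have -> : 4 * N ^+ 2 * (1 / 4) = N ^+ 2 by field.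
rewrite -E; apply: le_rad => s _; rewrite add0r.
have [h|h] := pselect (2 * N < rsum n s v); last by rewrite indicF// mulr0 sqr_ge0.
rewrite indicT//; nra.
Qed.

(** The maximum over the class is nonnegative since the class contains the vector
    [0], so Markov's inequality applies to it. *)
Lemma rad_markov n (v : T -> nat -> R) (M : R) : 0 < M -> (forall i, v j0 i = 0) ->
  rsup j0 n (fun i j => v j i) <= M / 2 ->
  rad n (fun s => indic (exists j, M < rsum n s (v j))) <= 1 / 2 :> R.
Proof.
move=> M0 v0 vM; rewrite -(ler_pM2l M0) -radZ.
apply: (@le_trans _ _ (rsup j0 n (fun i j => v j i))); last lra.
apply: le_rad => s _.
have ge j : rsum n s (v j) <= fmax j0 (fun j => rsum n s (v j)).
  exact: (fmax_ge j0 (fun j => rsum n s (v j))).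
have [[j Mj]|h] := pselect (exists j, M < rsum n s (v j)).
  by rewrite indicT ?mulr1; [rewrite (le_trans (ltW Mj))|exists j].
rewrite indicF// mulr0; apply: le_trans (ge j0).
by rewrite /rsum big1// => i _; rewrite v0 mulr0.
Qed.

Definition pos_part (a : R) : R := Num.max a 0.

Lemma pos_part_lipschitz (a b : R) : `|pos_part a - pos_part b| <= `|a - b|.
Proof.
have h1 := ler_norm (a - b); have h2 := ler_norm (b - a); rewrite distrC in h2.
rewrite ler_norml /pos_part.
by case: (leP a 0) => a0; case: (leP b 0) => b0; apply/andP; split; lra.
Qed.

(** If [a] exceeds [b] in absolute value, then [a] and [a - x] lie on the same side
    of the knot. *)
Lemma pos_part_clip (a b x : R) : `|x| <= b ->
  pos_part (a - x) - pos_part a = pos_part (clip b a - x) - pos_part (clip b a).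
Proof.
rewrite ler_norml => /andP[bx xb]; rewrite /clip /pos_part.
case: (leP a b) => ab; case: (leP (- b) _) => h //;
  rewrite /Num.max; repeat case: ifP; lra.
Qed.

End rad_tail_bounds.

(** * Uniform deviations of the normalised hinge increments *)

Lemma sum_CauchySchwarz {R : realType} (I : Type) (r : seq I) (a b : I -> R) :
  (\sum_(i <- r) a i * b i) ^+ 2 <=
  (\sum_(i <- r) a i ^+ 2) * (\sum_(i <- r) b i ^+ 2).
Proof.
elim: r => [|i r IH]; first by rewrite !big_nil expr0n mul0r.
rewrite !big_cons.
set s := \sum_(_ <- _) _ in IH *; set A := \sum_(_ <- _) a _ ^+ 2 in IH *.
set B := \sum_(_ <- _) b _ ^+ 2 in IH *.
have A0 : 0 <= A by apply: sumr_ge0 => k _; exact: sqr_ge0.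
have B0 : 0 <= B by apply: sumr_ge0 => k _; exact: sqr_ge0.
have cross : 2 * (s * (a i * b i)) <= A * b i ^+ 2 + B * a i ^+ 2.
  apply: le_trans (ler_norm _) _.
  have nn := addr_ge0 (mulr_ge0 A0 (sqr_ge0 (b i))) (mulr_ge0 B0 (sqr_ge0 (a i))).
  rewrite -(@ler_pXn2r _ 2)// ?nnegrE//.
  rewrite real_normK ?num_real//.
  have := sqr_ge0 (A * b i ^+ 2 - B * a i ^+ 2).
  have : 0 <= (A * B - s ^+ 2) * (a i * b i) ^+ 2 by rewrite mulr_ge0 ?sqr_ge0// subr_ge0.
  nra.
have -> : (a i * b i + s) ^+ 2 = a i ^+ 2 * b i ^+ 2 + 2 * (s * (a i * b i)) + s ^+ 2 by ring.
have -> : (a i ^+ 2 + A) * (b i ^+ 2 + B) =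
  a i ^+ 2 * b i ^+ 2 + (A * b i ^+ 2 + B * a i ^+ 2) + A * B by ring.
lra.
Qed.

Section deviation_constants.
Context {R : realType}.

(** With high probability the sample sum of the envelope is at most
    [(envelope_constant k1 kv * n) ^ 2], and the sums of the squared kernel parts are
    at most [kernel_constant k1 kv * n / g2]. *)
Definition envelope_constant (k1 kv : R) : R :=
  Num.sqrt (32 * kv + 18 * 66 * k1 ^+ 2).

Definition kernel_constant (k1 kv : R) : R :=
  32 + 18 * 66 * k1 ^+ 2 + 32 * k1 * envelope_constant k1 kv.

Definition deviation_constant (C0 k1 kv : R) : R :=
  6 + 32 * C0 ^+ 2 + 34 * envelope_constant k1 kv ^+ 2 + 20 * C0
  + 32 * Num.sqrt (C0 ^+ 2 + kernel_constant k1 kv) + 3 + 3 * C0.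

End deviation_constants.

Section hinge_class_deviation.
Context {R : realType} {dO dS : measure_display} {Omega : measurableType dO}
  {S : measurableType dS}.
Context (P : probability Omega R) (rho : probability S R) (n : nat)
  (W : 'I_n -> {RV P >-> S}) (iid : is_iid rho W) (n_gt0 : (0 < n)%N).
Context (J : finType) (j0 : J) (m p : nat).
Context (al : J -> 'I_m -> R) (e : 'I_m -> S -> R) (wt : 'I_m -> R)
  (b : J -> 'I_p -> R) (z : 'I_p -> S -> R) (y tau : S -> R) (sc : J -> R).
Context (C0 k1 g2 l kv : R) (kv_gt0 : 0 < kv).
Context (me : forall i, measurable_fun setT (e i))
  (mz : forall i, measurable_fun setT (z i)) (my : measurable_fun setT y)
  (mtau : measurable_fun setT tau).
Context (C0_gt0 : 0 < C0) (k1_gt0 : 0 < k1) (g2_gt0 : 0 < g2) (l_gt1 : 1 <= l)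
  (g2_ge : l <= n%:R * g2) (p_le : p%:R <= expR l) (exp_small : 32 * expR (- (2 * l)) <= 1).
Context (wt_gt0 : forall i, 0 < wt i) (sc_ge0 : forall j, 0 <= sc j)
  (y_le1 : forall x, `|y x| <= 1) (z_le : forall i x, `|z i x| <= C0)
  (b_le : forall j, \sum_i `|b j i| <= Num.sqrt (n%:R / l))
  (al_le : forall j, \sum_i wt i * al j i ^+ 2 <= 2)
  (al0 : forall i, al j0 i = 0) (b0 : forall i, b j0 i = 0).

(** Here [g2] stands for the square of the rate [gamma], [b j] for the coefficients
    of the linear part and [al j] for those of the kernel part in the basis [e];
    both are already multiplied by the scale [sc j].  The index [j0] is the
    target. *)
Definition linear_part j x : R := \sum_i b j i * z i x.
Definition kernel_part j x : R := \sum_i al j i * e i x.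
(** A common bound for the squares of the kernel parts, by Cauchy--Schwarz with the
    weights [wt]. *)
Definition envelope x : R := 2 * \sum_i e i x ^+ 2 / wt i.
Definition hinge_increment j x : R :=
  pos_part (sc j * tau x - y x * (linear_part j x + kernel_part j x))
  - pos_part (sc j * tau x).

Local Notation G := kernel_part.
Local Notation h := hinge_increment.
Local Notation k := envelope.

Context (k_le : forall x, k x <= (k1 / g2) ^+ 2)
  (k_int : \int[rho]_x k x <= kv * n%:R)
  (G_int : forall j, \int[rho]_x (G j x ^+ 2) <= g2^-1).

Let N : R := n%:R.
Let c1 : R := envelope_constant k1 kv.
Let C2 : R := kernel_constant k1 kv.
Let C3 : R := deviation_constant C0 k1 kv.
Let u : R := Num.sqrt (32 * l).
Let L1 : R := (c1 * N) ^+ 2.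
Let L2 : R := C2 * (N / g2).

Let N_gt0 : 0 < N. Proof. by rewrite ltr0n. Qed.
Let l_gt0 : 0 < l. Proof. exact: lt_le_trans ltr01 l_gt1. Qed.
Let c1_gt0 : 0 < c1.
Proof. by rewrite sqrtr_gt0 addr_gt0// ?mulr_gt0// exprn_gt0. Qed.
Let c1E : c1 ^+ 2 = 32 * kv + 18 * 66 * k1 ^+ 2.
Proof. by rewrite sqr_sqrtr// ltW// addr_gt0// ?mulr_gt0// exprn_gt0. Qed.
Let C2_gt0 : 0 < C2.
Proof. by rewrite !addr_gt0// !mulr_gt0// exprn_gt0. Qed.
Let u_ge0 : 0 <= u. Proof. exact: sqrtr_ge0. Qed.
Let uE : u ^+ 2 = 32 * l. Proof. by rewrite sqr_sqrtr// mulr_ge0// ltW. Qed.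
Let u1 : (u + 1) ^+ 2 <= 66 * l.
Proof.
have -> : (u + 1) ^+ 2 = 2 * u ^+ 2 + 2 - (u - 1) ^+ 2 by ring.
by rewrite uE; have := sqr_ge0 (u - 1); have := l_gt1; lra.
Qed.
Let exp_u : 4 * expR (- (u ^+ 2 / 16)) = 4 * expR (- (2 * l)).
Proof. by rewrite uE; congr (_ * expR _); field. Qed.

Let mG j : measurable_fun setT (G j).
Proof. by apply: measurable_sum => i; exact: measurable_funM. Qed.

Let mk : measurable_fun setT k.
Proof.
apply: measurable_funM => //; apply: measurable_sum => i.
by apply: measurable_funM => //; exact: measurable_funX.
Qed.

Let m_pos (f : S -> R) : measurable_fun setT f -> measurable_fun setT (fun x => pos_part (f x)).
Proof. by move=> mf; exact: measurable_maxr. Qed.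

Lemma measurable_hinge_increment j : measurable_fun setT (h j).
Proof.
have mlin : measurable_fun setT (linear_part j).
  by apply: measurable_sum => i; exact: measurable_funM.
apply: measurable_funB; apply: m_pos; last exact: measurable_funM.
apply: measurable_funB; first exact: measurable_funM.
by apply: measurable_funM => //; exact: measurable_funD.
Qed.

Let k_ge0 x : 0 <= k x.
Proof.
by rewrite mulr_ge0// sumr_ge0// => i _; rewrite divr_ge0 ?sqr_ge0// ltW.
Qed.

Let G_le j x : G j x ^+ 2 <= k x.
Proof.
have -> : G j x = \sum_i (Num.sqrt (wt i) * al j i) * (e i x / Num.sqrt (wt i)).
  by apply: eq_bigr => i _; field; rewrite gt_eqF// sqrtr_gt0.
apply: le_trans (sum_CauchySchwarz _ _ _) _.
apply: ler_pM; rewrite ?sumr_ge0//.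
- by move=> i _; exact: sqr_ge0.
- by move=> i _; exact: sqr_ge0.
- apply: le_trans (al_le j); apply: ler_sum => i _.
  by rewrite exprMn sqr_sqrtr// ltW.
- by apply: ler_sum => i _; rewrite exprMn exprVn sqr_sqrtr// ltW.
Qed.

Let k_sqrt x : Num.sqrt (k x) ^+ 2 = k x. Proof. exact: sqr_sqrtr. Qed.

Let G_abs j x : `|G j x| <= Num.sqrt (k x).
Proof.
by rewrite -(@ler_pXn2r _ 2)// ?nnegrE ?sqrtr_ge0// real_normK ?num_real// k_sqrt.
Qed.

Let bnd : R := C0 * Num.sqrt (N / l).

Let bnd_sqr : bnd ^+ 2 = C0 ^+ 2 * (N / l).
Proof. by rewrite exprMn sqr_sqrtr// divr_ge0// ltW. Qed.

Let bnd_gt0 : 0 < bnd.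
Proof. by rewrite mulr_gt0// sqrtr_gt0 divr_gt0. Qed.

Let lin_abs j x : `|linear_part j x| <= bnd.
Proof.
apply: le_trans (ler_norm_sum _ _ _) _.
apply: (@le_trans _ _ (\sum_i `|b j i| * C0)).
  by apply: ler_sum => i _; rewrite normrM ler_wpM2l.
by rewrite -mulr_suml mulrC ler_wpM2l ?(ltW C0_gt0)//; exact: b_le.
Qed.

Let incr_abs j x : `|y x * (linear_part j x + G j x)| <= bnd + Num.sqrt (k x).
Proof.
rewrite normrM -[leRHS]mul1r; apply: ler_pM => //.
by apply: le_trans (ler_normD _ _) _; apply: lerD.
Qed.

Let h_abs j x : `|h j x| <= bnd + Num.sqrt (k x).
Proof.
apply: le_trans (pos_part_lipschitz _ _) _.
by rewrite addrAC subrr add0r normrN.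
Qed.

Let h_sqr j x : h j x ^+ 2 <= 2 * bnd ^+ 2 + 2 * G j x ^+ 2.
Proof.
have hG : `|h j x| <= bnd + `|G j x|.
  apply: le_trans (pos_part_lipschitz _ _) _.
  rewrite addrAC subrr add0r normrN normrM -[leRHS]mul1r; apply: ler_pM => //.
  by apply: le_trans (ler_normD _ _) _; rewrite lerD2r.
have G2 : `|G j x| ^+ 2 = G j x ^+ 2 by rewrite real_normK ?num_real.
have := normr_ge0 (h j x); rewrite -(real_normK (num_real (h j x))) -G2.
have := sqr_ge0 (bnd - `|G j x|); have := normr_ge0 (G j x); nra.
Qed.

Let B1_l : 18 * ((u + 1) ^+ 2 * (k1 / g2) ^+ 2) <= 18 * 66 * k1 ^+ 2 * (l / g2 ^+ 2).
Proof.
have -> : 18 * 66 * k1 ^+ 2 * (l / g2 ^+ 2) = 18 * (66 * l * (k1 / g2) ^+ 2).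
  by rewrite expr_div_n; field; rewrite lt0r_neq0.
by rewrite ler_pM2l// ler_wpM2r ?sqr_ge0.
Qed.

Let g2V : g2^-1 <= N / l.
Proof. by rewrite -[g2^-1]mul1r ler_pdivrMr// mulrAC ler_pdivlMr// mul1r. Qed.

Let Nl_N : N / l <= N.
Proof. by rewrite ler_pdivrMr// ler_peMr// ltW. Qed.

Let lg_N : l / g2 <= N.
Proof. by rewrite ler_pdivrMr. Qed.

(** The mean of the sum of the envelope is at most [kv * n ^ 2], and its terms are at
    most [(k1 / g2) ^ 2], which is at most [k1 ^ 2 * n ^ 2 / l]. *)
Let envelope_tail : pr P [set w | L1 < ssum k (sample W w)] <= 4 * expR (- (2 * l)).
Proof.
rewrite -exp_u.
have H := @nonneg_tail R dO dS Omega S P rho n W iid unit (fun _ : unit => k) setT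
  ((k1 / g2) ^+ 2) (kv * N) (4 * kv * N ^+ 2) L1 0 u.
have E : [set w | exists j : unit, setT (sample W w) /\ L1 < ssum k (sample W w)] =
   [set w | L1 < ssum k (sample W w)].
  by apply/seteqP; split => [w [_ []]//|w wL]; exists tt.
rewrite -E; apply: H => //.
- by move=> _ x; rewrite k_ge0 k_le.
- rewrite (_ : [set w | _] = setT); last by apply/seteqP; split.
  by rewrite (_ : pr P setT = 1) ?/pr ?probability_setT//=; lra.
- by apply: mulr_gt0; [exact: mulr_gt0|exact: exprn_gt0].
- by rewrite -/N expr2; lra.
- by rewrite /L1 exprMn c1E; have := sqr_ge0 N; have := sqr_ge0 k1; nra.
- by rewrite mulr0 sqr_ge0.
- apply: le_trans B1_l _; rewrite /L1 exprMn c1E.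
  apply: (@le_trans _ _ (18 * 66 * k1 ^+ 2 * N ^+ 2)); last first.
    by rewrite ler_wpM2r ?sqr_ge0// lerDr ltW// mulr_gt0.
  apply: ler_wpM2l; first by rewrite mulr_ge0// sqr_ge0.
  have -> : l / g2 ^+ 2 = l / g2 * g2^-1 by field; rewrite lt0r_neq0.
  rewrite expr2; apply: ler_pM => //; first by rewrite divr_ge0// ltW.
    by rewrite invr_ge0 ltW.
  exact: le_trans g2V Nl_N.
- move=> x x' _ _ _; set v := dvec k x x'.
  apply: le_trans (_ : rad n (fun s => indic (2 * norm2 n v < rsum n s v)) <= _).
    by apply: le_rad => s _; apply: le_indic => -[_]; rewrite add0r.
  by apply: le_trans (rad_chebyshev _ _) _; lra.
Qed.

Let c (x : n.-tuple S) := ~ (L1 < ssum k x).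

Let mc : measurable (c : set (n.-tuple S)).
Proof.
by apply: measurableC; apply: measurable_set_ltr => //; exact: measurable_ssum.
Qed.

Let measurable_sample_exists (A : J -> set (n.-tuple S)) : (forall j, measurable (A j)) ->
  measurable [set w | exists j, A j (sample W w)].
Proof.
by move=> mA; apply: (measurable_exists (A := fun j => [set w | A j (sample W w)])) => j;
  exact: measurable_sample_set.
Qed.

Let measurable_kernel_event : measurable [set w | exists j, c (sample W w) /\
  L2 < ssum (fun x => G j x ^+ 2) (sample W w)].
Proof.
apply: measurable_sample_exists (fun j => c `&` [set x | L2 < ssum (fun x => G j x ^+ 2) x]) _ => j.
apply: measurableI => //.
by apply: measurable_set_ltr => //; apply: measurable_ssum; exact: measurable_funX.
Qed.

Let c_pr : 1 - 4 * expR (- (2 * l)) <= pr P [set w | c (sample W w)].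
Proof.
have -> : [set w | c (sample W w)] = ~` [set w | L1 < ssum k (sample W w)] by [].
rewrite pr_setC; first by rewrite lerD2l lerN2.
apply: (@measurable_sample_set _ _ _ _ _ P n W [set x | L1 < ssum k x]).
by apply: measurable_set_ltr => //; exact: measurable_ssum.
Qed.

Let c_sum x x' s : c (swap s x x') -> c (swap s x' x) -> ssum k x + ssum k x' <= 2 * L1.
Proof.
move=> /negP; rewrite -leNgt => h1 /negP; rewrite -leNgt => h2.
by have := ssum_swapD k s x x'; lra.
Qed.

Let at_ (f : S -> R) (x : n.-tuple S) (i : nat) := f (nth point x i).

Let rsup_G (x : n.-tuple S) (t : R) : 0 < t ->
  rsup j0 n (fun i j => at_ (G j) x i) <= t / 2 + ssum k x / (2 * t).
Proof.
move=> t0; apply: le_trans (@rsup_ellipsoid _ _ j0 m n al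
  (fun i q => e q (nth point x i)) wt 2 t wt_gt0 _ t0 al_le) _ => //.
rewrite lerD2l /ssum /envelope -mulr_sumr.
under [X in _ <= 2 * X / _]eq_bigr do under eq_bigr do rewrite (tnth_nth point).
by rewrite mulrAC.
Qed.

(** Squares are contracted to the kernel parts themselves, which are at most
    [k1 / g2], and the envelope bounds the complexity of these. *)
Let kernel_tail : pr P [set w | exists j, c (sample W w) /\
  L2 < ssum (fun x => G j x ^+ 2) (sample W w)] <= 4 * expR (- (2 * l)).
Proof.
rewrite -exp_u.
apply: (nonneg_tail iid (B := (k1 / g2) ^+ 2) (v := g2^-1) (l := 4 * (N / g2))
  (M := 8 * k1 * c1 * (N / g2))) => //.
- by move=> j; exact: measurable_funX.
- by move=> j x; rewrite sqr_ge0 (le_trans (G_le j x)).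
- by apply: (le_trans _ c_pr); have := exp_small; lra.
- by rewrite mulr_gt0// divr_gt0.
- have Ng : 0 < N / g2 by rewrite divr_gt0.
  rewrite mulrA ler_pM2r// /C2 /kernel_constant -/c1; have := mulr_gt0 k1_gt0 c1_gt0; have := sqr_ge0 k1; lra.
- have Ng : 0 < N / g2 by rewrite divr_gt0.
  rewrite mulrA ler_pM2r// /C2 /kernel_constant -/c1; have := mulr_gt0 k1_gt0 c1_gt0; have := sqr_ge0 k1; lra.
- apply: le_trans B1_l _; rewrite /L2.
  have -> : l / g2 ^+ 2 = l / g2 * g2^-1 by field; rewrite lt0r_neq0.
  rewrite mulrA [leRHS]mulrA ler_pM2r ?invr_gt0//.
  apply: ler_pM => //; first by rewrite mulr_ge0// sqr_ge0.
    by rewrite divr_ge0// ltW.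
  by rewrite /C2 /kernel_constant -/c1; have := mulr_gt0 k1_gt0 c1_gt0; lra.
move=> x x' s cs cs'; have kx := c_sum cs cs'.
set M := _ * (N / g2).
have M0 : 0 < M by rewrite /M !mulr_gt0// invr_gt0.
apply: le_trans (_ : rad n (fun s => indic (exists j, M <
    rsum n s (dvec (fun x => G j x ^+ 2) x x'))) <= _).
  apply: le_rad => s' _; apply: le_indic => -[j Mj]; exists j; apply: le_lt_trans Mj.
  by rewrite lerDl mulr_ge0// norm2_ge0.
have q x'' : rsup j0 n (fun i j => at_ (fun x => G j x ^+ 2) x'' i) <=
    2 * (k1 / g2) * (c1 * N / 2 + ssum k x'' / (2 * (c1 * N))).
  have kg0 : 0 <= k1 / g2 by rewrite divr_ge0// ltW.
  have kg2 : 0 <= 2 * (k1 / g2) by rewrite mulr_ge0.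
  apply: (@le_trans _ _ (rsup j0 n (fun i j => 2 * (k1 / g2) * at_ (G j) x'' i))).
    apply: rsup_contraction => i j j' _; rewrite /at_ -mulrBr [in leRHS]normrM.
    set X := nth _ _ _.
    rewrite subr_sqr mulrC normrM (ger0_norm kg2).
    rewrite ler_wpM2r//; apply: le_trans (ler_normD _ _) _.
    have GB jj : `|G jj X| <= k1 / g2.
      apply: le_trans (G_abs jj X) _.
      by rewrite -(@ler_pXn2r _ 2)// ?nnegrE ?sqrtr_ge0// k_sqrt.
    by have := GB j; have := GB j'; lra.
  apply: (le_trans (@rsupZ _ _ j0 n _ (fun i j => at_ (G j) x'' i) kg2)).
  by apply: (ler_wpM2l kg2); apply: rsup_G; rewrite mulr_gt0.
apply: (rad_markov (j0 := j0)) => //.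
  by move=> i; rewrite /dvec /kernel_part !big1 ?subrr// => i0 _; rewrite al0 mul0r.
rewrite /dvec; apply: le_trans (rsupD _ _ _ _) _; rewrite rsupN.
apply: le_trans (lerD (q x) (q x')) _.
rewrite -mulrDr /M; set a := ssum k x in kx *; set a' := ssum k x' in kx *.
have cN : 0 < c1 * N by rewrite mulr_gt0.
have -> : c1 * N / 2 + a / (2 * (c1 * N)) + (c1 * N / 2 + a' / (2 * (c1 * N))) =
    c1 * N + (a + a') / (2 * (c1 * N)).
  by field; rewrite !lt0r_neq0.
have h1 : (a + a') / (2 * (c1 * N)) <= c1 * N.
  rewrite ler_pdivrMr ?mulr_gt0//; apply: le_trans kx _.
  by rewrite /L1 le_eqVlt; apply/orP; left; apply/eqP; ring.
apply: (@le_trans _ _ (2 * (k1 / g2) * (2 * (c1 * N)))).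
  by rewrite ler_wpM2l ?mulr_ge0 ?(ltW k1_gt0) ?invr_ge0 ?(ltW g2_gt0)//; lra.
by rewrite le_eqVlt; apply/orP; left; apply/eqP; field; rewrite lt0r_neq0.
Qed.

(** On such samples the increments [h j] form a vector of norm of order
    [n / sqrt l], so that a deviation of order [n] has probability of order
    [expR (- (2 * l))]. *)
Let typical j (x : n.-tuple S) := c x /\ ~ (L2 < ssum (fun x => G j x ^+ 2) x).

Let mtypical j : measurable (typical j : set (n.-tuple S)).
Proof.
apply: measurableI => //; apply: measurableC.
by apply: measurable_set_ltr => //; apply: measurable_ssum; exact: measurable_funX.
Qed.

(** The parameters [1 / (r * C0)] and [3 * l * C0 * r] make the [p] exponential
    moments sum to at most a constant. *)
Let rsup_linear (x : n.-tuple S) :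
  rsup j0 n (fun i j => at_ (fun x => y x * linear_part j x) x i) <= 5 * C0 * N.
Proof.
set r := Num.sqrt (N / l).
have r0 : 0 < r by rewrite sqrtr_gt0 divr_gt0.
have r2 : r ^+ 2 = N / l by rewrite sqr_sqrtr// divr_ge0// ltW.
pose zz i q := at_ (fun x => y x * z q x) x i.
have -> : (fun i j => at_ (fun x => y x * linear_part j x) x i) =
    (fun i j => \sum_q b j q * zz i q).
  apply/funext => i; apply/funext => j; rewrite /at_ /linear_part mulr_sumr.
  by apply: eq_bigr => q _; rewrite mulrCA.
have zzC i q : `|zz i q| <= C0.
  by rewrite /zz /at_ normrM -[leRHS]mul1r; apply: ler_pM.
have t0 : 0 < (r * C0)^-1 by rewrite invr_gt0 mulr_gt0.
have u0 : 0 <= 3 * l * (C0 * r).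
  by rewrite !mulr_ge0// ltW.
apply: le_trans (rsup_l1_ball j0 n b_le zzC t0 u0) _; rewrite -/N -/r invrK card_ord.
have -> : 2 * ((r * C0)^-1 ^+ 2 * N * C0 ^+ 2) - (r * C0)^-1 * (3 * l * (C0 * r)) = - l.
  rewrite exprVn exprMn r2; field; rewrite !lt0r_neq0//.
have pe : p%:R * expR (- l) <= 1.
  by rewrite expRN -ler_pdivlMr ?invr_gt0 ?expR_gt0// mul1r invrK.
apply: (@le_trans _ _ (r * (3 * l * (C0 * r) + r * C0 * 2))).
  rewrite ler_pM2l// lerD2l ler_pM2l ?mulr_gt0//; lra.
have -> : r * (3 * l * (C0 * r) + r * C0 * 2) = C0 * (3 * l + 2) * r ^+ 2 by ring.
rewrite r2 mulrA ler_pdivrMr// -subr_ge0.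
have -> : 5 * C0 * N * l - C0 * (3 * l + 2) * N = 2 * (C0 * N) * (l - 1) by ring.
apply: mulr_ge0; last by rewrite subr_ge0.
by apply: mulr_ge0 => //; apply: mulr_ge0; exact: ltW.
Qed.

(** The complexity of the increments, split into that of the clipped scales and that
    of the linear and kernel parts. *)
Let rsup_h (x : n.-tuple S) :
  rsup j0 n (fun i j => at_ (h j) x i) <=
  N + 4 / N * (2 * C0 ^+ 2 * N ^+ 2 + 2 * ssum k x) + 5 * C0 * N
    + (N / 2 + ssum k x / (2 * N)).
Proof.
pose bb i := bnd + Num.sqrt (at_ k x i).
have bb0 i : 0 < bb i by rewrite ltr_wpDr// sqrtr_ge0.
pose cl i j := clip (bb i) (sc j * at_ tau x i).
pose Del i j := at_ (fun x => y x * (linear_part j x + G j x)) x i.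
have clip_le : rsup j0 n cl <= N / 2 + 2 / N * (2 * C0 ^+ 2 * N ^+ 2 + 2 * ssum k x).
  apply: le_trans (rsup_clip j0 n (at_ tau x) N_gt0 sc_ge0 bb0) _.
  rewrite lerD2l ler_wpM2l ?divr_ge0 ?(ltW N_gt0)//.
  apply: (@le_trans _ _ (\sum_(i < n) (2 * C0 ^+ 2 * N + 2 * k (tnth x i)))).
    apply: ler_sum => i _; rewrite (tnth_nth point) /bb /at_.
    have sk := k_sqrt (nth point x i); set q := Num.sqrt _ in sk *.
    have bb2 : bnd ^+ 2 <= C0 ^+ 2 * N by rewrite bnd_sqr ler_wpM2l ?sqr_ge0.
    have -> : (bnd + q) ^+ 2 = 2 * bnd ^+ 2 + 2 * q ^+ 2 - (bnd - q) ^+ 2 by ring.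
    move: bb2 sk (sqr_ge0 (bnd - q)); lra.
  rewrite big_split/= sumr_const card_ord -mulr_sumr -/(ssum k x).
  by rewrite -[X in X + _ <= _]mulr_natr -/N expr2 !mulrA.
have Del_le : rsup j0 n Del <= 5 * C0 * N + (N / 2 + ssum k x / (2 * N)).
  have -> : Del = (fun i j => at_ (fun x => y x * linear_part j x) x i +
      at_ (fun x => y x * G j x) x i).
    by apply/funext => i; apply/funext => j; rewrite /Del /at_ mulrDr.
  apply: le_trans (rsupD _ _ _ _) _; apply: lerD; first exact: rsup_linear.
  apply: le_trans (rsup_G x N_gt0); apply: rsup_contraction => i j j' _.
  by rewrite /at_ -mulrBr normrM -[leRHS]mul1r ler_wpM2r.
have -> : (fun i j => at_ (h j) x i) =
    (fun i j => pos_part (cl i j - Del i j) + - pos_part (cl i j)).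
  apply/funext => i; apply/funext => j; rewrite /at_ /hinge_increment.
  by rewrite (pos_part_clip _ (incr_abs j (nth point x i))).
apply: le_trans (rsupD _ _ _ _) _; rewrite rsupN.
have h1 : rsup j0 n (fun i j => pos_part (cl i j - Del i j)) <= rsup j0 n cl + rsup j0 n Del.
  apply: (@le_trans _ _ (rsup j0 n (fun i j => cl i j + - Del i j))).
    by apply: rsup_contraction => i j j' _; exact: pos_part_lipschitz.
  by apply: le_trans (rsupD _ _ _ _) _; rewrite rsupN.
have h2 : rsup j0 n (fun i j => pos_part (cl i j)) <= rsup j0 n cl.
  by apply: rsup_contraction => i j j' _; exact: pos_part_lipschitz.
lra.
Qed.

Let h_bound j x : `|h j x| <= bnd + k1 / g2.
Proof.
apply: le_trans (h_abs j x) _; rewrite lerD2l.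
have kg0 : 0 <= k1 / g2 by rewrite divr_ge0// ltW.
by rewrite -(@ler_pXn2r _ 2)// ?nnegrE ?sqrtr_ge0// k_sqrt.
Qed.

Let h_int j : \int[rho]_x (h j x ^+ 2) <= (2 * C0 ^+ 2 + 2) * N.
Proof.
have Gi : rho.-integrable setT (EFin \o (fun x => G j x ^+ 2)).
  apply: (@bounded_integrable _ _ _ _ _ ((k1 / g2) ^+ 2)); first exact: measurable_funX.
  by move=> x; rewrite ger0_norm ?sqr_ge0// (le_trans (G_le j x)).
have bi : rho.-integrable setT (EFin \o (fun _ : S => 2 * bnd ^+ 2)).
  by apply: (@bounded_integrable _ _ _ _ _ `|2 * bnd ^+ 2|).
have Gi2 : rho.-integrable setT (EFin \o (fun x => 2 * G j x ^+ 2)).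
  by have := integrableZl measurableT 2 Gi; apply: eq_integrable.
apply: (@le_trans _ _ (\int[rho]_x (2 * bnd ^+ 2 + 2 * G j x ^+ 2))).
  apply: le_Rintegral => //.
  - apply: (@bounded_integrable _ _ _ _ _ ((bnd + k1 / g2) ^+ 2)).
      by apply: measurable_funX; exact: measurable_hinge_increment.
    move=> x; rewrite normrX ler_sqr ?nnegrE//.
    by rewrite (le_trans _ (h_bound j x)).
  - by have := integrableD measurableT bi Gi2; apply: eq_integrable.
rewrite RintegralD// (RintegralZl _ measurableT Gi) Rintegral_pr_cst bnd_sqr.
have h1 : C0 ^+ 2 * (N / l) <= C0 ^+ 2 * N by rewrite ler_wpM2l ?sqr_ge0.
have h2 : g2^-1 <= N by exact: le_trans g2V Nl_N.
have h3 := G_int j; lra.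
Qed.

Let rootC : R := Num.sqrt (C0 ^+ 2 + C2).

Let rootC_ge0 : 0 <= rootC. Proof. exact: sqrtr_ge0. Qed.

Let rootC2 : rootC ^+ 2 = C0 ^+ 2 + C2.
Proof. by rewrite sqr_sqrtr// addr_ge0 ?sqr_ge0// ltW. Qed.

Let u_gt0 : 0 < u. Proof. by rewrite sqrtr_gt0 mulr_gt0. Qed.

(** The sign [sg] allows both tails to be treated as upper tails. *)
Let one_sided (sg : R) : `|sg| = 1 ->
  pr P [set w | exists j, typical j (sample W w) /\
    2 * (C3 * N) < sg * (ssum (h j) (sample W w) - N * \int[rho]_x h j x)]
  <= 4 * expR (- (2 * l)).
Proof.
move=> sg1; rewrite -exp_u.
have sg2 : sg ^+ 2 = 1 by rewrite -(real_normK (num_real sg)) sg1 expr1n.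
pose h' j x := sg * h j x.
have mh j : measurable_fun setT (h j) by exact: measurable_hinge_increment.
have hi j : rho.-integrable setT (EFin \o h j).
  exact: (@bounded_integrable _ _ _ _ _ (bnd + k1 / g2)).
have Ej j X : sg * (ssum (h j) X - N * \int[rho]_x h j x) =
    ssum (h' j) X - N * \int[rho]_x h' j x.
  rewrite /h' (RintegralZl _ measurableT (hi j)) /ssum -[in RHS]mulr_sumr mulrBr.
  by congr (_ - _); exact: mulrCA.
have E : [set w | exists j, typical j (sample W w) /\
    2 * (C3 * N) < sg * (ssum (h j) (sample W w) - N * \int[rho]_x h j x)] =
  [set w | exists j, typical j (sample W w) /\
    2 * (C3 * N) < ssum (h' j) (sample W w) - N * \int[rho]_x h' j x].
  by apply/seteqP; split => w [j jP]; exists j; move: jP; rewrite Ej.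
rewrite E.
have C3_ge : 3 + 3 * C0 <= C3.
  have := sqr_ge0 C0; have := sqr_ge0 c1; rewrite /C3 /deviation_constant -/c1 -/C2 -/rootC; have := rootC_ge0.
  have := C0_gt0; lra.
have C30 : 0 < C3 by have := C0_gt0; lra.
apply: (@deviation_tail _ _ _ _ _ P rho n W iid J h' typical (bnd + k1 / g2)
  ((2 * C0 ^+ 2 + 2) * N) (C3 * N)
  ((6 + 32 * C0 ^+ 2 + 34 * c1 ^+ 2 + 20 * C0) * N) (16 * rootC * N / u) u) => //.
- by move=> j; exact: measurable_funM.
- by move=> j x; rewrite normrM sg1 mul1r.
- move=> j; apply: le_trans (h_int j); rewrite le_eqVlt; apply/orP; left; apply/eqP.
  by apply: eq_Rintegral => x _; rewrite /h' exprMn sg2 mul1r.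
- move=> j; have c34 : 3 / 4 <= pr P [set w | c (sample W w)] - 4 * expR (- (2 * l)).
    by have := c_pr; have := exp_small; lra.
  apply: le_trans c34 _; rewrite lerBlDr.
  pose B1 := [set w | typical j (sample W w)].
  pose B2 := [set w | exists j, c (sample W w) /\ L2 < ssum (fun x => G j x ^+ 2) (sample W w)].
  have mB1 : measurable B1 by exact: measurable_sample_set (mtypical j).
  have mB2 : measurable B2 by exact: measurable_kernel_event.
  apply: (@le_trans _ _ (pr P (B1 `|` B2))).
    apply: le_pr; [exact: measurable_sample_set|exact: measurableU|].
    move=> w cw; have [hw|hw] := pselect (L2 < ssum (fun x => G j x ^+ 2) (sample W w)).
      by right; exists j.
    by left; split.
  apply: le_trans (pr_setU P mB1 mB2) _; rewrite lerD2l; exact: kernel_tail.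
- by rewrite mulr_gt0.
- have -> : 4 * (n%:R * ((2 * C0 ^+ 2 + 2) * N)) = (8 * C0 ^+ 2 + 8) * N ^+ 2.
    by rewrite -/N; ring.
  rewrite exprMn ler_wpM2r ?sqr_ge0//.
  apply: (@le_trans _ _ ((3 + 3 * C0) ^+ 2)); first by have := C0_gt0; nra.
  by rewrite ler_sqr ?nnegrE ?(ltW C30)//; have := C0_gt0; lra.
- have -> : 2 * (16 * rootC * N / u * u) = 32 * rootC * N.
    by field; rewrite lt0r_neq0.
  rewrite -mulrDl ler_wpM2r ?(ltW N_gt0)// /C3 /deviation_constant -/c1 -/C2 -/rootC; have := C0_gt0; lra.
move=> x x' s j [cx Gx] [cx' Gx']; have kx := c_sum cx cx'.
have Gs := ssum_swapD (fun x => G j x ^+ 2) s x x'.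
move: Gx Gx' => /negP; rewrite -leNgt => Gx /negP; rewrite -leNgt => Gx'.
split.
  rewrite -(@ler_pXn2r _ 2)// ?nnegrE ?norm2_ge0//; last first.
    by rewrite divr_ge0// !mulr_ge0// ltW.
  have -> : (16 * rootC * N / u) ^+ 2 = 8 * (C0 ^+ 2 + C2) * (N * (N / l)).
    rewrite expr_div_n uE !exprMn rootC2; field; exact: lt0r_neq0.
  rewrite norm2_sqr.
  apply: (@le_trans _ _ (\sum_(i < n) (8 * bnd ^+ 2 +
      (4 * G j (tnth x i) ^+ 2 + 4 * G j (tnth x' i) ^+ 2)))).
    apply: ler_sum => i _; rewrite /dvec !(tnth_nth point) /h'.
    set a := nth _ x i; set a' := nth _ x' i.
    have -> : (sg * h j a - sg * h j a') ^+ 2 = sg ^+ 2 * (h j a - h j a') ^+ 2 by ring.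
    rewrite sg2 mul1r; have := h_sqr j a; have := h_sqr j a'.
    have := sqr_ge0 (h j a + h j a').
    have -> : (h j a - h j a') ^+ 2 = 2 * h j a ^+ 2 + 2 * h j a' ^+ 2 - (h j a + h j a') ^+ 2 by ring.
    lra.
  rewrite big_split/= sumr_const card_ord -[(8 * bnd ^+ 2) *+ n]mulr_natr -/N big_split/= -!mulr_sumr.
  rewrite bnd_sqr.
  have L2N : L2 <= C2 * (N * (N / l)).
    by rewrite /L2 ler_wpM2l ?(ltW C2_gt0)// ler_wpM2l ?(ltW N_gt0).
  set g := \sum_(i < n) G j (tnth x i) ^+ 2.
  set g' := \sum_(i < n) G j (tnth x' i) ^+ 2.
  have gE : g = ssum (fun x => G j x ^+ 2) x by [].
  have gE' : g' = ssum (fun x => G j x ^+ 2) x' by [].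
  have gg : g + g' <= 2 * L2 by rewrite gE gE' -Gs; lra.
  have -> : 8 * (C0 ^+ 2 * (N / l)) * N = 8 * C0 ^+ 2 * (N * (N / l)) by ring.
  lra.
have C0N : 0 <= C0 ^+ 2 by exact: sqr_ge0.
apply: (rad_markov (j0 := j0)) => //.
- rewrite mulr_gt0//; have := sqr_ge0 c1; have := C0_gt0; lra.
- move=> i; rewrite /dvec /h'.
  have h0 X : h j0 X = 0.
    rewrite /hinge_increment /linear_part /kernel_part.
    rewrite big1; last by move=> q _; rewrite b0 mul0r.
    rewrite big1; last by move=> q _; rewrite al0 mul0r.
    by rewrite addr0 mulr0 subr0 subrr.
  by rewrite !h0 subrr.
have one X : rsup j0 n (fun i j => at_ (h' j) X i) <= rsup j0 n (fun i j => at_ (h j) X i).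
  by apply: rsup_contraction => i jj j' _; rewrite /at_ /h' -mulrBr normrM sg1 mul1r.
rewrite /dvec; apply: le_trans (rsupD _ _ _ _) _; rewrite rsupN.
apply: le_trans (lerD (le_trans (one x) (rsup_h x)) (le_trans (one x') (rsup_h x'))) _.
set a := ssum k x in kx *; set a' := ssum k x' in kx *.
have -> : N + 4 / N * (2 * C0 ^+ 2 * N ^+ 2 + 2 * a) + 5 * C0 * N + (N / 2 + a / (2 * N)) +
   (N + 4 / N * (2 * C0 ^+ 2 * N ^+ 2 + 2 * a') + 5 * C0 * N + (N / 2 + a' / (2 * N))) =
   (3 + 16 * C0 ^+ 2 + 10 * C0) * N + 17 / 2 * ((a + a') / N).
  by field; rewrite lt0r_neq0.
have aN : (a + a') / N <= 2 * c1 ^+ 2 * N.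
  rewrite ler_pdivrMr//; apply: le_trans kx _; rewrite /L1.
  by rewrite le_eqVlt; apply/orP; left; apply/eqP; ring.
lra.
Qed.

(** Two tails of the process, and the exceptional events for the envelope and for
    the kernel parts, of probability [4 * expR (- (2 * l))] each. *)
Lemma hinge_class_deviation :
  pr P [set w | exists j, 2 * (deviation_constant C0 k1 kv * N) <
    `|ssum (h j) (sample W w) - N * \int[rho]_x h j x| ] <= 16 * expR (- (2 * l)).
Proof.
rewrite -[deviation_constant _ _ _]/C3.
pose B1 := [set w | L1 < ssum k (sample W w)].
pose B2 := [set w | exists j, c (sample W w) /\ L2 < ssum (fun x => G j x ^+ 2) (sample W w)].
pose B3 (sg : R) := [set w | exists j, typical j (sample W w) /\
    2 * (C3 * N) < sg * (ssum (h j) (sample W w) - N * \int[rho]_x h j x)].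
have mD (sg : R) j : measurable_fun setT (fun x : n.-tuple S => sg * (ssum (h j) x - N * \int[rho]_x h j x)).
  apply: measurable_funM => //; apply: measurable_funB => //.
  by apply: measurable_ssum; exact: measurable_hinge_increment.
have mB1 : measurable B1.
  apply: (@measurable_sample_set _ _ _ _ _ P n W [set x | L1 < ssum k x]).
  by apply: measurable_set_ltr => //; exact: measurable_ssum.
have mB2 : measurable B2 by exact: measurable_kernel_event.
have mB3 sg : measurable (B3 sg).
  apply: measurable_sample_exists (fun j => typical j `&` [set x | 2 * (C3 * N) <
    sg * (ssum (h j) x - N * \int[rho]_x h j x)]) _ => j.
  apply: measurableI; first exact: mtypical.
  by apply: measurable_set_ltr => //; exact: mD.
have mA : measurable [set w | exists j, 2 * (C3 * N) <
    `|ssum (h j) (sample W w) - N * \int[rho]_x h j x| ].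
  apply: measurable_sample_exists
    (fun j => [set x | 2 * (C3 * N) < `|ssum (h j) x - N * \int[rho]_x h j x| ]) _ => j.
  apply: measurable_set_ltr => //; apply: measurableT_comp => //.
  by have := mD 1 j; congr measurable_fun; apply/funext => x; rewrite mul1r.
have mU3 := measurableU _ _ (mB3 1) (mB3 (-1)).
have mU2 := measurableU _ _ mB2 mU3.
apply: (@le_trans _ _ (pr P (B1 `|` (B2 `|` (B3 1 `|` B3 (-1)))))).
  apply: le_pr => //; first exact: measurableU.
  move=> w [j jP]; have [|nB1] := pselect (B1 w); [by left|right].
  have [|nB2] := pselect (B2 w); [by left|right].
  have tw : typical j (sample W w) by split => // L2w; apply: nB2; exists j; split.
  move: jP; case: (ger0P (_ - _)) => _ jP; [left|right]; exists j; split => //.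
    by rewrite mul1r.
  by rewrite mulN1r.
have := pr_setU P mB1 mU2; have := pr_setU P mB2 mU3; have := pr_setU P (mB3 1) (mB3 (-1)).
have := envelope_tail; have := kernel_tail.
have := one_sided (normr1 R); have := @one_sided (-1); rewrite normrN1 => /(_ erefl).
rewrite -/B1 -/B2 -/(B3 1) -/(B3 (-1)); lra.
Qed.

End hinge_class_deviation.

(** * Reproducing kernel Hilbert spaces *)

Section rkhs_theory.
Context {R : realType} {X : Type} (D : set X) (K : X -> X -> R) (H : set (X -> R))
  (ip : (X -> R) -> (X -> R) -> R) (rk : is_rkhs D K H ip).
Implicit Types (g h f : X -> R) (t : X).

Local Notation Ks := (ksection D K).
Local Notation nrm := (ip_norm ip).

Lemma rkhsD g h : H g -> H h -> H (g \+ h).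
Proof.
move=> Hg Hh; have := rkhs_comb rk 1 Hg Hh.
by congr H; apply/funext => x /=; rewrite mul1r.
Qed.

Lemma rkhsZ (a : R) g : H g -> H (a \*o g).
Proof.
move=> Hg; have := rkhs_comb rk a Hg (rkhs_zero rk).
by congr H; apply/funext => x /=; rewrite addr0.
Qed.

Lemma rkhsB g h : H g -> H h -> H (g \- h).
Proof.
move=> Hg Hh; have := rkhs_comb rk (-1) Hh Hg.
by congr H; apply/funext => x /=; rewrite mulN1r addrC.
Qed.

Lemma ipDl g h f : H g -> H h -> H f -> ip (g \+ h) f = ip g f + ip h f.
Proof.
move=> Hg Hh Hf; have := rkhs_lin rk 1 Hg Hh Hf; rewrite mul1r => <-.
by congr ip; apply/funext => x /=; rewrite mul1r.
Qed.

Lemma ip0l f : H f -> ip (cst 0) f = 0.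
Proof.
move=> Hf; have := ipDl (rkhs_zero rk) (rkhs_zero rk) Hf.
have -> : (cst 0 : X -> R) \+ cst 0 = cst 0 by apply/funext => x /=; rewrite addr0.
by move=> /eqP; rewrite -subr_eq subrr eq_sym => /eqP.
Qed.

Lemma ipZl (a : R) g f : H g -> H f -> ip (a \*o g) f = a * ip g f.
Proof.
move=> Hg Hf; have := rkhs_lin rk a Hg (rkhs_zero rk) Hf; rewrite ip0l// addr0 => <-.
by congr ip; apply/funext => x /=; rewrite addr0.
Qed.

Lemma ipBl g h f : H g -> H h -> H f -> ip (g \- h) f = ip g f - ip h f.
Proof.
move=> Hg Hh Hf.
have -> : g \- h = (-1) \*o h \+ g by apply/funext => x /=; rewrite mulN1r addrC.
by rewrite (rkhs_lin rk)// mulN1r addrC.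
Qed.

Lemma ipDr g h f : H g -> H h -> H f -> ip f (g \+ h) = ip f g + ip f h.
Proof.
by move=> Hg Hh Hf; rewrite !(rkhs_sym rk Hf)//; [exact: ipDl|exact: rkhsD].
Qed.

Lemma ipZr (a : R) g f : H g -> H f -> ip f (a \*o g) = a * ip f g.
Proof.
by move=> Hg Hf; rewrite !(rkhs_sym rk Hf)//; [exact: ipZl|exact: rkhsZ].
Qed.

Lemma ipBr g h f : H g -> H h -> H f -> ip f (g \- h) = ip f g - ip f h.
Proof.
by move=> Hg Hh Hf; rewrite !(rkhs_sym rk Hf)//; [exact: ipBl|exact: rkhsB].
Qed.

Lemma ip_sqrB g h : H g -> H h ->
  ip (g \- h) (g \- h) = ip g g - 2 * ip g h + ip h h.
Proof.
move=> Hg Hh; rewrite ipBl ?ipBr//; last exact: rkhsB.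
by rewrite (rkhs_sym rk Hh Hg); ring.
Qed.

Lemma ip_sqrD g h : H g -> H h ->
  ip (g \+ h) (g \+ h) = ip g g + 2 * ip g h + ip h h.
Proof.
move=> Hg Hh; rewrite ipDl ?ipDr//; last exact: rkhsD.
by rewrite (rkhs_sym rk Hh Hg); ring.
Qed.

Lemma ip_CauchySchwarz g h : H g -> H h -> ip g h ^+ 2 <= ip g g * ip h h.
Proof.
move=> Hg Hh; have g0 := rkhs_ge0 rk Hg; have h0 := rkhs_ge0 rk Hh.
have q (a : R) : 0 <= a ^+ 2 * ip g g - 2 * a * ip g h + ip h h.
  have Hag := rkhsZ a Hg.
  have := rkhs_ge0 rk (rkhsB Hag Hh).
  by rewrite ip_sqrB// ipZl// ipZr// ipZl//; congr (0 <= _); ring.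
have [gg0|gg0] := eqVneq (ip g g) 0.
  by have -> := rkhs_def rk Hg gg0; rewrite (ip0l Hh) (ip0l (rkhs_zero rk)) expr0n mul0r.
have g_gt0 : 0 < ip g g by rewrite lt_neqAle eq_sym gg0.
have := q (ip g h / ip g g).
have -> : (ip g h / ip g g) ^+ 2 * ip g g - 2 * (ip g h / ip g g) * ip g h + ip h h =
    (ip g g * ip h h - ip g h ^+ 2) / ip g g by field.
by rewrite pmulr_lge0 ?invr_gt0// subr_ge0.
Qed.

Lemma ip_norm_ge0 g : 0 <= nrm g.
Proof. exact: sqrtr_ge0. Qed.

Lemma ip_norm_sqr g : H g -> nrm g ^+ 2 = ip g g.
Proof. by move=> Hg; rewrite sqr_sqrtr// (rkhs_ge0 rk). Qed.

Lemma ip_norm_le g h : H g -> H h -> `|ip g h| <= nrm g * nrm h.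
Proof.
move=> Hg Hh; rewrite -(@ler_pXn2r _ 2)// ?nnegrE ?mulr_ge0 ?ip_norm_ge0//.
by rewrite real_normK ?num_real// exprMn !ip_norm_sqr//; exact: ip_CauchySchwarz.
Qed.

Lemma ip_normD g h : H g -> H h -> nrm (g \+ h) <= nrm g + nrm h.
Proof.
move=> Hg Hh; rewrite -(@ler_pXn2r _ 2)// ?nnegrE ?addr_ge0 ?ip_norm_ge0//.
rewrite ip_norm_sqr; last exact: rkhsD.
rewrite ip_sqrD// sqrrD !ip_norm_sqr//.
have := le_trans (ler_norm _) (ip_norm_le Hg Hh); lra.
Qed.

Lemma ip_normN g h : H g -> H h -> nrm (g \- h) = nrm (h \- g).
Proof.
by move=> Hg Hh; rewrite /ip_norm; congr Num.sqrt; rewrite !ip_sqrB// (rkhs_sym rk Hh Hg); ring.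
Qed.

Lemma ksectionE s t : D s -> Ks t s = K s t.
Proof. by move=> Ds; rewrite /ksection mem_set. Qed.

Lemma rkhs_eval_le g t : H g -> D t -> `|g t| <= nrm g * Num.sqrt (K t t).
Proof.
move=> Hg Dt; rewrite -(rkhs_reproducing rk Hg Dt).
apply: le_trans (ip_norm_le Hg (rkhs_section rk Dt)) _.
by rewrite {2}/ip_norm (rkhs_reproducing rk (rkhs_section rk Dt) Dt) ksectionE.
Qed.

(** A finite combination of kernel sections is given by a list of weighted points,
    so that sums of combinations are concatenations. *)
Definition kcomb (s : seq (R * X)) : X -> R := fun x => \sum_(p <- s) p.1 * Ks p.2 x.

Definition kapply f (s : seq (R * X)) : R := \sum_(p <- s) p.1 * f p.2.

Definition on_D (s : seq (R * X)) : Prop := List.Forall (fun p => D p.2) s.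

Lemma kcomb_cons p s : kcomb (p :: s) = p.1 \*o Ks p.2 \+ kcomb s.
Proof. by apply/funext => x; rewrite /kcomb big_cons. Qed.

Lemma kcomb_rkhs s : on_D s -> H (kcomb s).
Proof.
elim: s => [|p s IH] Ds.
  by have := rkhs_zero rk; congr H; apply/funext => x; rewrite /kcomb big_nil.
rewrite kcomb_cons; inversion Ds; subst.
by apply: (rkhs_comb rk); [exact: (rkhs_section rk)|exact: IH].
Qed.

Lemma ip_kcomb f s : H f -> on_D s -> ip f (kcomb s) = kapply f s.
Proof.
move=> Hf; elim: s => [|p s IH] Ds.
  rewrite /kapply big_nil (rkhs_sym rk Hf); last exact: kcomb_rkhs.
  rewrite -[RHS](ip0l Hf); congr ip; apply/funext => x; by rewrite /kcomb big_nil.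
inversion Ds; subst; rewrite kcomb_cons /kapply big_cons.
have Hp := rkhs_section rk H2; have Hs := kcomb_rkhs H3.
rewrite ipDr//; last exact: rkhsZ.
by rewrite ipZr// (rkhs_reproducing rk)// IH.
Qed.

Lemma on_D_cat s1 s2 : on_D s1 -> on_D s2 -> on_D (s1 ++ s2).
Proof. by move=> h1 h2; apply/List.Forall_app. Qed.

Lemma kcomb_cat s1 s2 : kcomb (s1 ++ s2) = kcomb s1 \+ kcomb s2.
Proof. by apply/funext => x; rewrite /kcomb big_cat. Qed.

Lemma kapply_cat f s1 s2 : kapply f (s1 ++ s2) = kapply f s1 + kapply f s2.
Proof. by rewrite /kapply big_cat. Qed.

Definition kscale (a : R) (s : seq (R * X)) := [seq (a * p.1, p.2) | p <- s].

Lemma on_D_scale a s : on_D s -> on_D (kscale a s).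
Proof. by elim: s => [|p s IH] Ds //=; inversion Ds; subst; constructor => //; exact: IH. Qed.

Lemma kcomb_scale a s : kcomb (kscale a s) = a \*o kcomb s.
Proof.
apply/funext => x; rewrite /kcomb /kscale big_map /= mulr_sumr.
by apply: eq_bigr => p _; rewrite mulrA.
Qed.

Lemma kapply_scale f a s : kapply f (kscale a s) = a * kapply f s.
Proof.
rewrite /kapply /kscale big_map mulr_sumr.
by apply: eq_bigr => p _; rewrite mulrA.
Qed.

(** A function bounded as a linear functional on the kernel sections belongs to
    the space: it is the limit of a minimising sequence for the quadratic
    functional [ip h h - 2 f h], which is Cauchy by the parallelogram identity;
    minimality in the direction of a kernel section identifies its values. *)
Lemma rkhs_of_bounded f (C : R) : 0 <= C -> (forall t, ~ D t -> f t = 0) ->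
  (forall s, on_D s -> kapply f s ^+ 2 <= C ^+ 2 * ip (kcomb s) (kcomb s)) ->
  H f /\ ip f f <= C ^+ 2.
Proof.
move=> C0 f0 fC.
pose Q s := ip (kcomb s) (kcomb s) - 2 * kapply f s.
pose A := [set Q s | s in on_D].
have Qlb s : on_D s -> - C ^+ 2 <= Q s.
  move=> Ds; have := fC s Ds; rewrite /Q; have := rkhs_ge0 rk (kcomb_rkhs Ds).
  set q := ip _ _; set L := kapply f s => q0 LC.
  have := sqr_ge0 (C ^+ 2 - q).
  have h : `|L| ^+ 2 <= ((C ^+ 2 + q) / 2) ^+ 2.
    rewrite real_normK ?num_real//; apply: le_trans LC _.
    have := sqr_ge0 (C ^+ 2 - q); nra.
  have : `|L| <= (C ^+ 2 + q) / 2.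
    rewrite -(@ler_pXn2r _ 2)// ?nnegrE//.
    by apply: divr_ge0 => //; apply: addr_ge0 => //; exact: sqr_ge0.
  have := ler_norm L; lra.
have iA : has_inf A.
  split; first by exists (Q [::]), [::] => //; constructor.
  by exists (- C ^+ 2) => _ [s Ds <-]; exact: Qlb.
have infQ s : on_D s -> inf A <= Q s.
  by move=> Ds; apply: ge_inf; [case: iA|exists s].
pose eps (k : nat) : R := k.+1%:R^-1.
have eps0 k : 0 < eps k by rewrite invr_gt0.
have /choice[sq sqP] : forall k, exists s, on_D s /\ Q s < inf A + eps k.
  move=> k; have [_ [s Ds <-] h] := inf_adherent (eps0 k) iA.
  by exists s.
pose v k := kcomb (sq k).
have Hv k : H (v k) by apply: kcomb_rkhs; case: (sqP k).
have vB k l : ip (v k \- v l) (v k \- v l) <= 2 * eps k + 2 * eps l.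
  have [Dk Qk] := sqP k; have [Dl Ql] := sqP l.
  have := infQ _ (on_D_scale (1 / 2) (on_D_cat Dk Dl)).
  rewrite /Q kcomb_scale kcomb_cat kapply_scale kapply_cat -/(v k) -/(v l).
  have Hkl := rkhsD (Hv k) (Hv l).
  rewrite ipZl// ?ipZr//; last exact: rkhsZ.
  rewrite ip_sqrD// ip_sqrB//.
  move: Qk Ql; rewrite /Q -/(v k) -/(v l); lra.
have [g Hg gv] : exists2 g, H g & ip_norm ip (v k \- g) @[k --> \oo] --> (0 : R).
  apply: (rkhs_complete rk Hv) => e e0.
  have e2 : 0 < e ^+ 2 / 4 by rewrite divr_gt0// exprn_gt0.
  have [N _ NP] := near_infty_natSinv_lt (PosNum e2).
  exists N => k l Nk Nl.
  rewrite -(@ltr_pXn2r _ 2)// ?nnegrE ?ip_norm_ge0 ?(ltW e0)// ip_norm_sqr; last exact: rkhsB.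
  apply: le_lt_trans (vB k l) _.
  have hk : eps k < e ^+ 2 / 4 := NP k Nk; have hl : eps l < e ^+ 2 / 4 := NP l Nl; lra.
have gvP (e : R) : 0 < e -> exists k, ip_norm ip (v k \- g) < e /\ eps k < e.
  move=> e0; have /cvgrPdist_lt/(_ _ e0)[N1 _ h1] := gv.
  have [N2 _ h2] := near_infty_natSinv_lt (PosNum e0).
  exists (maxn N1 N2); split; last by have := h2 (maxn N1 N2) (leq_maxr _ _).
  by have := h1 (maxn N1 N2) (leq_maxl _ _); rewrite /= sub0r normrN ger0_norm// ip_norm_ge0.
have vt k t : D t -> (v k t - f t) ^+ 2 <= (K t t + 1) * eps k.
  move=> Dt; have [Dk Qk] := sqP k.
  set del := v k t - f t.
  have Kt : 0 <= K t t.
    have := rkhs_ge0 rk (rkhs_section rk Dt).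
    by rewrite (rkhs_reproducing rk (rkhs_section rk Dt) Dt) ksectionE.
  set a := - del / (K t t + 1).
  have Ds : on_D ((a, t) :: sq k) by constructor.
  have := infQ _ Ds; rewrite /Q kcomb_cons /kapply big_cons -/(kapply f (sq k)) -/(v k) /=.
  have Ht := rkhs_section rk Dt; have Hat := rkhsZ a Ht.
  rewrite ip_sqrD// ipZl// ?ipZr// ipZl//.
  rewrite (rkhs_reproducing rk Ht Dt) ksectionE//.
  rewrite (rkhs_sym rk Ht (Hv k)) (rkhs_reproducing rk (Hv k) Dt).
  move: Qk; rewrite /Q -/(v k) => Qk h.
  have K1 : 0 < K t t + 1 by rewrite ltr_wpDl.
  have h2 : - eps k <= a * (a * K t t) + 2 * (a * del) by rewrite /del; lra.
  have E : a * (a * K t t) + 2 * (a * del) = - (del ^+ 2 / (K t t + 1)) - a ^+ 2.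
    by rewrite /a; field; rewrite lt0r_neq0.
  have : del ^+ 2 / (K t t + 1) <= eps k by have := sqr_ge0 a; lra.
  by rewrite ler_pdivrMr// mulrC.
have gf : g = f.
  apply/funext => t; have [Dt|nDt] := pselect (D t); last first.
    by rewrite f0// (rkhs_supp rk Hg).
  apply/eqP; rewrite -subr_eq0 -normr_le0; apply/ler_addgt0Pr => e e0; rewrite add0r.
  have Kt : 0 <= K t t.
    have := rkhs_ge0 rk (rkhs_section rk Dt).
    by rewrite (rkhs_reproducing rk (rkhs_section rk Dt) Dt) ksectionE.
  have rt0 := sqrtr_ge0 (K t t).
  pose d1 := e / (2 * (Num.sqrt (K t t) + 1)).
  have d10 : 0 < d1 by rewrite divr_gt0// mulr_gt0// ltr_wpDl.
  pose d2 := (e / 2) ^+ 2 / (K t t + 1).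
  have d20 : 0 < d2 by rewrite divr_gt0 ?ltr_wpDl// exprn_gt0// divr_gt0.
  have dm : 0 < Num.min d1 d2 by rewrite lt_min d10.
  have [k []] := gvP _ dm; rewrite !lt_min => /andP[k1 _] /andP[_ k2].
  have h1 : `|v k t - g t| <= e / 2.
    have := rkhs_eval_le (rkhsB (Hv k) Hg) Dt => /= /le_trans; apply.
    apply: (@le_trans _ _ (d1 * (Num.sqrt (K t t) + 1))).
      by apply: ler_pM; rewrite ?ip_norm_ge0 ?(ltW k1)// lerDl.
    by rewrite /d1 le_eqVlt; apply/orP; left; apply/eqP; field; rewrite lt0r_neq0// ltr_wpDl.
  have h2 : `|v k t - f t| <= e / 2.
    rewrite -(@ler_pXn2r _ 2)// ?nnegrE ?divr_ge0 ?(ltW e0)// real_normK ?num_real//.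
    apply: le_trans (vt k t Dt) _.
    have : (K t t + 1) * eps k <= (K t t + 1) * d2.
      by rewrite ler_wpM2l ?(ltW k2)// addr_ge0.
    move=> /le_trans; apply; rewrite /d2 mulrC divfK//.
    by rewrite lt0r_neq0// ltr_wpDl.
  have -> : g t - f t = (v k t - f t) - (v k t - g t) by ring.
  by apply: le_trans (ler_normB _ _) _; lra.
split; first by rewrite -gf.
have Hf : H f by rewrite -gf.
rewrite -(ip_norm_sqr Hf) ler_sqr ?nnegrE ?ip_norm_ge0//.
have [fn0|fn0] := leP (ip_norm ip f) 0; first exact: le_trans C0.
rewrite -(ler_pM2l fn0) -expr2 ip_norm_sqr//.
apply/ler_addgt0Pr => e e0.
set F := ip_norm ip f in fn0 *.
have de0 : 0 < e / (C + F + 1) by rewrite divr_gt0// ltr_wpDl// addr_ge0// ltW.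
have [k [kd _]] := gvP _ de0; rewrite gf in kd.
set dk := ip_norm ip (v k \- f) in kd.
have vf : ip f f = ip f (v k) - ip f (v k \- f) by rewrite ipBr//; ring.
have h1 : ip f (v k) <= C * ip_norm ip (v k).
  have Dk := (sqP k).1; apply: le_trans (ler_norm _) _.
  rewrite -(@ler_pXn2r _ 2)// ?nnegrE ?mulr_ge0 ?ip_norm_ge0// real_normK ?num_real//.
  by rewrite exprMn ip_norm_sqr// ip_kcomb//; exact: fC.
have h2 : ip_norm ip (v k) <= F + dk.
  have := ip_normD Hf (rkhsB (Hv k) Hf).
  by congr (ip_norm ip _ <= _); apply/funext => x /=; ring.
have h3 : - ip f (v k \- f) <= F * dk.
  by have := ip_norm_le Hf (rkhsB (Hv k) Hf); rewrite ler_norml => /andP[]; rewrite lerNl.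
have h4 : (C + F) * dk <= e.
  have dk0 : 0 <= dk by exact: ip_norm_ge0.
  have CF : 0 <= C + F by rewrite addr_ge0// ltW.
  move: kd; rewrite ltr_pdivlMr; last by rewrite ltr_wpDl.
  move=> kd; nra.
have h5 : C * ip_norm ip (v k) <= C * (F + dk) by exact: ler_wpM2l.
rewrite vf; lra.
Qed.

End rkhs_theory.

(** * The Mercer expansion in the kernel space *)

Lemma eq_cvgn {R : realType} (u v : nat -> R) (a : R) : u =1 v ->
  u @ \oo --> a -> v @ \oo --> a.
Proof. by move=> /funext ->. Qed.

Lemma sum_range {R : zmodType} (F : nat -> R) i j : (i <= j)%N ->
  \sum_(l < j) F l - \sum_(l < i) F l = \sum_(l < j) (if (i <= l)%N then F l else 0).
Proof.
move=> ij; rewrite (big_ord_widen j F ij) [X in _ - X]big_mkcond -sumrB.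
by apply: eq_bigr => l _; case: ltnP => _; rewrite ?subrr ?subr0.
Qed.

Section mercer_theory.
Context {R : realType} {dX : measure_display} {X : measurableType dX} (D : set X)
  (K : X -> X -> R) (H : set (X -> R)) (ip : (X -> R) -> (X -> R) -> R)
  (rhoX : probability X R) (mu : nat -> R) (phi : nat -> X -> R).
Context (mD : measurable D) (rk : is_rkhs D K H ip) (mer : is_mercer D K rhoX mu phi)
  (Kb : R) (K_le : forall t, D t -> K t t <= Kb).
Implicit Types (g h : X -> R) (t : X) (c : nat -> R).

(** The factor [sqrt (mu l)] makes these orthonormal in the kernel space. *)
Definition eigen (l : nat) : X -> R :=
  fun t => if t \in D then Num.sqrt (mu l) * phi l t else 0.

Definition comb m c : X -> R := fun t => \sum_(l < m) c l * eigen l t.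

Definition coef g (l : nat) : R := ip g (eigen l).

Let mu_gt0 l : 0 < mu l. Proof. exact: mercer_gt0 mer l. Qed.

Lemma eigenE l t : D t -> eigen l t = Num.sqrt (mu l) * phi l t.
Proof. by move=> Dt; rewrite /eigen mem_set. Qed.

Lemma eigen0 l t : ~ D t -> eigen l t = 0.
Proof. by move=> Dt; rewrite /eigen memNset. Qed.

Lemma comb0 m c t : ~ D t -> comb m c t = 0.
Proof. by move=> Dt; rewrite /comb big1// => l _; rewrite eigen0// mulr0. Qed.

Lemma combS m c : comb m.+1 c = comb m c \+ c m \*o eigen m.
Proof. by apply/funext => t; rewrite /comb big_ord_recr. Qed.

Lemma eigen_cvg s t : D s -> D t ->
  (fun n => \sum_(l < n) eigen l s * eigen l t) @ \oo --> K s t.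
Proof.
move=> Ds Dt; apply: (eq_cvgn _ (mercer_expansion mer Ds Dt)) => n; rewrite seriesEnat/= big_mkord.
apply: eq_bigr => l _; rewrite !eigenE// -{1}(@sqr_sqrtr _ (mu l)) ?ltW//; ring.
Qed.

Lemma kcomb_cvg s1 s2 : on_D D s1 -> on_D D s2 ->
  (fun n => \sum_(l < n) kapply (eigen l) s1 * kapply (eigen l) s2) @ \oo -->
  kapply (kcomb D K s2) s1.
Proof.
move=> + D2; elim: s1 => [|p s1 IH] D1.
  rewrite /kapply big_nil.
  rewrite (_ : (fun n => _) = fun=> 0); first exact: cvg_cst.
  by apply/funext => n; rewrite big1// => l _; rewrite big_nil mul0r.
inversion D1; subst; rewrite /kapply big_cons -/(kapply _ s1).
rewrite (_ : (fun n => _) = (fun n => p.1 * (\sum_(l < n) eigen l p.2 * kapply (eigen l) s2)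
    + \sum_(l < n) kapply (eigen l) s1 * kapply (eigen l) s2)); last first.
  apply/funext => n; rewrite mulr_sumr -big_split/=; apply: eq_bigr => l _.
  by rewrite big_cons mulrDl mulrA.
apply: cvgD; last exact: IH.
apply: cvgMr; rewrite /kcomb.
elim: s2 D2 {IH} => [|q s2 IH2] D2.
  rewrite big_nil (_ : (fun n => _) = fun=> 0); first exact: cvg_cst.
  by apply/funext => n; rewrite big1// => l _; rewrite /kapply big_nil mulr0.
inversion D2; subst; rewrite big_cons.
rewrite (_ : (fun n => _) = (fun n => q.1 * (\sum_(l < n) eigen l p.2 * eigen l q.2)
    + \sum_(l < n) eigen l p.2 * kapply (eigen l) s2)); last first.
  apply/funext => n; rewrite mulr_sumr -big_split/=; apply: eq_bigr => l _.
  by rewrite /kapply big_cons; ring.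
apply: cvgD; last exact: IH2.
by apply: cvgMr; rewrite ksectionE//; exact: eigen_cvg.
Qed.

Lemma sum_le_lim (u : nat -> R) (a : R) n : (forall l, 0 <= u l) ->
  (fun n => \sum_(l < n) u l) @ \oo --> a -> \sum_(l < n) u l <= a.
Proof.
move=> u0 ua; rewrite -(cvg_lim _ ua)//.
apply: (nondecreasing_cvgn_le (u_ := fun n => \sum_(l < n) u l)); last by apply/cvg_ex; exists a.
move=> i j ij; rewrite -!(big_mkord xpredT u).
by rewrite [leRHS](big_cat_nat (n := i))//= lerDl; apply: sumr_ge0.
Qed.

Lemma kapply_eigen_le n s : on_D D s ->
  \sum_(l < n) kapply (eigen l) s ^+ 2 <= ip (kcomb D K s) (kcomb D K s).
Proof.
move=> Ds; rewrite (ip_kcomb rk (kcomb_rkhs rk Ds) Ds).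
apply: (@sum_le_lim (fun l => kapply (eigen l) s ^+ 2)); first by move=> l; exact: sqr_ge0.
apply: (eq_cvgn _ (kcomb_cvg Ds Ds)) => n'.
by apply: eq_bigr => l _; rewrite expr2.
Qed.

Lemma eigen_diag_le n t : D t -> \sum_(l < n) eigen l t ^+ 2 <= K t t.
Proof.
move=> Dt; apply: (@sum_le_lim (fun l => eigen l t ^+ 2)); first by move=> l; exact: sqr_ge0.
apply: (eq_cvgn _ (eigen_cvg Dt Dt)) => n'.
by apply: eq_bigr => l _; rewrite expr2.
Qed.

(** On a combination of kernel sections the functional of [comb m c] is a scalar
    product with the values of the eigenfunctions, whose squares sum to at most
    the square of its norm by the Mercer expansion. *)
Lemma comb_bounded m c : H (comb m c) /\
  ip (comb m c) (comb m c) <= \sum_(l < m) c l ^+ 2.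
Proof.
have c0 : 0 <= \sum_(l < m) c l ^+ 2 by apply: sumr_ge0 => l _; exact: sqr_ge0.
rewrite -[X in _ <= X](sqr_sqrtr c0); apply: (rkhs_of_bounded rk).
- exact: sqrtr_ge0.
- by move=> t; exact: comb0.
move=> s Ds; rewrite sqr_sqrtr//.
have -> : kapply (comb m c) s = \sum_(l < m) c l * kapply (eigen l) s.
  rewrite /kapply /comb; under eq_bigr do rewrite mulr_sumr.
  rewrite exchange_big/=; apply: eq_bigr => l _; rewrite mulr_sumr.
  by apply: eq_bigr => p _; rewrite mulrCA.
apply: le_trans (sum_CauchySchwarz _ _ _) _.
by rewrite ler_wpM2l//; exact: kapply_eigen_le.
Qed.

Lemma comb_rkhs m c : H (comb m c). Proof. exact: (comb_bounded m c).1. Qed.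

Lemma eigen_comb l : eigen l = comb l.+1 (fun k => (k == l)%:R).
Proof.
apply/funext => t; rewrite /comb big_ord_recr/= eqxx mul1r big1 ?add0r// => k _.
by rewrite ltn_eqF ?mul0r.
Qed.

Lemma eigen_rkhs l : H (eigen l).
Proof. by rewrite eigen_comb; exact: comb_rkhs. Qed.

Lemma ip_comb g m c : H g -> ip g (comb m c) = \sum_(l < m) c l * coef g l.
Proof.
move=> Hg; elim: m => [|m IH].
  rewrite big_ord0 (rkhs_sym rk Hg (comb_rkhs _ _)) -[RHS](ip0l rk Hg); congr ip.
  by apply/funext => t; rewrite /comb big_ord0.
have He := eigen_rkhs m; have Hc := comb_rkhs m c.
rewrite combS (ipDr rk)//; last exact: (rkhsZ rk).
by rewrite (ipZr rk)// IH big_ord_recr.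
Qed.

Lemma coef_le g m : H g -> \sum_(l < m) coef g l ^+ 2 <= ip g g.
Proof.
move=> Hg; set s := \sum_(l < m) _.
have s0 : 0 <= s by apply: sumr_ge0 => l _; exact: sqr_ge0.
have := ip_CauchySchwarz rk Hg (comb_rkhs m (coef g)).
rewrite ip_comb//; under eq_bigr do rewrite -expr2.
rewrite -/s => h; have := le_trans h (ler_wpM2l (rkhs_ge0 rk Hg) (comb_bounded m (coef g)).2).
rewrite -/s; have [s_gt0|s_le0 _] := ltP 0 s; last exact: le_trans s_le0 (rkhs_ge0 rk Hg).
by rewrite expr2 ler_pM2r.
Qed.

(** The truncated expansion of the kernel section at [t] converges in norm, because
    the expansion of [K t t] converges. *)
Lemma comb_coef_cvg g t : H g -> D t -> (fun n => comb n (coef g) t) @ \oo --> g t.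
Proof.
move=> Hg Dt; have Hs := rkhs_section rk Dt.
pose r n := ksection D K t \- comb n (eigen ^~ t).
have rle n : ip (r n) (r n) <= K t t - \sum_(l < n) eigen l t ^+ 2.
  rewrite (ip_sqrB rk)//; last exact: comb_rkhs.
  rewrite (rkhs_reproducing rk Hs Dt) ksectionE// (rkhs_sym rk Hs (comb_rkhs _ _)).
  rewrite (rkhs_reproducing rk (comb_rkhs _ _) Dt).
  have := (comb_bounded n (eigen ^~ t)).2.
  have -> : comb n (eigen ^~ t) t = \sum_(l < n) eigen l t ^+ 2.
    by apply: eq_bigr => l _; rewrite expr2.
  lra.
have gr n : g t - comb n (coef g) t = ip g (r n).
  rewrite (ipBr rk)//; last exact: comb_rkhs.
  rewrite (rkhs_reproducing rk Hg Dt) ip_comb//; congr (_ - _).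
  by apply: eq_bigr => l _; rewrite mulrC.
have gr2 n : (g t - comb n (coef g) t) ^+ 2 <= ip g g * (K t t - \sum_(l < n) eigen l t ^+ 2).
  rewrite gr; apply: le_trans (ip_CauchySchwarz rk Hg _) _.
    by apply: (rkhsB rk) => //; exact: comb_rkhs.
  by rewrite ler_wpM2l ?(rkhs_ge0 rk).
have lim0 : (fun n => ip g g * (K t t - \sum_(l < n) eigen l t ^+ 2)) @ \oo --> (0 : R).
  rewrite -[X in _ --> X](mulr0 (ip g g)); apply: cvgMr.
  rewrite -[X in _ --> X](subrr (K t t)); apply: cvgB; first exact: cvg_cst.
  apply: (eq_cvgn _ (eigen_cvg Dt Dt)) => n'.
  by apply: eq_bigr => l _; rewrite expr2.
apply/cvgrPdist_lt => e e0.
have e2 : 0 < e ^+ 2 by rewrite exprn_gt0.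
move/cvgrPdist_lt : lim0 => /(_ _ e2); apply: filterS => n.
rewrite sub0r normrN => h.
rewrite -(@ltr_pXn2r _ 2)// ?nnegrE ?(ltW e0)// real_normK ?num_real//.
by apply: le_lt_trans (gr2 n) (le_lt_trans (ler_norm _) h).
Qed.

Lemma Kb_ge t : D t -> 0 <= Kb.
Proof.
move=> Dt; apply: le_trans (K_le Dt).
by have := eigen_diag_le 0 Dt; rewrite big_ord0.
Qed.

Lemma comb_coef_le g n t : H g -> D t ->
  `|comb n (coef g) t| <= Num.sqrt (ip g g * Kb).
Proof.
move=> Hg Dt; have g0 := rkhs_ge0 rk Hg; have K0 := Kb_ge Dt.
rewrite -(@ler_pXn2r _ 2)// ?nnegrE ?sqrtr_ge0// real_normK ?num_real// sqr_sqrtr ?mulr_ge0//.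
apply: le_trans (sum_CauchySchwarz _ _ _) _.
apply: ler_pM; rewrite ?sumr_ge0//.
- by move=> l _; exact: sqr_ge0.
- by move=> l _; exact: sqr_ge0.
- exact: coef_le.
- exact: le_trans (eigen_diag_le _ Dt) (K_le Dt).
Qed.

(** * Integrals against the eigenfunctions *)

Lemma measurable_zero_ext (f : X -> R) : measurable_fun D f ->
  (forall t, ~ D t -> f t = 0) -> measurable_fun setT f.
Proof.
move=> mf f0; have -> : f = f \_ D.
  apply/funext => t; rewrite patchE; case: ifPn => // /negP tD.
  by apply: f0; move: tD; rewrite inE.
by apply/(measurable_restrictT _ mD).
Qed.

Lemma measurable_eigen l : measurable_fun setT (eigen l).
Proof.
apply: measurable_zero_ext; last by move=> t; exact: eigen0.
apply: (eq_measurable_fun (fun t => Num.sqrt (mu l) * phi l t)).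
  by move=> t; rewrite inE => Dt; rewrite eigenE.
by apply: measurable_funM => //; exact: mercer_meas mer l.
Qed.

Lemma measurable_comb m c : measurable_fun setT (comb m c).
Proof.
by apply: measurable_sum => l; apply: measurable_funM => //; exact: measurable_eigen.
Qed.

Lemma measurable_rkhs g : H g -> measurable_fun setT g.
Proof.
move=> Hg; apply: measurable_zero_ext; last by move=> t; exact: (rkhs_supp rk Hg).
apply: (measurable_fun_cvg (h := fun n => comb n (coef g))).
  by move=> n; apply: measurable_funTS; exact: measurable_comb.
by move=> t Dt; exact: comb_coef_cvg.
Qed.

Let phi_sqr_integrable l : rhoX.-integrable D (EFin \o (fun t => phi l t * phi l t)).
Proof.
have mphi := mercer_meas mer l.
have m2 : measurable_fun D (fun t => phi l t * phi l t) by exact: measurable_funM.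
apply/integrableP; split; first exact/measurable_EFinP.
have := mercer_orthonormal mer l l; rewrite eqxx /Rintegral => /= h.
rewrite (eq_integral (fun t => (phi l t * phi l t)%:E)); last first.
  by move=> t _ /=; rewrite ger0_norm// -expr2 sqr_ge0.
by case: integral h => [r _|/= h|/= h]; rewrite ?ltry//; move/eqP: h; rewrite eq_sym oner_eq0.
Qed.

Lemma phi_integrable l j : rhoX.-integrable D (EFin \o (fun t => phi l t * phi j t)).
Proof.
have mphi k := mercer_meas mer k.
apply: (le_integrable mD _ _ (integrableD mD (phi_sqr_integrable l) (phi_sqr_integrable j))).
  by apply/measurable_EFinP; exact: measurable_funM.
move=> t _ /=; rewrite lee_fin [leRHS]ger0_norm -?expr2 ?addr_ge0 ?sqr_ge0//.
rewrite ler_norml; have := sqr_ge0 (phi l t - phi j t); have := sqr_ge0 (phi l t + phi j t).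
rewrite sqrrD sqrrB => h1 h2; have := sqr_ge0 (phi l t); have := sqr_ge0 (phi j t).
by move=> h3 h4; apply/andP; split; lra.
Qed.

Let phi_abs_integrable j : rhoX.-integrable D (EFin \o (fun t => 1 + phi j t * phi j t)).
Proof.
have i1 : rhoX.-integrable D (EFin \o cst (1 : R)) by exact: finite_measure_integrable_cst.
by have := integrableD mD i1 (phi_sqr_integrable j); apply: eq_integrable.
Qed.

Lemma eigen_phi_integrable l j :
  rhoX.-integrable D (EFin \o (fun t => eigen l t * phi j t)).
Proof.
have := integrableZl mD (Num.sqrt (mu l)) (phi_integrable l j).
by apply: eq_integrable => // t; rewrite inE => Dt /=; rewrite eigenE// -EFinM mulrA.
Qed.

Lemma integral_eigen_phi l j :
  \int[rhoX]_(t in D) (eigen l t * phi j t) = Num.sqrt (mu l) * (l == j)%:R.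
Proof.
rewrite -(mercer_orthonormal mer) -RintegralZl//; last exact: phi_integrable.
by apply: eq_Rintegral => t; rewrite inE => Dt; rewrite eigenE// mulrA.
Qed.

Lemma comb_phi_integrable m c j :
  rhoX.-integrable D (EFin \o (fun t => comb m c t * phi j t)) /\
  \int[rhoX]_(t in D) (comb m c t * phi j t) =
    \sum_(l < m) c l * \int[rhoX]_(t in D) (eigen l t * phi j t).
Proof.
have ie (l : 'I_m) : rhoX.-integrable D (EFin \o (fun t => c l * (eigen l t * phi j t))).
  by have := integrableZl mD (c l) (eigen_phi_integrable l j); apply: eq_integrable.
have -> : (fun t => comb m c t * phi j t) = (fun t => \sum_(l < m) c l * (eigen l t * phi j t)).
  apply/funext => t; rewrite /comb mulr_suml.
  by apply: eq_bigr => l _; rewrite mulrA.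
have [si ->] := Rintegral_sum (index_enum 'I_m) mD ie; split => //.
by apply: eq_bigr => l _; rewrite RintegralZl//; exact: eigen_phi_integrable.
Qed.

Lemma integral_comb_phi m c j : (j < m)%N ->
  \int[rhoX]_(t in D) (comb m c t * phi j t) = c j * Num.sqrt (mu j).
Proof.
move=> jm.
rewrite (comb_phi_integrable m c j).2 (bigD1 (Ordinal jm))//= big1 ?addr0.
  by rewrite integral_eigen_phi eqxx mulr1.
move=> l lj; rewrite integral_eigen_phi (_ : (nat_of_ord l == j) = false) ?mulr0 ?mulr0//.
by apply/negbTE; move: lj; rewrite -val_eqE.
Qed.

(** The expansion of [g] converges pointwise and boundedly, hence it may be
    integrated term by term. *)
Lemma integral_rkhs_phi g j : H g ->
  \int[rhoX]_(t in D) (g t * phi j t) = coef g j * Num.sqrt (mu j).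
Proof.
move=> Hg; pose f n t := (comb n (coef g) t * phi j t)%:E.
pose B := Num.sqrt (ip g g * Kb).
have mphi := mercer_meas mer j.
have [] := @dominated_convergence _ _ R rhoX D mD f (fun t => (g t * phi j t)%:E)
  (fun t => (B * (1 + phi j t * phi j t))%:E).
- move=> n; apply/measurable_EFinP; apply: measurable_funM => //.
  by apply: measurable_funTS; exact: measurable_comb.
- apply/measurable_EFinP; apply: measurable_funM => //.
  by apply: measurable_funTS; exact: measurable_rkhs.
- apply: aeW => t Dt; apply: cvg_EFin; first by near=> n.
  by apply: cvgMl; exact: comb_coef_cvg.
- by have := integrableZl mD B (phi_abs_integrable j); apply: eq_integrable.
- apply: aeW => t n Dt; rewrite lee_fin normrM; apply: ler_pM => //.
    exact: comb_coef_le.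
  rewrite ler_norml; have := sqr_ge0 (phi j t - 1); have := sqr_ge0 (phi j t + 1).
  rewrite sqrrD sqrrB !mulr1 expr1n => h1 h2; have := sqr_ge0 (phi j t).
  by rewrite -expr2 => h3; apply/andP; split; lra.
move=> gi _ lim; rewrite /Rintegral.
have lim' : (\int[rhoX]_(t in D) f n t)%E @[n --> \oo] --> (coef g j * Num.sqrt (mu j))%:E.
  apply: cvg_near_cst; exists j.+1 => // n /= jn.
  rewrite -(integral_comb_phi (coef g) jn) /Rintegral fineK//.
  apply: integrable_fin_num => //.
  exact: (comb_phi_integrable n (coef g) j).1.
by rewrite (cvg_unique _ lim lim').
Unshelve. all: by end_near. Qed.

(** The coefficients of [eigen l] in the kernel space are computed from its
    integrals against the eigenfunctions. *)
Lemma eigen_orthonormal l j : ip (eigen l) (eigen j) = (l == j)%:R.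
Proof.
have := integral_rkhs_phi j (eigen_rkhs l); rewrite integral_eigen_phi.
have sm k : 0 < Num.sqrt (mu k) by rewrite sqrtr_gt0.
case: eqVneq => [->|_]; rewrite ?mulr1 ?mulr0 => h.
  by apply: (mulIf (lt0r_neq0 (sm j))); rewrite mul1r [RHS]h.
by apply: (mulIf (lt0r_neq0 (sm j))); rewrite mul0r [RHS]h.
Qed.

Lemma coef_comb m c l : (l < m)%N -> coef (comb m c) l = c l.
Proof.
move=> lm; rewrite /coef (rkhs_sym rk (comb_rkhs _ _) (eigen_rkhs _)) ip_comb; last exact: eigen_rkhs.
rewrite (bigD1 (Ordinal lm))//= /coef eigen_orthonormal eqxx mulr1 big1 ?addr0// => k kl.
rewrite eigen_orthonormal (_ : (l == k) = false) ?mulr0//.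
by apply/negbTE; move: kl; rewrite -val_eqE eq_sym.
Qed.

Lemma comb_ip m c : ip (comb m c) (comb m c) = \sum_(l < m) c l ^+ 2.
Proof.
rewrite ip_comb; last exact: comb_rkhs.
by apply: eq_bigr => l _; rewrite coef_comb.
Qed.

(** Finite combinations are dense: the expansion of [g] is Cauchy, so it has a
    limit in the space, which can only be its pointwise limit. *)
Lemma comb_dense g (e : R) : H g -> 0 < e -> exists m, ip_norm ip (g \- comb m (coef g)) < e.
Proof.
move=> Hg e0; pose v n := comb n (coef g).
have Hv n : H (v n) by exact: comb_rkhs.
pose S n := \sum_(l < n) coef g l ^+ 2.
have vS i j : (i <= j)%N -> ip (v j \- v i) (v j \- v i) <= S j - S i.
  move=> ij; pose c l := if (i <= l)%N then coef g l else 0.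
  have E : v j \- v i = comb j c.
    apply/funext => t /=; rewrite /v /comb.
    rewrite (sum_range (fun l => coef g l * eigen l t) ij).
    by apply: eq_bigr => l _; rewrite /c; case: ifP => _ //; rewrite mul0r.
  rewrite E comb_ip /S (sum_range (fun l => coef g l ^+ 2) ij).
  by apply: ler_sum => l _; rewrite /c; case: ifP => _ //; rewrite expr0n.
have S_nd : {homo S : n m / (n <= m)%N >-> n <= m}.
  move=> i j ij; rewrite -subr_ge0; apply: le_trans (vS i j ij).
  by apply: (rkhs_ge0 rk); exact: (rkhsB rk).
have S_cvg : cvgn S.
  apply: nondecreasing_is_cvgn => //; exists (ip g g) => _ [n _ <-]; exact: coef_le.
have S_le n : S n <= limn S by exact: nondecreasing_cvgn_le.
have S_near (d : R) : 0 < d -> exists N, forall n, (N <= n)%N -> limn S - d < S n.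
  move=> d0; move/cvgrPdist_lt : (S_cvg) => /(_ _ d0)[N _ NP].
  by exists N => n Nn; have := NP n Nn; rewrite /= ltr_norml => /andP[]; lra.
have [g' Hg' gv] : exists2 g', H g' & ip_norm ip (v k \- g') @[k --> \oo] --> (0 : R).
  apply: (rkhs_complete rk Hv) => d d0.
  have d2 : 0 < d ^+ 2 by rewrite exprn_gt0.
  have [N NP] := S_near _ d2; exists N => k l Nk Nl.
  wlog kl : k l Nk Nl / (l <= k)%N => [hw|].
    have [lk|/ltnW kl] := leqP l k; first exact: hw.
    by rewrite (ip_normN rk (Hv k) (Hv l)); exact: hw.
  rewrite -(@ltr_pXn2r _ 2)// ?nnegrE ?ip_norm_ge0 ?(ltW d0)//.
  rewrite (ip_norm_sqr rk); last exact: (rkhsB rk).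
  apply: le_lt_trans (vS l k kl) _; have := NP l Nl; have := S_le k; lra.
have gg' : g' = g.
  apply/funext => t; have [Dt|nDt] := pselect (D t); last first.
    by rewrite (rkhs_supp rk Hg' nDt) (rkhs_supp rk Hg nDt).
  have l1 : (fun n => v n t) @ \oo --> g' t.
    apply/cvgrPdist_lt => d d0.
    have K0 := sqrtr_ge0 (K t t).
    have dK : 0 < d / (Num.sqrt (K t t) + 1) by rewrite divr_gt0// ltr_wpDl.
    move/cvgrPdist_lt : gv => /(_ _ dK); apply: filterS => n.
    rewrite sub0r normrN ger0_norm ?ip_norm_ge0// ltr_pdivlMr ?ltr_wpDl// => h.
    rewrite distrC; apply: le_lt_trans h.
    apply: le_trans (rkhs_eval_le rk (rkhsB rk (Hv n) Hg') Dt) _.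
    by rewrite ler_wpM2l ?ip_norm_ge0// lerDl.
  by apply: (cvg_unique _ l1 (comb_coef_cvg Hg Dt)); exact: Rhausdorff.
move: gv; rewrite gg' => /cvgrPdist_lt/(_ _ e0)[N _ NP].
exists N; have := NP N (leqnn N); rewrite /= sub0r normrN ger0_norm ?ip_norm_ge0//.
by rewrite (ip_normN rk).
Qed.

Lemma integral_comb_sqr m c :
  \int[rhoX]_(t in D) (comb m c t ^+ 2) = \sum_(l < m) mu l * c l ^+ 2.
Proof.
have ie (l : 'I_m) : rhoX.-integrable D (EFin \o
    (fun t => c l * Num.sqrt (mu l) * (comb m c t * phi l t))).
  have := integrableZl mD (c l * Num.sqrt (mu l)) (comb_phi_integrable m c l).1.
  by apply: eq_integrable => // t _ /=; rewrite -EFinM.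
have [_ ] := Rintegral_sum (index_enum 'I_m) mD ie.
have -> : \int[rhoX]_(t in D) (\sum_(l < m) c l * Num.sqrt (mu l) * (comb m c t * phi l t)) =
    \int[rhoX]_(t in D) (comb m c t ^+ 2).
  apply: eq_Rintegral => t; rewrite inE => Dt; rewrite expr2 {3}/comb mulr_sumr.
  by apply: eq_bigr => l _; rewrite eigenE//; ring.
move=> ->; apply: eq_bigr => l _; rewrite RintegralZl//; last first.
  exact: (comb_phi_integrable m c l).1.
rewrite integral_comb_phi// -[in RHS](@sqr_sqrtr _ (mu l)) ?ltW//; ring.
Qed.

End mercer_theory.

(** * Compact sets of tuples are measurable *)

Section compact_measurable.
Context {R : realType} {d : nat}.

Lemma rational_near (a e : R) : 0 < e -> exists q : rat, `|a - ratr q| < e.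
Proof.
move=> e0; have /rat_in_itvoo[q] : a - e < a + e by rewrite ltrBlDr -addrA ltrDl addr_gt0.
by rewrite in_itv/= => /andP[h1 h2]; exists q; rewrite distrC ltr_distl h1.
Qed.

Lemma row_of_tuple_inj : injective (@row_of_tuple R d).
Proof.
move=> s t st; apply: eq_from_tnth => i.
by have /rowP/(_ i) := st; rewrite !mxE.
Qed.

Lemma measurable_row_ball (c : 'rV[R]_d) (e : R) : 0 < e ->
  measurable (row_of_tuple @^-1` ball c e).
Proof.
move=> e0; have -> : row_of_tuple @^-1` ball c e =
    [set t | forall j, `|c ord0 j - tnth t j| < e].
  apply/seteqP; split => [t h j|t h]; last split=> // i j.
    by have := h.2 ord0 j; rewrite mxE.
  by rewrite ord1 mxE; exact: h.
apply: measurable_forall => j.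
by apply: measurable_set_ltr => //; apply: measurableT_comp => //; apply: measurable_funB => //; exact: measurable_tnth.
Qed.

(** An open set is the union of the countably many balls with rational centre
    and inverse integer radius that it contains, so the coordinates generate
    the Borel sets. *)
Lemma measurable_compact (A : set (d.-tuple R)) :
  compact (row_of_tuple @` A) -> measurable A.
Proof.
move=> cA.
have clA : closed (row_of_tuple @` A : set 'rV[R]_d).
  by apply: compact_closed => //; exact: norm_hausdorff.
set U := ~` (row_of_tuple @` A) : set 'rV[R]_d.
have oU : open U by exact: closed_openC.
pose qv (q : 'rV[rat]_d) : 'rV[R]_d := map_mx ratr q.
have -> : A = ~` \bigcup_(q in [set q : 'rV[rat]_d * nat | ball (qv q.1) (q.2.+1%:R^-1) `<=` U])
    (row_of_tuple @^-1` ball (qv q.1) (q.2.+1%:R^-1)).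
  apply/seteqP; split => [t At [[q k] /= qU tq]|t nt].
    by apply: (qU _ tq); exists t.
  apply: contrapT => nA; apply: nt.
  have Ut : U (row_of_tuple t) by move=> [s As /row_of_tuple_inj st]; rewrite -st in nA.
  have /nbhs_ballP[e /= e0 eU] : nbhs (row_of_tuple t) U by exact: open_nbhs_nbhs.
  have [k _ kP] := near_infty_natSinv_lt (PosNum (divr_gt0 e0 (ltr0n R 2))).
  have ke : k.+1%:R^-1 < e / 2 := kP k (leqnn k).
  have k0 : (0 : R) < k.+1%:R^-1 by rewrite invr_gt0.
  have /choice[q qP] : forall j : 'I_d, exists r : rat,
      `|ratr r - tnth t j| < k.+1%:R^-1.
    by move=> j; have [r rP] := rational_near (tnth t j) k0; exists r; rewrite distrC.
  pose Q : 'rV[rat]_d := \row_j q j.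
  have bQ : ball (qv Q) (k.+1%:R^-1) (row_of_tuple t).
    by split=> // i j; rewrite ord1 !mxE; exact: qP.
  exists (Q, k) => //= s Qs; apply: eU.
  apply: (@le_ball _ _ _ (k.+1%:R^-1 + k.+1%:R^-1)); first by rewrite [leRHS](splitr e); apply: lerD; exact: ltW.
  by apply: ball_triangle Qs; exact: ball_sym.
apply: measurableC; rewrite bigcup_mkcond.
apply: countable_bigcupT_measurable => // q; case: ifP => // _.
by apply: measurable_row_ball; rewrite invr_gt0.
Qed.

End compact_measurable.

(** * The norm in L2 *)

Section L2norm_bounded.
Context {R : realType} {dX : measure_display} {X : measurableType dX}
  (rhoX : probability X R).
Implicit Types f g : X -> R.

Let sqr_integrable f (B : R) : measurable_fun setT f -> (forall x, `|f x| <= B) ->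
  rhoX.-integrable setT (EFin \o (fun x => f x ^+ 2)).
Proof.
move=> mf fB; apply: (@bounded_integrable _ _ _ _ _ (B ^+ 2)); first exact: measurable_funX.
move=> x; rewrite normrX; have := fB x; have := normr_ge0 (f x).
by move: (`|f x|) => a a0 aB; rewrite ler_sqr ?nnegrE// (le_trans a0).
Qed.

Let LnormE f (B : R) : measurable_fun setT f -> (forall x, `|f x| <= B) ->
  ('N[rhoX]_2%:E[EFin \o f] = (Num.sqrt (\int[rhoX]_x (f x ^+ 2)))%:E)%E.
Proof.
move=> mf fB; rewrite unlock /=.
have -> : (\int[rhoX]_x `|(f x)%:E| `^ 2 = (\int[rhoX]_x (f x ^+ 2))%:E)%E.
  rewrite /Rintegral fineK; last by apply: integrable_fin_num => //; exact: sqr_integrable fB.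
  apply: eq_integral => x _; rewrite /= powR_mulrn// real_normK// num_real//.
by rewrite poweR_EFin powR12_sqrt// Rintegral_ge0// => x _; exact: sqr_ge0.
Qed.

Lemma L2normE f (B : R) : measurable_fun setT f -> (forall x, `|f x| <= B) ->
  L2norm rhoX f = Num.sqrt (\int[rhoX]_x (f x ^+ 2)).
Proof. by move=> mf fB; rewrite /L2norm (LnormE mf fB). Qed.

Lemma L2norm_ge0 f : 0 <= L2norm rhoX f.
Proof. by rewrite fine_ge0// Lnorm_ge0. Qed.

Lemma L2norm_le f (B : R) : measurable_fun setT f -> (forall x, `|f x| <= B) ->
  L2norm rhoX f <= B.
Proof.
move=> mf fB; have B0 : 0 <= B by exact: le_trans (fB point).
rewrite (L2normE mf fB) -[leRHS]ger0_norm// -sqrtr_sqr ler_sqrt ?sqr_ge0//.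
rewrite -[leRHS](Rintegral_pr_cst rhoX); apply: le_Rintegral => //.
- exact: sqr_integrable fB.
- exact: (@bounded_integrable _ _ _ _ _ `|B ^+ 2|).
- by move=> x _; rewrite -[leLHS]real_normK ?num_real// ler_sqr ?nnegrE.
Qed.

Lemma L2normD f g (B : R) : measurable_fun setT f -> measurable_fun setT g ->
  (forall x, `|f x| <= B) -> (forall x, `|g x| <= B) ->
  L2norm rhoX (f \+ g) <= L2norm rhoX f + L2norm rhoX g.
Proof.
move=> mf mg fB gB.
have fgB x : `|(f \+ g) x| <= B + B by apply: le_trans (ler_normD _ _) (lerD (fB x) (gB x)).
have := @minkowski_EFin _ _ _ rhoX f g 2 mf mg; rewrite (LnormE mf fB) (LnormE mg gB).
rewrite (LnormE (measurable_funD mf mg) fgB) lee_fin => /(_ (ler1n _ 2)).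
by rewrite (L2normE mf fB) (L2normE mg gB) (L2normE (measurable_funD mf mg) fgB).
Qed.

End L2norm_bounded.

(** * Eigenvalues and the critical radius *)

Section mercer_moments.
Context {R : realType} {dX : measure_display} {X : measurableType dX} (D : set X)
  (K : X -> X -> R) (H : set (X -> R)) (ip : (X -> R) -> (X -> R) -> R)
  (rhoX : probability X R) (mu : nat -> R) (phi : nat -> X -> R).
Context (mD : measurable D) (rk : is_rkhs D K H ip) (mer : is_mercer D K rhoX mu phi)
  (Kb : R) (K_le : forall t, D t -> K t t <= Kb) (Kb_ge0 : 0 <= Kb).
Implicit Types (g h : X -> R) (t : X) (c : nat -> R).

Local Notation eigen := (eigen D mu phi).
Local Notation comb := (comb D mu phi).

Let mu_gt0 l : 0 < mu l. Proof. exact: mercer_gt0 mer l. Qed.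

Lemma rkhs_bounded g t : H g -> `|g t| <= ip_norm ip g * Num.sqrt Kb.
Proof.
move=> Hg; have [Dt|nDt] := pselect (D t).
  apply: le_trans (rkhs_eval_le rk Hg Dt) _.
  by rewrite ler_wpM2l ?ip_norm_ge0// ler_sqrt// K_le.
by rewrite (rkhs_supp rk Hg nDt) normr0 mulr_ge0 ?ip_norm_ge0 ?sqrtr_ge0.
Qed.

Lemma eigen_sqr_sum n t : \sum_(l < n) eigen l t ^+ 2 <= Kb.
Proof.
have [Dt|nDt] := pselect (D t); first exact: le_trans (eigen_diag_le mer _ Dt) (K_le Dt).
by rewrite big1// => l _; rewrite eigen0// expr0n.
Qed.

Lemma integral_setT_comb_sqr m c :
  \int[rhoX]_t (comb m c t ^+ 2) = \sum_(l < m) mu l * c l ^+ 2.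
Proof.
rewrite -(integral_comb_sqr mD mer) [RHS]Rintegral_mkcond; congr (Rintegral _ _ _).
apply/funext => t; rewrite patchE; case: ifPn => // /negP; rewrite inE => nDt.
by rewrite comb0// expr0n.
Qed.

Lemma L2norm_comb m c : L2norm rhoX (comb m c) ^+ 2 = \sum_(l < m) mu l * c l ^+ 2.
Proof.
have Hc := comb_rkhs rk mer m c.
rewrite (@L2normE _ _ _ _ _ (ip_norm ip (comb m c) * Num.sqrt Kb)).
- rewrite sqr_sqrtr; first exact: integral_setT_comb_sqr.
  by apply: Rintegral_ge0 => x _; exact: sqr_ge0.
- exact: (measurable_comb mD mer).
- by move=> t; exact: rkhs_bounded.
Qed.

Lemma integral_eigen_sqr l : \int[rhoX]_t (eigen l t ^+ 2) = mu l.
Proof.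
have := integral_setT_comb_sqr l.+1 (fun k => (k == l)%:R).
rewrite big_ord_recr/= big1 ?add0r; last first.
  by move=> i _; rewrite ltn_eqF// expr0n mulr0.
rewrite eqxx expr1n mulr1 => <-; congr (Rintegral _ _ _); apply/funext => t; congr (_ ^+ 2).
rewrite /comb big_ord_recr/= big1 ?add0r ?eqxx ?mul1r//.
by move=> i _; rewrite ltn_eqF// mul0r.
Qed.

(** The full sum is the trace of the kernel operator, the integral of [K t t]. *)
Lemma eigenvalue_sum_le m : \sum_(l < m) mu l <= Kb.
Proof.
have ei (l : 'I_m) : rhoX.-integrable setT (EFin \o (fun t => eigen l t ^+ 2)).
  apply: (@bounded_integrable _ _ _ _ _ Kb).
    by apply: measurable_funX; exact: (measurable_eigen mD mer).
  move=> t; rewrite ger0_norm ?sqr_ge0//; apply: le_trans (eigen_sqr_sum m t).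
  by rewrite (bigD1 l)//= lerDl sumr_ge0// => i _; exact: sqr_ge0.
have [si se] := Rintegral_sum (index_enum 'I_m) measurableT ei.
have -> : \sum_(l < m) mu l = \sum_(l < m) \int[rhoX]_t (eigen l t ^+ 2).
  by apply: eq_bigr => l _; rewrite integral_eigen_sqr.
rewrite -se -[leRHS](Rintegral_pr_cst rhoX); apply: le_Rintegral => //.
  exact: (@bounded_integrable _ _ _ _ _ `|Kb|).
by move=> t _; exact: eigen_sqr_sum.
Qed.

Section rates.
Context (n : nat) (nu : R) (n_gt0 : (0 < n)%N) (nuP : is_critical_radius mu n nu).

(** The series defining the critical radius converges because the eigenvalues are
    summable. *)
Lemma critical_radius_sum m :
  \sum_(l < m) Num.min (nu ^+ 2) (mu l) <= n%:R * (40 * nu ^+ 2) ^+ 2.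
Proof.
case: nuP => nu0 Qnu _; pose u l := Num.min (nu ^+ 2) (mu l).
have u0 l : 0 <= u l by rewrite le_min sqr_ge0 ltW.
have nd : {homo series u : i j / (i <= j)%N >-> i <= j}.
  move=> i j ij; rewrite !seriesEnat/= [leRHS](big_cat_nat (n := i))//= lerDl.
  by apply: sumr_ge0.
have cv : cvgn (series u).
  apply: nondecreasing_is_cvgn => //; exists Kb => _ [k _ <-].
  rewrite seriesEnat/= big_mkord; apply: le_trans (eigenvalue_sum_le k).
  by apply: ler_sum => l _; rewrite ge_min lexx orbT.
have h : \sum_(l < m) u l <= limn (series u).
  have := nondecreasing_cvgn_le nd cv m; by rewrite seriesEnat/= big_mkord.
apply: le_trans h _; set L := limn _ in Qnu *.
have n0 : (0 : R) < n%:R by rewrite ltr0n.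
have L0 : 0 <= L by apply: le_trans (nondecreasing_cvgn_le nd cv 0); rewrite seriesEnat/= big_geq.
move: Qnu; rewrite /Qn -/u -/L => Qnu.
have sn : 0 < Num.sqrt n%:R :> R by rewrite sqrtr_gt0.
have : Num.sqrt L <= Num.sqrt n%:R * (40 * nu ^+ 2) by rewrite -ler_pdivrMl.
rewrite -(@ler_pXn2r _ 2)// ?nnegrE ?sqrtr_ge0//; last first.
  by rewrite mulr_ge0 ?sqrtr_ge0// mulr_ge0 ?sqr_ge0.
by rewrite sqr_sqrtr// exprMn sqr_sqrtr// ltW.
Qed.

(** The ratio of the truncated sum to the square of the truncation level
    decreases with the level. *)
Lemma critical_radius_sum_ge m gam : nu <= gam ->
  \sum_(l < m) Num.min (gam ^+ 2) (mu l) <= n%:R * (40 * gam ^+ 2) ^+ 2.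
Proof.
move=> nug; have nu0 : 0 < nu by case: nuP.
have g0 : 0 < gam by exact: lt_le_trans nug.
have r1 : 1 <= (gam / nu) ^+ 2 by rewrite exprn_ege1// ler_pdivlMr// mul1r.
apply: (@le_trans _ _ ((gam / nu) ^+ 2 * \sum_(l < m) Num.min (nu ^+ 2) (mu l))).
  rewrite mulr_sumr; apply: ler_sum => l _; rewrite minr_pMr ?sqr_ge0//.
  rewrite -exprMn divfK ?lt0r_neq0// le_min !ge_min lexx/=; apply/orP; right.
  by rewrite ler_peMl// ltW.
apply: (@le_trans _ _ ((gam / nu) ^+ 2 * (n%:R * (40 * nu ^+ 2) ^+ 2))).
  by rewrite ler_wpM2l ?sqr_ge0//; exact: critical_radius_sum.
have -> : (gam / nu) ^+ 2 * (n%:R * (40 * nu ^+ 2) ^+ 2) = n%:R * (40 * (gam * nu)) ^+ 2.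
  by field; rewrite lt0r_neq0.
rewrite ler_wpM2l// ler_sqr ?nnegrE ?mulr_ge0 ?(ltW g0) ?(ltW nu0) ?sqr_ge0//.
by rewrite ler_wpM2l// expr2 ler_wpM2l// ltW.
Qed.

End rates.

End mercer_moments.

(** * The hinge loss of a partially linear decision function *)

Section model_loss.
Context {R : realType} {d p : nat}.
Implicit Types (beta b : 'rV[R]_p) (g : d.-tuple R -> R) (x : obs R p d).

Lemma l1norm_ge0 beta : 0 <= l1norm beta.
Proof. by apply: sumr_ge0 => j _. Qed.

Lemma l1normD beta b : l1norm (beta + b) <= l1norm beta + l1norm b.
Proof. by rewrite -big_split; apply: ler_sum => j _; rewrite mxE ler_normD. Qed.

Lemma hinge_lipschitz (a b : R) : `|hinge a - hinge b| <= `|a - b|.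
Proof.
rewrite -[hinge a]/(pos_part (1 - a)) -[hinge b]/(pos_part (1 - b)).
apply: le_trans (pos_part_lipschitz _ _) _.
have -> : 1 - a - (1 - b) = b - a by ring.
by rewrite distrC.
Qed.

Lemma decisionB beta beta' g g' x : decision beta g x - decision beta' g' x =
  decision (beta - beta') (g \- g') x.
Proof.
rewrite /decision /= opprD addrACA -sumrB; congr (_ + _); apply: eq_bigr => j _.
by rewrite !mxE mulrBl.
Qed.

Lemma decision_le beta g x (C M : R) : (forall j, `|tnth (obsZ x) j| <= C) ->
  `|g (obsT x)| <= M -> `|decision beta g x| <= C * l1norm beta + M.
Proof.
move=> ZC gM; apply: le_trans (ler_normD _ _) _; apply: lerD => //.
apply: le_trans (ler_norm_sum _ _ _) _; rewrite mulr_sumr; apply: ler_sum => j _.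
by rewrite normrM mulrC ler_wpM2r.
Qed.

Lemma margin_loss_lipschitz beta beta' g g' x :
  `|margin_loss beta g x - margin_loss beta' g' x| <=
  `|obsY x| * `|decision (beta - beta') (g \- g') x|.
Proof.
apply: le_trans (hinge_lipschitz _ _) _.
by rewrite -mulrBr decisionB normrM.
Qed.

Lemma measurable_obsY : measurable_fun setT (@obsY R p d).
Proof. exact: (measurableT_comp measurable_fst measurable_fst). Qed.

Lemma measurable_obsZ (j : 'I_p) : measurable_fun setT (fun x : obs R p d => tnth (obsZ x) j).
Proof.
apply: (measurableT_comp (measurable_tnth j)).
exact: (measurableT_comp measurable_snd measurable_fst).
Qed.

Lemma measurable_obsT : measurable_fun setT (@obsT R p d).
Proof. exact: measurable_snd. Qed.

Lemma measurable_decision beta g : measurable_fun setT g ->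
  measurable_fun setT (fun x : obs R p d => decision beta g x).
Proof.
move=> mg; apply: measurable_funD; last exact: (measurableT_comp mg measurable_obsT).
by apply: measurable_sum => j; apply: measurable_funM => //; exact: measurable_obsZ.
Qed.

Lemma measurable_margin_loss beta g : measurable_fun setT g ->
  measurable_fun setT (fun x : obs R p d => margin_loss beta g x).
Proof.
move=> mg; apply: measurable_maxr => //; apply: measurable_funB => //.
apply: measurable_funM; [exact: measurable_obsY|exact: measurable_decision].
Qed.

End model_loss.

(** * The empirical process of the model *)

Section hinge_class.
Context {R : realType} {d p : nat} (calT : set (d.-tuple R))
  (K : d.-tuple R -> d.-tuple R -> R) (H : set (d.-tuple R -> R))
  (ip : (d.-tuple R -> R) -> (d.-tuple R -> R) -> R)
  (rhoT : probability (d.-tuple R) R) (mu : nat -> R) (phi : nat -> d.-tuple R -> R)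
  (C0 Kb : R).
Context (mT : measurable calT) (aeT : {ae rhoT, forall t, calT t})
  (rk : is_rkhs calT K H ip) (mer : is_mercer calT K rhoT mu phi)
  (K_le : forall t, calT t -> K t t <= Kb) (Kb_gt0 : 0 < Kb) (C0_gt0 : 0 < C0).
Context {dO : measure_display} {Omega : measurableType dO} (P : probability Omega R)
  (rho : probability (obs R p d) R) (n : nat) (W : 'I_n -> {RV P >-> obs R p d})
  (beta0 : 'rV[R]_p) (g0 : d.-tuple R -> R) (nu : R).
Context (n_gt0 : (0 < n)%N) (aeY : {ae rho, forall w, obsY w = -1 \/ obsY w = 1})
  (rhoTE : forall B, measurable B -> rho (@obsT R p d @^-1` B) = rhoT B)
  (aeZ : {ae rho, forall w, forall j, `|tnth (obsZ w) j| <= C0})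
  (iid : is_iid rho W) (Hg0 : H g0) (nuP : is_critical_radius mu n nu).
Implicit Types (beta b : 'rV[R]_p) (g : d.-tuple R -> R) (x : obs R p d).

Local Notation eigen := (eigen calT mu phi).
Local Notation comb := (comb calT mu phi).
Local Notation gam := (gamma_rate nu n p).
Local Notation lam := (Num.sqrt (ln p%:R / n%:R) : R).

Let Kb_ge0 : 0 <= Kb. Proof. exact: ltW. Qed.

(** Almost every observation satisfies the bounds of the model; the others are cut
    off, to have bounds that hold everywhere. *)
Definition typical_obs : set (obs R p d) :=
  [set x | (obsY x = -1 \/ obsY x = 1) /\ (forall j, `|tnth (obsZ x) j| <= C0) /\
           calT (obsT x)].

Local Notation chi x := (indic (typical_obs x) : R).

Lemma measurable_typical_obs : measurable typical_obs.
Proof.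
have -> : typical_obs = [set x | `|obsY x ^+ 2 - 1| <= 0] `&`
    ([set x | forall j, `|tnth (obsZ x) j| <= C0] `&` (@obsT R p d @^-1` calT)).
  apply/seteqP; split => [x [Y ZT]|x [Y ZT]]; split => //.
    by case: Y => /= ->; rewrite ?sqrrN expr1n subrr normr0.
  move: Y => /=; rewrite normr_le0 subr_eq0 sqrf_eq1 => /orP[/eqP|/eqP]; tauto.
apply: measurableI.
  apply: measurable_set_ler => //; apply: measurableT_comp => //; apply: measurable_funB => //.
  by apply: measurable_funX; exact: measurable_obsY.
apply: measurableI.
  apply: measurable_forall => j; apply: measurable_set_ler => //.
  by apply: measurableT_comp => //; exact: measurable_obsZ.
by rewrite -[X in measurable X]setTI; exact: measurable_obsT.
Qed.

Lemma typical_obs_ae : {ae rho, forall x, typical_obs x}.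
Proof.
have aT : {ae rho, forall x : obs R p d, calT (obsT x)}.
  have /negligibleP h0 : rhoT.-negligible (~` calT) by exact: aeT.
  exists (@obsT R p d @^-1` (~` calT)); split => //.
    by rewrite -[X in measurable X]setTI; apply: measurable_obsT => //; exact: measurableC.
  by rewrite rhoTE; [apply: h0; exact: measurableC|exact: measurableC].
by apply: filterS3 aeY aeZ aT => x Y Z T; split.
Qed.

Lemma typical_obs_null : rho (~` typical_obs) = 0.
Proof.
have mC := measurableC measurable_typical_obs.
by apply/(negligibleP rho mC); exact: typical_obs_ae.
Qed.

Definition margin_bound beta g : R :=
  1 + (C0 * l1norm beta + ip_norm ip g * Num.sqrt Kb).

Lemma margin_loss_typical beta g x : H g -> typical_obs x ->
  `|margin_loss beta g x| <= margin_bound beta g.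
Proof.
move=> Hg [Y [Z T]].
have Y1 : `|obsY x| = 1 by case: Y => ->; rewrite ?normrN normr1.
have h : `|obsY x * decision beta g x| <= C0 * l1norm beta + ip_norm ip g * Num.sqrt Kb.
  rewrite normrM Y1 mul1r; apply: decision_le => //.
  by apply: (rkhs_bounded rk K_le Kb_ge0).
rewrite /margin_loss /hinge /margin_bound; move: h; set a := _ * decision _ _ _.
rewrite ler_norml => /andP[h1 h2].
by rewrite ler_norml /Num.max; case: ifP => h3; apply/andP; split; lra.
Qed.

Lemma margin_bound_ge0 beta g : 0 <= margin_bound beta g.
Proof.
apply: addr_ge0 => //.
by apply: addr_ge0; rewrite mulr_ge0 ?ip_norm_ge0 ?sqrtr_ge0 ?l1norm_ge0// ltW.
Qed.

Lemma chi_margin_loss beta g x : H g -> `|chi x * margin_loss beta g x| <= margin_bound beta g.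
Proof.
move=> Hg; have [t|t] := pselect (typical_obs x).
  by rewrite indicT// mul1r; exact: margin_loss_typical.
by rewrite indicF// mul0r normr0 margin_bound_ge0.
Qed.

Lemma measurable_chi : measurable_fun setT (fun x => chi x).
Proof. by apply: measurable_indic_set; exact: measurable_typical_obs. Qed.

Let mH g : H g -> measurable_fun setT g.
Proof. exact: (measurable_rkhs mT rk mer). Qed.

Lemma chi_margin_integrable beta g : H g ->
  rho.-integrable setT (EFin \o (fun x => chi x * margin_loss beta g x)).
Proof.
move=> Hg; apply: (@bounded_integrable _ _ _ _ _ (margin_bound beta g)).
  by apply: measurable_funM; [exact: measurable_chi|apply: measurable_margin_loss; exact: mH].
by move=> x; exact: chi_margin_loss.
Qed.

Lemma riskE beta g : H g -> risk rho beta g = \int[rho]_x (chi x * margin_loss beta g x).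
Proof.
move=> Hg; rewrite /risk unlock /Rintegral; congr fine.
have mm : measurable_fun setT (fun x : obs R p d => margin_loss beta g x).
  by apply: measurable_margin_loss; exact: mH.
apply: ae_eq_integral => //.
- exact/measurable_EFinP.
- by apply/measurable_EFinP; apply: measurable_funM => //; exact: measurable_chi.
by apply: filterS typical_obs_ae => x tx _ /=; rewrite indicT// mul1r.
Qed.

Lemma risk_lipschitz beta beta' g g' : H g -> H g' ->
  `|risk rho beta g - risk rho beta' g'| <=
  C0 * l1norm (beta - beta') + ip_norm ip (g \- g') * Num.sqrt Kb.
Proof.
move=> Hg Hg'; rewrite !riskE//; set B := (X in _ <= X).
have B0 : 0 <= B.
  by apply: addr_ge0; rewrite mulr_ge0 ?ip_norm_ge0 ?sqrtr_ge0 ?l1norm_ge0// ltW.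
have i1 := chi_margin_integrable beta Hg; have i2 := chi_margin_integrable beta' Hg'.
rewrite -RintegralB//.
have i3 := integrableB measurableT i1 i2.
apply: le_trans (le_normr_Rintegral _ _) _ => //.
rewrite -[leRHS](Rintegral_pr_cst rho); apply: le_Rintegral => //.
- by have := integrable_norm i3; apply: eq_integrable.
- exact: (@bounded_integrable _ _ _ _ _ `|B|).
move=> x _; rewrite -mulrBr; have [t|t] := pselect (typical_obs x); last first.
  by rewrite indicF// mul0r normr0.
rewrite indicT// mul1r; apply: le_trans (margin_loss_lipschitz _ _ _ _ _) _.
case: t => Y [Z T].
have -> : `|obsY x| = 1 by case: Y => ->; rewrite ?normrN normr1.
rewrite mul1r; apply: decision_le => //.
exact: (rkhs_bounded rk K_le Kb_ge0) (rkhsB rk Hg Hg').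
Qed.

(** The constant depends on the sample: the inequality serves to approximate
    decision functions for one sample at a time. *)
Lemma emp_risk_lipschitz (w : Omega) : exists L : R, 0 <= L /\
  forall beta beta' g g', H g -> H g' ->
  `|emp_risk (W ^~ w) beta g - emp_risk (W ^~ w) beta' g'| <=
  L * (l1norm (beta - beta') + ip_norm ip (g \- g') * Num.sqrt Kb).
Proof.
pose M (i : 'I_n) : R := 1 + \sum_j `|tnth (obsZ (W i w)) j|.
exists (n%:R^-1 * \sum_(i < n) `|obsY (W i w)| * M i).
have M1 i : 1 <= M i by rewrite lerDl sumr_ge0.
have M0 i : 0 <= M i by exact: le_trans ler01 (M1 i).
split; first by rewrite mulr_ge0// ?invr_ge0// sumr_ge0// => i _; rewrite mulr_ge0.
move=> beta beta' g g' Hg Hg'.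
rewrite /emp_risk -mulrBr normrM ger0_norm ?invr_ge0// -mulrA ler_wpM2l ?invr_ge0//.
rewrite -sumrB; apply: le_trans (ler_norm_sum _ _ _) _; rewrite mulr_suml.
apply: ler_sum => i _; apply: le_trans (margin_loss_lipschitz _ _ _ _ _) _.
rewrite -mulrA ler_wpM2l//.
apply: le_trans (decision_le (C := M i) (M := ip_norm ip (g \- g') * Num.sqrt Kb) _ _ _) _.
- move=> j; rewrite /M (bigD1 j)//= addrCA lerDl addr_ge0// sumr_ge0//.
- exact: (rkhs_bounded rk K_le Kb_ge0) (rkhsB rk Hg Hg').
rewrite mulrDr lerD2l ler_peMl// mulr_ge0 ?ip_norm_ge0 ?sqrtr_ge0//.
Qed.

Definition deviation_rate b g : R :=
  lam * l1norm b + gam * L2norm rhoT g + gam ^+ 2 * ip_norm ip g + expR (- p%:R).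

Definition excess_process beta g (w : Omega) : R :=
  emp_process rho (W ^~ w) beta g - emp_process rho (W ^~ w) beta0 g0.

Lemma measurable_excess_process beta g : H g -> measurable_fun setT (excess_process beta g).
Proof.
move=> Hg; have me beta' g' : H g' -> measurable_fun setT (fun w => emp_risk (W ^~ w) beta' g').
  move=> Hg'; apply: measurable_funM => //; apply: measurable_sum => i.
  exact: (measurable_comp_RV W i (measurable_margin_loss beta' (mH Hg'))).
by apply: measurable_funB; apply: measurable_funB => //; exact: me.
Qed.

Lemma gamma_rate_gt0 : 0 < gam.
Proof. by case: nuP => nu0 _ _; apply: lt_le_trans nu0 _; rewrite le_max lexx. Qed.

Lemma deviation_rate_gt0 b g : 0 < deviation_rate b g.
Proof.
have g0' := ltW gamma_rate_gt0.
apply: ltr_wpDl; last exact: expR_gt0.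
apply: addr_ge0; first apply: addr_ge0.
- by rewrite mulr_ge0 ?sqrtr_ge0 ?l1norm_ge0.
- by rewrite mulr_ge0 ?L2norm_ge0.
- by rewrite mulr_ge0 ?sqr_ge0 ?ip_norm_ge0.
Qed.

Definition typical_sample : set Omega := [set w | forall i, typical_obs (W i w)].

Lemma measurable_typical_sample : measurable typical_sample.
Proof.
apply: measurable_forall => i; rewrite -[X in measurable X]setTI.
by apply: measurable_funPT => //; exact: measurable_typical_obs.
Qed.

Lemma typical_sample_pr : pr P (~` typical_sample) = 0.
Proof.
rewrite pr_setC; last exact: measurable_typical_sample.
have -> : pr P typical_sample = 1; last by rewrite subrr.
rewrite /pr (iid_rect iid (A := fun=> typical_obs)); last first.
  by move=> _; exact: measurable_typical_obs.
rewrite big1// => i _.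
have := probability_setC rho measurable_typical_obs; rewrite typical_obs_null.
by move=> /eqP; rewrite eq_sym sube_eq ?add0e// => /eqP <-.
Qed.

Lemma Rintegral_obsT (f : d.-tuple R -> R) (c : R) : measurable_fun setT f ->
  (forall t, `|f t| <= c) -> \int[rho]_x f (obsT x) = \int[rhoT]_t f t.
Proof.
move=> mf fc; rewrite /Rintegral; congr fine.
have mfE : measurable_fun setT (EFin \o f) by exact/measurable_EFinP.
have := @integral_pushforward _ _ _ _ R (@obsT R p d) (@measurable_obsT R d p) rho setT (EFin \o f) mfE.
rewrite preimage_setT => /(_ _ measurableT) <-.
  apply: eq_measure_integral; first exact: measurable_obsT.
  by move=> mf' A mA _; exact: rhoTE.
apply: (@bounded_integrable _ _ _ rho (fun x => f (obsT x)) c) => //.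
exact: (measurableT_comp mf (@measurable_obsT R d p)).
Qed.

(** * Finite classes of decision functions *)

(** The envelope is at most [2 * Kb / gamma ^ 4], and its mean at most
    [2 * 40 ^ 2 * n], the factor [40] being that of the critical radius. *)
Definition hinge_constant : R :=
  deviation_constant C0 (Num.sqrt (2 * Kb)) (2 * 40 ^+ 2).

Section finite_class.
Context (J : finType) (j0 : J) (m : nat) (b : J -> 'rV[R]_p) (c : J -> nat -> R)
  (b0 : b j0 = 0) (c0 : forall i, c j0 i = 0)
  (l_ge1 : 1 <= ln p%:R :> R) (exp_small : 32 * expR (- (2 * ln p%:R)) <= 1 :> R).

Let l : R := ln p%:R.
Let N : R := n%:R.
Let k1 : R := Num.sqrt (2 * Kb).
Let g j : d.-tuple R -> R := comb m (c j).
Let sc j : R := (deviation_rate (b j) (g j))^-1.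
Let al j (i : 'I_m) : R := sc j * c j i.
Let wt (i : 'I_m) : R := mu i * gam ^+ 2 + gam ^+ 4.
Let e (i : 'I_m) (x : obs R p d) : R := eigen i (obsT x).
Let bs j (i : 'I_p) : R := sc j * b j ord0 i.
Let z (i : 'I_p) (x : obs R p d) : R := chi x * tnth (obsZ x) i.
Let y (x : obs R p d) : R := chi x * obsY x.
Let tau (x : obs R p d) : R := 1 - obsY x * decision beta0 g0 x.
Let h := hinge_increment al e bs z y tau sc.

Let N_gt0 : 0 < N. Proof. by rewrite ltr0n. Qed.
Let gam_gt0 : 0 < gam := gamma_rate_gt0.
Let l_gt0 : 0 < l. Proof. exact: lt_le_trans ltr01 l_ge1. Qed.
Let mu_gt0 i : 0 < mu i. Proof. exact: mercer_gt0 mer i. Qed.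
Let Hg j : H (g j). Proof. exact: (comb_rkhs rk mer). Qed.
Let Hg0g j : H (g0 \+ g j). Proof. exact: (rkhsD rk). Qed.
Let sc_gt0 j : 0 < sc j. Proof. by rewrite invr_gt0 deviation_rate_gt0. Qed.

Let sc_part j (a a' : R) : 0 <= a' -> a + a' = deviation_rate (b j) (g j) -> sc j * a <= 1.
Proof.
move=> a0 E; rewrite -(@mulVf _ (deviation_rate (b j) (g j))) ?lt0r_neq0 ?deviation_rate_gt0//.
by rewrite -/(sc j) ler_wpM2l ?(ltW (sc_gt0 j))// -E lerDl.
Qed.

Let term_ge0 j : [/\ 0 <= lam * l1norm (b j), 0 <= gam * L2norm rhoT (g j),
  0 <= gam ^+ 2 * ip_norm ip (g j) & 0 <= expR (- p%:R) :> R].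
Proof.
split; last exact: expR_ge0.
- by rewrite mulr_ge0 ?sqrtr_ge0 ?l1norm_ge0.
- by rewrite mulr_ge0 ?L2norm_ge0// ltW.
- by rewrite mulr_ge0 ?sqr_ge0 ?ip_norm_ge0.
Qed.

Let sc_l1 j : sc j * (lam * l1norm (b j)) <= 1.
Proof.
have [t1 t2 t3 t4] := term_ge0 j.
apply: (sc_part (a' := gam * L2norm rhoT (g j) + gam ^+ 2 * ip_norm ip (g j) + expR (- p%:R))).
  by rewrite !addr_ge0.
by rewrite /deviation_rate !addrA.
Qed.

Let sc_norms j : sc j * (gam * L2norm rhoT (g j) + gam ^+ 2 * ip_norm ip (g j)) <= 1.
Proof.
have [t1 t2 t3 t4] := term_ge0 j.
apply: (sc_part (a' := lam * l1norm (b j) + expR (- p%:R))); first by rewrite !addr_ge0.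
by rewrite /deviation_rate; ring.
Qed.

Let bs_le j : \sum_i `|bs j i| <= Num.sqrt (N / l).
Proof.
have -> : \sum_i `|bs j i| = sc j * l1norm (b j).
  by rewrite mulr_sumr; apply: eq_bigr => i _; rewrite normrM gtr0_norm.
have lam_gt0 : 0 < lam by rewrite sqrtr_gt0 divr_gt0.
have -> : Num.sqrt (N / l) = lam^-1 by rewrite -sqrtrV ?invf_div// divr_ge0 ?ltW.
by rewrite -(ler_pM2l lam_gt0) mulfV ?lt0r_neq0// mulrCA.
Qed.

(** The weighted sum of squares is the sum of the squares of the two norms of the
    kernel part, each multiplied by its rate. *)
Let al_le j : \sum_i wt i * al j i ^+ 2 <= 2.
Proof.
have [_ t2 t3 _] := term_ge0 j; have s0 := sc_gt0 j.
have -> : \sum_i wt i * al j i ^+ 2 =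
    (sc j * (gam * L2norm rhoT (g j))) ^+ 2 + (sc j * (gam ^+ 2 * ip_norm ip (g j))) ^+ 2.
  have -> : (sc j * (gam * L2norm rhoT (g j))) ^+ 2 + (sc j * (gam ^+ 2 * ip_norm ip (g j))) ^+ 2
    = sc j ^+ 2 * (gam ^+ 2 * L2norm rhoT (g j) ^+ 2 + gam ^+ 4 * ip_norm ip (g j) ^+ 2) by ring.
  rewrite (ip_norm_sqr rk (Hg j)) (comb_ip mT rk mer K_le) (L2norm_comb mT rk mer K_le Kb_ge0).
  rewrite !mulr_sumr -big_split mulr_sumr; apply: eq_bigr => i _ /=.
  by rewrite /wt /al; ring.
have := sc_norms j; rewrite mulrDr.
have u0 : 0 <= sc j * (gam * L2norm rhoT (g j)) by rewrite mulr_ge0// ltW.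
have v0 : 0 <= sc j * (gam ^+ 2 * ip_norm ip (g j)) by rewrite mulr_ge0// ltW.
move: u0 v0; set u := sc j * _; set v := sc j * _; move=> u0 v0 uv.
have u1 : u ^+ 2 <= 1 by rewrite expr_le1//; lra.
have v1 : v ^+ 2 <= 1 by rewrite expr_le1//; lra.
lra.
Qed.

Let kernelE j x : kernel_part al e j x = sc j * g j (obsT x).
Proof. by rewrite /g /comb mulr_sumr; apply: eq_bigr => i _; rewrite mulrA. Qed.

(** A nonnegative scale commutes with the positive part; at an observation that is
    not typical both sides vanish. *)
Let incrementE j x :
  h j x = sc j * (chi x * margin_loss (beta0 + b j) (g0 \+ g j) x - chi x * margin_loss beta0 g0 x).
Proof.
rewrite /h /hinge_increment kernelE /y /linear_part /z.
have [t|t] := pselect (typical_obs x); last first.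
  by rewrite indicF// !mul0r !subr0 !subrr mulr0.
rewrite indicT// !mul1r.
have mx (u : R) : sc j * hinge u = pos_part (sc j * (1 - u)).
  by rewrite /hinge /pos_part maxr_pMr ?mulr0// ltW.
rewrite [RHS]mulrBr /margin_loss !mx -/(tau x); congr (pos_part _ - _).
have -> : \sum_i bs j i * (1 * tnth (obsZ x) i) = sc j * (\sum_i b j ord0 i * tnth (obsZ x) i).
  by rewrite mulr_sumr; apply: eq_bigr => i _; rewrite mul1r mulrA.
have -> : \sum_i b j ord0 i * tnth (obsZ x) i =
    decision (beta0 + b j) (g0 \+ g j) x - decision beta0 g0 x - g j (obsT x).
  rewrite decisionB /decision /=.
  have -> : beta0 + b j - beta0 = b j by rewrite addrAC subrr add0r.
  by ring.
by rewrite /tau; ring.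
Qed.

Let envelope_le x : envelope e wt x <= (k1 / gam ^+ 2) ^+ 2.
Proof.
rewrite /envelope expr_div_n /k1 sqr_sqrtr ?mulr_ge0// -mulrA ler_wpM2l//.
rewrite ler_pdivlMr ?exprn_gt0// mulr_suml.
apply: le_trans (eigen_sqr_sum mer K_le Kb_ge0 m (obsT x)); apply: ler_sum => i _.
have w0 : 0 < wt i by rewrite addr_gt0 ?mulr_gt0 ?exprn_gt0.
rewrite -mulrA ler_piMr ?sqr_ge0// mulrC ler_pdivrMr// mul1r /wt.
have -> : (gam ^+ 2) ^+ 2 = gam ^+ 4 by ring.
by rewrite lerDr mulr_ge0 ?sqr_ge0// ltW.
Qed.

Let eigen_bound i t : `|eigen i t ^+ 2| <= Kb.
Proof.
rewrite ger0_norm ?sqr_ge0//; apply: le_trans (eigen_sqr_sum mer K_le Kb_ge0 i.+1 t).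
by rewrite big_ord_recr/= lerDr sumr_ge0// => k _; exact: sqr_ge0.
Qed.

Let me i : measurable_fun setT (eigen i) := measurable_eigen mT mer i.

(** The ratio of [mu i] to its weight is at most the minimum of [mu i] and
    [gamma ^ 2], divided by [gamma ^ 4]. *)
Let envelope_int : \int[rho]_x envelope e wt x <= 2 * 40 ^+ 2 * N.
Proof.
have fi (i : 'I_m) : rho.-integrable setT (EFin \o (fun x => e i x ^+ 2 / wt i)).
  have i1 : rho.-integrable setT (EFin \o (fun x => e i x ^+ 2)).
    apply: (@bounded_integrable _ _ _ _ _ Kb); last by move=> x; exact: eigen_bound.
    by apply: measurable_funX; exact: (measurableT_comp (me i) (@measurable_obsT R d p)).
  have := integrableZl measurableT ((wt i)^-1) i1.
  by apply: eq_integrable => // x _; rewrite /= mulrC.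
have [si se] := Rintegral_sum (index_enum 'I_m) measurableT fi.
rewrite /envelope RintegralZl// se -mulrA ler_wpM2l//.
apply: (@le_trans _ _ (\sum_(i < m) Num.min (gam ^+ 2) (mu i) / gam ^+ 4)).
  apply: ler_sum => i _.
  have -> : \int[rho]_x (e i x ^+ 2 / wt i) = mu i / wt i.
    rewrite RintegralZr//; last first.
      apply: (@bounded_integrable _ _ _ _ _ Kb); last by move=> x; exact: eigen_bound.
      by apply: measurable_funX; exact: (measurableT_comp (me i) (@measurable_obsT R d p)).
    rewrite (@Rintegral_obsT (fun t => eigen i t ^+ 2) Kb) //.
      by rewrite (integral_eigen_sqr mT mer).
    exact: measurable_funX.
  have w0 : 0 < wt i by rewrite addr_gt0 ?mulr_gt0 ?exprn_gt0.
  have m0 := mu_gt0 i; have q0 : 0 < gam ^+ 2 by rewrite exprn_gt0.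
  rewrite ler_pdivlMr ?exprn_gt0// mulrAC ler_pdivrMr//.
  have -> : mu i * gam ^+ 4 = gam ^+ 2 * (mu i * gam ^+ 2) by ring.
  rewrite /wt; move: q0 m0; set q := gam ^+ 2; set M := mu i => q0 m0.
  have -> : Num.min q M * (M * q + gam ^+ 4) = q * (Num.min q M * (M + q)) by rewrite /q; ring.
  rewrite ler_wpM2l ?(ltW q0)//; rewrite /Num.min; case: ifP => hm; nra.
rewrite -mulr_suml ler_pdivrMr ?exprn_gt0//.
apply: le_trans (critical_radius_sum_ge mT mer K_le Kb_ge0 n_gt0 nuP m _) _.
  by rewrite le_max lexx.
by rewrite le_eqVlt; apply/orP; left; apply/eqP; rewrite /N; ring.
Qed.

Let kernel_int j : \int[rho]_x (kernel_part al e j x ^+ 2) <= (gam ^+ 2)^-1.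
Proof.
have [_ t2 t3 _] := term_ge0 j.
have -> : (fun x => kernel_part al e j x ^+ 2) = (fun x => (sc j * g j (obsT x)) ^+ 2).
  by apply/funext => x; rewrite kernelE.
have gb t : `|g j t| <= ip_norm ip (g j) * Num.sqrt Kb by exact: (rkhs_bounded rk K_le Kb_ge0).
have gb2 t : `|g j t ^+ 2| <= (ip_norm ip (g j) * Num.sqrt Kb) ^+ 2.
  by rewrite normrX ler_sqr ?nnegrE// (le_trans _ (gb t)).
have mg2 : measurable_fun setT (fun t => g j t ^+ 2) by apply: measurable_funX; exact: mH.
rewrite (@Rintegral_obsT (fun t => (sc j * g j t) ^+ 2) (sc j ^+ 2 * (ip_norm ip (g j) * Num.sqrt Kb) ^+ 2)).
- have -> : (fun t => (sc j * g j t) ^+ 2) = (fun t => sc j ^+ 2 * g j t ^+ 2).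
    by apply/funext => t; rewrite exprMn.
  rewrite RintegralZl//; last exact: bounded_integrable gb2.
  rewrite (integral_setT_comb_sqr mT mer) -(L2norm_comb mT rk mer K_le Kb_ge0).
  rewrite -exprMn -[leRHS]mul1r ler_pdivlMr ?exprn_gt0// -exprMn expr_le1//.
    rewrite -mulrA [_ * gam]mulrC; apply: le_trans (sc_norms j).
    by rewrite ler_wpM2l ?(ltW (sc_gt0 j))// lerDl.
  by rewrite !mulr_ge0 ?L2norm_ge0// ltW.
- by apply: measurable_funX; apply: measurable_funM => //; exact: mH.
- by move=> t; rewrite exprMn normrM ger0_norm ?sqr_ge0// ler_wpM2l ?sqr_ge0.
Qed.

Lemma finite_class_deviation :
  pr P [set w | exists j, 2 * hinge_constant * deviation_rate (b j) (comb m (c j)) <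
    `|excess_process (beta0 + b j) (g0 \+ comb m (c j)) w| ] <= 16 * expR (- (2 * l)).
Proof.
have kv_gt0 : 0 < 2 * 40 ^+ 2 :> R by rewrite mulr_gt0// exprn_gt0.
have k1_gt0 : 0 < k1 by rewrite sqrtr_gt0 mulr_gt0.
have g2_gt0 : 0 < gam ^+ 2 by rewrite exprn_gt0.
have mh j : measurable_fun setT (h j).
  have -> : h j = (fun x => sc j * (chi x * margin_loss (beta0 + b j) (g0 \+ g j) x -
      chi x * margin_loss beta0 g0 x)) by apply/funext => x; exact: incrementE.
  by apply: measurable_funM => //; apply: measurable_funB;
    apply: measurable_funM; try exact: measurable_chi; apply: measurable_margin_loss; exact: mH.
have dev : pr P [set w | exists j, 2 * (hinge_constant * N) <
    `|ssum (h j) (sample W w) - N * \int[rho]_x h j x| ] <= 16 * expR (- (2 * l)).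
  apply: (hinge_class_deviation iid n_gt0 (g2 := gam ^+ 2) (wt := wt) (j0 := j0)) => //.
  - by move=> i; exact: (measurableT_comp (me i) (@measurable_obsT R d p)).
  - by move=> i; apply: measurable_funM; [exact: measurable_chi|exact: measurable_obsZ].
  - by apply: measurable_funM; [exact: measurable_chi|exact: measurable_obsY].
  - apply: measurable_funB => //; apply: measurable_funM; first exact: measurable_obsY.
    by apply: measurable_decision; exact: mH.
  - rewrite mulrC -ler_pdivrMr// -[leLHS]sqr_sqrtr; last by rewrite divr_ge0 ?ltW.
    by rewrite ler_sqr ?nnegrE ?sqrtr_ge0 ?(ltW gam_gt0)// le_max lexx orbT.
  - rewrite /l lnK// posrE ltr0n lt0n; apply/negP => /eqP p0.
    by move: l_gt0; rewrite /l p0 ln0// ltxx.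
  - by move=> i; rewrite addr_gt0 ?mulr_gt0 ?exprn_gt0.
  - by move=> j; rewrite ltW.
  - move=> x; rewrite /y; have [t|t] := pselect (typical_obs x).
      by rewrite indicT ?mul1r; [case: t => [[]-> _]; rewrite ?normrN normr1|].
    by rewrite indicF// mul0r normr0.
  - move=> i x; rewrite /z; have [t|t] := pselect (typical_obs x).
      by rewrite indicT// mul1r; case: t => _ [].
    by rewrite indicF// mul0r normr0 ltW.
  - by move=> i; rewrite /al c0 mulr0.
  - by move=> i; rewrite /bs b0 mxE mulr0.
have hint j : \int[rho]_x h j x = sc j * (risk rho (beta0 + b j) (g0 \+ g j) - risk rho beta0 g0).
  rewrite !riskE//.
  have i1 := chi_margin_integrable (beta0 + b j) (Hg0g j).
  have i2 := chi_margin_integrable beta0 Hg0.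
  rewrite -RintegralB// -RintegralZl//; last first.
    by have := integrableB measurableT i1 i2; apply: eq_integrable.
  by apply: eq_Rintegral => x _; exact: incrementE.
have excessE j w : typical_sample w -> ssum (h j) (sample W w) - N * \int[rho]_x h j x =
    N * sc j * excess_process (beta0 + b j) (g0 \+ g j) w.
  move=> tw; rewrite ssum_sample hint /excess_process /emp_process /emp_risk -/N.
  have -> : \sum_(i < n) h j (W i w) = sc j *
      (\sum_(i < n) margin_loss (beta0 + b j) (g0 \+ g j) (W i w) -
       \sum_(i < n) margin_loss beta0 g0 (W i w)).
    rewrite -sumrB mulr_sumr; apply: eq_bigr => i _.
    by rewrite incrementE (indicT (tw i)) !mul1r.
  by field; rewrite lt0r_neq0.
set A := [set w | _]; set B := [set w | _] in dev.
have mA : measurable A.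
  apply: measurable_exists => j; apply: measurable_set_ltr => //.
  by apply: measurableT_comp => //; apply: measurable_excess_process; exact: Hg0g.
have mB : measurable B.
  apply: measurable_exists => j; apply: (@measurable_sample_set _ _ _ _ _ P n W
    [set X | 2 * (hinge_constant * N) < `|ssum (h j) X - N * \int[rho]_x h j x| ]).
  apply: measurable_set_ltr => //; apply: measurableT_comp => //; apply: measurable_funB => //.
  exact: measurable_ssum.
have mC := measurableC measurable_typical_sample.
apply: (@le_trans _ _ (pr P (~` typical_sample `|` B))).
  apply: le_pr => //; first exact: measurableU.
  move=> w [j Aj]; have [tw|tw] := pselect (typical_sample w); [right|by left].
  exists j; rewrite (excessE _ _ tw) normrM gtr0_norm ?mulr_gt0//.
  rewrite (_ : 2 * (hinge_constant * N) =
    N * sc j * (2 * hinge_constant * deviation_rate (b j) (g j))); last first.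
    by rewrite /sc; field; rewrite lt0r_neq0// deviation_rate_gt0.
  by rewrite ltr_pM2l ?mulr_gt0.
by apply: le_trans (pr_setU P mC mB) _; rewrite typical_sample_pr add0r.
Qed.

End finite_class.

(** * Reduction to countably many decision functions *)

(** A linear part and a list of coefficients in the eigenfunctions, both rational,
    relative to the target. *)
Let coded := ('rV[rat]_p * seq rat)%type.

Definition rational_beta (t : coded) : 'rV[R]_p := map_mx ratr t.1.

Definition rational_coef (t : coded) (i : nat) : R := ratr (nth 0 t.2 i).

Definition rational_kernel (t : coded) : d.-tuple R -> R := comb (size t.2) (rational_coef t).

Local Notation rb := rational_beta.
Local Notation rg := rational_kernel.

Lemma rational_kernelE m t : (size t.2 <= m)%N -> comb m (rational_coef t) = rg t.
Proof.
move=> sm; apply/funext => x; rewrite /rg /comb (big_ord_widen m (fun i => rational_coef t i * eigen i x) sm).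
rewrite [RHS]big_mkcond; apply: eq_bigr => i _; case: ltnP => // si.
by rewrite /rational_coef nth_default// rmorph0 mul0r.
Qed.

Let Hrg t : H (rg t). Proof. exact: (comb_rkhs rk mer). Qed.

(** Finite combinations are dense, and their norm is the Euclidean norm of the
    coefficients. *)
Lemma rational_dense (b : 'rV[R]_p) (g : d.-tuple R -> R) (e : R) : H g -> 0 < e ->
  exists t, l1norm (b - rb t) <= e /\ ip_norm ip (g \- rg t) <= e.
Proof.
move=> Hg e0.
have ep : 0 < e / p.+1%:R by rewrite divr_gt0.
have /choice[q qP] : forall j : 'I_p, exists r : rat, `|b ord0 j - ratr r| < e / p.+1%:R.
  by move=> j; exact: rational_near.
have e2 : 0 < e / 2 by rewrite divr_gt0.
have [m mP] := comb_dense mT rk mer K_le Hg e2.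
have em : 0 < (e / 2) / m.+1%:R by rewrite divr_gt0.
have /choice[r rP] : forall i, exists s : rat, `|coef calT ip mu phi g i - ratr s| < (e / 2) / m.+1%:R.
  by move=> i; exact: rational_near.
exists (\row_j q j, mkseq r m); split.
  apply: (@le_trans _ _ (\sum_(j < p) e / p.+1%:R)).
    by apply: ler_sum => j _; rewrite !mxE ltW.
  rewrite sumr_const card_ord -[leLHS]mulr_natr -mulrA ler_piMr ?(ltW e0)// mulrC.
  by rewrite ler_pdivrMr// mul1r ler_nat.
set t := (_, _).
have Hm := comb_rkhs rk mer m (coef calT ip mu phi g).
have -> : g \- rg t = (g \- comb m (coef calT ip mu phi g)) \+
    comb m (fun i => coef calT ip mu phi g i - ratr (r i)).
  apply/funext => x /=.
  have -> : rg t x = \sum_(i < m) ratr (r i) * eigen i x.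
    rewrite -(@rational_kernelE m t) ?size_mkseq//; apply: eq_bigr => i _.
    by rewrite /rational_coef nth_mkseq.
  have -> : comb m (fun i => coef calT ip mu phi g i - ratr (r i)) x =
     comb m (coef calT ip mu phi g) x - \sum_(i < m) ratr (r i) * eigen i x.
    by rewrite /comb -sumrB; apply: eq_bigr => i _; rewrite mulrBl.
  by ring.
have Hd := comb_rkhs rk mer m (fun i => coef calT ip mu phi g i - ratr (r i)).
apply: le_trans (ip_normD rk (rkhsB rk Hg Hm) Hd) _.
rewrite [leRHS](splitr e) lerD ?(ltW mP)//.
rewrite -(@ler_pXn2r _ 2)// ?nnegrE ?ip_norm_ge0 ?(ltW e2)//.
rewrite (ip_norm_sqr rk Hd) (comb_ip mT rk mer K_le).
apply: (@le_trans _ _ (\sum_(i < m) ((e / 2) / m.+1%:R) ^+ 2)).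
  apply: ler_sum => i _; rewrite -[leLHS]real_normK ?num_real//.
  by rewrite ler_sqr ?nnegrE ?(ltW em)// ltW.
rewrite sumr_const card_ord -[leLHS]mulr_natr expr_div_n -mulrA ler_piMr ?sqr_ge0//.
rewrite mulrC ler_pdivrMr ?exprn_gt0// mul1r -natrX ler_nat.
by rewrite (leq_trans (leqnSn m))// expnS leq_pmulr// expn_gt0.
Qed.

Definition violation (D : R) t : set Omega :=
  [set w | D * deviation_rate (rb t) (rg t) <
    `|excess_process (beta0 + rb t) (g0 \+ rg t) w| ].

Lemma measurable_violation D t : measurable (violation D t).
Proof.
apply: measurable_set_ltr => //; apply: measurableT_comp => //.
by apply: measurable_excess_process; exact: (rkhsD rk Hg0 (Hrg t)).
Qed.

(** Both sides of the inequality defining the event are continuous in the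
    decision function, for the norm of the kernel space and a fixed sample.  The
    constant [M] collects the Lipschitz constants. *)
Lemma good_event_rational (D : R) : 0 <= D ->
  good_event W rho rhoT H ip beta0 g0 nu D = ~` \bigcup_t violation D t.
Proof.
move=> D0; apply/seteqP; split => [w Ew [t _]|w nw beta g Hg].
  rewrite /violation /= ltNge => /negP; apply.
  have := Ew (beta0 + rb t) (g0 \+ rg t) (rkhsD rk Hg0 (Hrg t)) => /=.
  have -> : beta0 + rb t - beta0 = rb t by rewrite addrAC subrr add0r.
  have -> // : (g0 \+ rg t) \- g0 = rg t.
  by apply/funext => x /=; rewrite addrAC subrr add0r.
rewrite /= -[leLHS]/(`|excess_process beta g w|).
rewrite -[X in _ <= D * X]/(deviation_rate (beta - beta0) (g \- g0)).
set b := beta - beta0; set f := g \- g0.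
have Hf : H f by exact: (rkhsB rk Hg Hg0).
have [L [L0 LP]] := emp_risk_lipschitz w.
set s := Num.sqrt Kb in LP; have s0 : 0 <= s by exact: sqrtr_ge0.
have lam0 : 0 <= lam by exact: sqrtr_ge0.
have gam0 := gamma_rate_gt0.
pose M := L * (1 + s) + (C0 + s) + D * (lam + gam * s + gam ^+ 2).
have M0 : 0 <= M.
  rewrite addr_ge0 ?addr_ge0 ?mulr_ge0 ?addr_ge0 ?mulr_ge0 ?sqr_ge0//; exact: ltW.
apply/ler_addgt0Pr => eps eps0.
have M1 : 0 < M + 1 by rewrite ltr_wpDl.
pose e := eps / (M + 1); have e0 : 0 < e by rewrite divr_gt0.
have [t [tb tg]] := rational_dense b Hf e0.
have Hrt := Hrg t; have Hft := rkhsB rk Hf Hrt.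
have Hgt := rkhsD rk Hg0 Hrt.
have l1e : beta - (beta0 + rb t) = b - rb t by rewrite opprD addrA.
have ge : g \- (g0 \+ rg t) = f \- rg t.
  by apply/funext => x /=; rewrite opprD addrA.
have h1 : `|excess_process beta g w - excess_process (beta0 + rb t) (g0 \+ rg t) w| <=
    (L * (1 + s) + (C0 + s)) * e.
  have := LP beta (beta0 + rb t) g (g0 \+ rg t) Hg Hgt.
  have := risk_lipschitz beta (beta0 + rb t) Hg Hgt.
  rewrite l1e ge -/s /excess_process /emp_process.
  set r1 := risk _ _ _; set r2 := risk _ _ _; set r3 := risk _ _ _.
  set e1 := emp_risk _ _ _; set e2 := emp_risk _ _ _; set e3 := emp_risk _ _ _.
  move=> hr he.
  have -> : e1 - r1 - (e3 - r3) - (e2 - r2 - (e3 - r3)) = (e1 - e2) - (r1 - r2) by ring.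
  apply: le_trans (ler_normB _ _) _; rewrite mulrDl; apply: lerD.
    apply: le_trans he _; rewrite -mulrA ler_wpM2l// mulrDl mul1r lerD//.
    by rewrite mulrC ler_wpM2l.
  apply: le_trans hr _; rewrite mulrDl lerD//; first by rewrite ler_wpM2l// ltW.
  by rewrite mulrC ler_wpM2l.
have h2 : `|excess_process (beta0 + rb t) (g0 \+ rg t) w| <= D * deviation_rate (rb t) (rg t).
  by rewrite leNgt; apply/negP => h; apply: nw; exists t.
have h3 : deviation_rate (rb t) (rg t) <=
    deviation_rate b f + (lam + gam * s + gam ^+ 2) * e.
  have l1 : l1norm (rb t) <= l1norm b + e.
    have -> : rb t = b + - (b - rb t) by rewrite opprB addrC subrK.
    apply: le_trans (l1normD _ _) _; rewrite lerD2l; apply: le_trans tb.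
    by rewrite /l1norm ler_sum// => j _; rewrite mxE normrN.
  have fE : rg t = f \+ (rg t \- f) by apply/funext => x /=; rewrite addrC subrK.
  have tg' : ip_norm ip (rg t \- f) <= e by rewrite (ip_normN rk).
  have Htf := rkhsB rk Hrt Hf.
  have l2 : L2norm rhoT (rg t) <= L2norm rhoT f + s * e.
    rewrite {1}fE; pose B := (ip_norm ip f + ip_norm ip (rg t \- f)) * s.
    apply: le_trans (L2normD rhoT (B := B) _ _ _ _) _.
    - exact: mH.
    - exact: mH.
    - move=> x; apply: le_trans (rkhs_bounded rk K_le Kb_ge0 x Hf) _.
      by rewrite ler_wpM2r// lerDl ip_norm_ge0.
    - move=> x; apply: le_trans (rkhs_bounded rk K_le Kb_ge0 x Htf) _.
      by rewrite ler_wpM2r// lerDr ip_norm_ge0.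
    rewrite lerD2l; apply: (@L2norm_le _ _ _ rhoT (rg t \- f) (s * e)); first exact: mH.
    move=> x; apply: le_trans (rkhs_bounded rk K_le Kb_ge0 x Htf) _.
    by rewrite mulrC ler_wpM2l.
  have l3 : ip_norm ip (rg t) <= ip_norm ip f + e.
    by rewrite {1}fE; apply: le_trans (ip_normD rk Hf Htf) _; rewrite lerD2l.
  rewrite /deviation_rate.
  have m1 := ler_wpM2l lam0 l1; have m2 := ler_wpM2l (ltW gam0) l2.
  have m3 := ler_wpM2l (sqr_ge0 gam) l3; move: m1 m2 m3; lra.
have h4 := ler_wpM2l D0 h3.
have h5 : M * e <= eps.
  by rewrite /e mulrA ler_pdivrMr// [leRHS]mulrC ler_wpM2r ?(ltW eps0)// lerDl.
have h6 : `|excess_process beta g w| <= (L * (1 + s) + (C0 + s)) * e +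
    `|excess_process (beta0 + rb t) (g0 \+ rg t) w|.
  by apply: le_trans (lerD h1 (lexx _)); apply: le_trans (ler_normD _ _); rewrite subrK.
move: h5; rewrite /M; lra.
Qed.

(** The violations by the first [N] decision functions are covered by a finite class
    to which the target is added as the index [None]. *)
Lemma good_event_probability :
  1 <= ln p%:R :> R -> 32 * expR (- (2 * ln p%:R)) <= 1 :> R ->
  measurable (good_event W rho rhoT H ip beta0 g0 nu (2 * hinge_constant)) /\
  ((1 - 16 * expR (- (2 * ln p%:R)))%:E <=
   P (good_event W rho rhoT H ip beta0 g0 nu (2 * hinge_constant)))%E.
Proof.
move=> l1 l32; set D := 2 * hinge_constant; set del : R := 16 * _.
have D0 : 0 <= D.
  rewrite mulr_ge0// /hinge_constant /deviation_constant.
  by rewrite !addr_ge0// ?mulr_ge0 ?sqr_ge0 ?sqrtr_ge0// ltW.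
rewrite good_event_rational//.
have ctd : countable [set: coded] by exact: countableP.
have mU : measurable (\bigcup_t violation D t).
  by apply: countable_bigcupT_measurable => // t; exact: measurable_violation.
split; first exact: measurableC.
pose t_ (k : nat) : coded := odflt (0, [::]) (unpickle k).
pose F (N : nat) : set Omega := [set w | exists j : 'I_N, violation D (t_ j) w].
have mF N : measurable (F N) by apply: measurable_exists => j; exact: measurable_violation.
have UF : \bigcup_t violation D t = \bigcup_N F N.
  apply/seteqP; split => [w [t _ tw]|w [N _ [j jw]]]; last by exists (t_ j).
  exists (pickle t).+1 => //; exists ord_max; by rewrite /t_ /= pickleK.
have Fle N : (P (F N) <= del%:E)%E.
  rewrite -(prE P (mF N)) lee_fin.
  pose m := \max_(j < N) size (t_ j).2.
  pose tj (j : option 'I_N) : coded := if j is Some j then t_ j else (0, [::]).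
  have sm j : (size (tj j).2 <= m)%N by case: j => //= j; exact: (leq_bigmax j).
  have cE j : comb m (rational_coef (tj j)) = rg (tj j) by exact: rational_kernelE.
  have vE : [set w | exists j, D * deviation_rate (rb (tj j)) (comb m (rational_coef (tj j))) <
      `|excess_process (beta0 + rb (tj j)) (g0 \+ comb m (rational_coef (tj j))) w| ] =
      [set w | exists j, violation D (tj j) w].
    by apply/seteqP; split => w [j jw]; exists j; move: jw; rewrite /violation /= cE.
  have mv : measurable [set w | exists j, violation D (tj j) w].
    by apply: measurable_exists => j; exact: measurable_violation.
  have := @finite_class_deviation (option 'I_N) None m (fun j => rb (tj j))
    (fun j => rational_coef (tj j)) _ _ l1 l32.
  rewrite -/D vE -/del => h; apply: le_trans (h _ _).
  - by apply: le_pr => // w [j jw]; exists (Some j).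
  - by rewrite /rational_beta /= map_mx0.
  - by move=> i; rewrite /rational_coef /= nth_nil rmorph0.
have ndF : nondecreasing_seq F.
  move=> N M NM; apply/subsetPset => w [j jw].
  by exists (widen_ord NM j).
have PU : (P (\bigcup_t violation D t) <= del%:E)%E.
  have mUF : measurable (\bigcup_N F N) by rewrite -UF.
  rewrite UF; apply: (cvge_to_le (nondecreasing_cvg_mu mF mUF ndF)).
  by apply: nearW => N /=.
rewrite probability_setC// EFinB leeB//.
Qed.

End hinge_class.

(** * The deviation bound *)

Theorem lemma1 (R : realType) :
  exists2 A : R, 3 < A &
  forall (d : nat) (calT : set (d.-tuple R))
    (K : d.-tuple R -> d.-tuple R -> R)
    (H : set (d.-tuple R -> R))
    (ip : (d.-tuple R -> R) -> (d.-tuple R -> R) -> R)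
    (rhoT : probability (d.-tuple R) R)
    (mu : nat -> R) (phi : nat -> d.-tuple R -> R) (C0 Lmax : R),
  compact (row_of_tuple @` calT) ->
  {ae rhoT, forall t, calT t} ->
  psd_kernel calT K ->
  has_ubound [set K t t | t in calT] ->
  is_rkhs calT K H ip ->
  is_mercer calT K rhoT mu phi ->
  0 < C0 -> 0 < Lmax ->
  exists2 D0 : R, 0 < D0 &
  forall p : nat -> nat, Omega_log R p -> little_o_exp R p ->
  forall (n : nat) (dO : measure_display) (Omega : measurableType dO)
    (P : probability Omega R)
    (rho : probability (obs R (p n) d) R)
    (W : 'I_n -> {RV P >-> obs R (p n) d})
    (beta0 : 'rV[R]_(p n)) (g0 : d.-tuple R -> R) (nu : R),
  (0 < n)%N ->
  {ae rho, forall w, obsY w = -1 \/ obsY w = 1} ->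
  (forall B, measurable B -> rho (obsT @^-1` B) = rhoT B) ->
  assumption_A C0 Lmax rho ->
  is_iid rho W ->
  risk_minimizer rho H beta0 g0 ->
  is_critical_radius mu n nu ->
  let E := good_event W rho rhoT H ip beta0 g0 nu D0 in
  measurable E /\
  ((1 - 2 * (p n)%:R `^ (- (A / 2)) - 16 * (p n)%:R `^ (3 - A))%:E <= P E)%E.
Proof.
exists 4 => [|d calT K H ip rhoT mu phi C0 Lmax cT aeT psd [B0 B0P] rk mer C0_gt0 _].
  by rewrite ltr_nat.
pose Kb := Num.max B0 1.
have Kb_gt0 : 0 < Kb by rewrite lt_max ltr01 orbT.
have K_le t : calT t -> K t t <= Kb.
  by move=> Tt; rewrite le_max; apply/orP; left; apply: B0P; exists t.
have mT : measurable calT by exact: measurable_compact.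
have D0_gt0 : 0 < 2 * hinge_constant C0 Kb.
  rewrite mulr_gt0// /hinge_constant /deviation_constant ltr_wpDl ?mulr_gt0//.
  by rewrite !addr_ge0// ?mulr_ge0 ?sqr_ge0 ?sqrtr_ge0// ltW.
exists (2 * hinge_constant C0 Kb) => //.
move=> p_ _ _ n dO Omega P rho; set p := p_ n => W beta0 g0 nu n_gt0 aeY rhoTE
  [aeZ [a [ev _] _]] iid [Hg0 _] nuP E.
(* A matrix of size 0 has no eigenvalue. *)
have p_gt0 : (0 < p)%N.
  rewrite lt0n; apply/negP => /eqP p0; move/negP: ev; apply.
  by have := rank_leq_row (eigenspace (second_moment rho) a); rewrite [X in (_ <= X)%N]p0 leqn0 mxrank_eq0.
have pR : 0 < p%:R :> R by rewrite ltr0n.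
rewrite (_ : 3 - 4 = -1 :> R); last by ring.
rewrite [_ `^ -1]powRN powRr1 ?(ltW pR)//; set q := _ `^ _.
have q0 : 0 <= q by exact: powR_ge0.
(* Below this threshold the term [16 / p] makes the bound trivial. *)
have [p16|p17] := leqP p 16.
  split.
    rewrite /E (good_event_rational mT aeT rk mer K_le Kb_gt0 C0_gt0 W beta0 aeY rhoTE aeZ Hg0 nuP) ?(ltW D0_gt0)//.
    apply: measurableC; apply: countable_bigcupT_measurable; first exact: countableP.
    by move=> t; exact: (measurable_violation mT rk mer).
  apply: (@le_trans _ _ 0%E); last exact: measure_ge0.
  rewrite lee_fin; have : 1 <= 16 / p%:R :> R by rewrite ler_pdivlMr// mul1r ler_nat.
  by move=> h; lra.
have l_ge1 : 1 <= ln p%:R :> R.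
  rewrite -ler_expR lnK ?posrE//; apply: (@le_trans _ _ 4); last first.
    by rewrite ler_nat; apply: leq_trans p17.
  have e2 : expR (1 / 2) <= 2 :> R.
    have := expR_ge1Dx (- (1 / 2) : R); rewrite expRN => h.
    by rewrite -[leLHS]invrK -[leRHS]invrK lef_pV2 ?posrE ?invr_gt0 ?expR_gt0//; lra.
  have -> : expR 1 = expR (1 / 2) ^+ 2 :> R by rewrite -expRM_natl; congr expR; field.
  by have := expR_gt0 (1 / 2 : R); nra.
have eE : expR (- (2 * ln p%:R)) = (p%:R ^+ 2)^-1 :> R.
  by rewrite expRN expRM_natl lnK ?posrE.
have pp : (p%:R ^+ 2)^-1 <= p%:R^-1 :> R.
  by rewrite lef_pV2 ?posrE ?exprn_gt0// expr2 ler_peMl ?(ltW pR)// ler1n.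
have [|mE PE] := good_event_probability mT aeT rk mer K_le Kb_gt0 C0_gt0 beta0 n_gt0 aeY
  rhoTE aeZ iid Hg0 nuP l_ge1.
  rewrite eE ler_pdivrMr ?exprn_gt0// mul1r -natrX ler_nat.
  by rewrite -mulnn; apply: leq_trans (leq_mul p17 p17).
split => //; apply: le_trans PE; rewrite lee_fin -/p eE; lra.
Qed.
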